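(* Let $f_n:\mathbb{D}\to\mathbb{D}$, $n\in\mathbb{N}$, be inner functions such that $f_n(0)=0$ for all $n\in\mathbb{N}$, and assume that $F_n := f_n\circ f_{n-1}\circ\cdots\circ f_1$ converges locally uniformly in $\mathbb{D}$ to some $F:\mathbb{D}\to\mathbb{D}$. Then $F$ is either constant or an inner function, and the latter happens if and only if \[ \sum_{n\geq 1} (1 - |f_n'(0)|) < +\infty. \]
   Context: $\mathbb{D}=\{z\in\mathbb{C}:|z|<1\}$ is the open unit disc and $\mathbb{N}=\{1,2,3,\dots\}$. An inner function is a holomorphic function $f:\mathbb{D}\to\mathbb{D}$ such that the radial limits $f(e^{i\theta}) := \lim_{r\nearrow 1} f(re^{i\theta})$ exist and satisfy $|f(e^{i\theta})|=1$ for Lebesgue-a.e. $\theta\in[0,2\pi)$. *)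

(* Defs.v *)
From HB Require Import structures.
From mathcomp Require Export all_boot all_order all_algebra.
From mathcomp Require Export all_classical all_reals all_analysis.
From mathcomp Require Export complex.

Set Implicit Arguments.
Unset Strict Implicit.
Unset Printing Implicit Defensive.

Import Order.TTheory GRing.Theory Num.Theory.
Import numFieldNormedType.Exports.

Local Open Scope classical_set_scope.
Local Open Scope ring_scope.
Local Open Scope complex_scope.

(* R[i] as a normed module over itself, so that [derivable f z 1] and
   [derive1 f z] below are complex differentiability and the complex derivative. *)
HB.instance Definition _ (R : rcfType) := NormedModule.copy R[i] R[i]^o.

(* Functions on the disc are total functions on R[i]; only their values on
   [disc R] are ever constrained or observed. *)
Definition disc (R : realType) : set R[i] := [set z | `|z| < 1].

Definition maps_disc (R : realType) (f : R[i] -> R[i]) : Prop :=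
  forall z, disc z -> disc (f z).

Definition holomorphic_disc (R : realType) (f : R[i] -> R[i]) : Prop :=
  forall z, disc z -> derivable f z 1.

Definition expi (R : realType) (t : R) : R[i] := cos t +i* sin t.

Definition radial_limit (R : realType) (f : R[i] -> R[i]) (t : R) (l : R[i])
    : Prop :=
  f (r%:C * expi t) @[r --> (1 : R)^'-] --> l.

Definition inner (R : realType) (f : R[i] -> R[i]) : Prop :=
  [/\ holomorphic_disc f,
      maps_disc f &
      {ae (@lebesgue_measure R), forall t : R, t \in `[0, 2 * pi[ ->
        exists l : R[i], radial_limit f t l /\ `|l| = 1}].

Definition constant_disc (R : realType) (f : R[i] -> R[i]) : Prop :=
  exists c : R[i], forall z, disc z -> f z = c.

(* [iter_comp f n] is f_n o ... o f_1; the value [f 0] is not used. *)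
Fixpoint iter_comp (T : Type) (f : nat -> T -> T) (n : nat) : T -> T :=
  if n is m.+1 then f m.+1 \o iter_comp f m else id.

Definition cvg_locally_uniformly_disc (R : realType)
    (G : nat -> R[i] -> R[i]) (F : R[i] -> R[i]) : Prop :=
  forall z, disc z ->
    exists2 U : set R[i], nbhs z U & {uniform U `&` @disc R, G @ \oo --> F}.

(* Main.v *)
(* Let S_n be the sum of the first n defects 1 - |f_k'(0)|.
   If S_n is unbounded, Harnack's inequality applied to 1 - |f_k(z)/z| makes each
   f_k contract moduli below |z| by a factor 1 - (1 - |z|)/2 * (1 - |f_k'(0)|), so
   |F_n(z)| (1 + (1 - |z|)/2 * S_n) <= 1 and F = 0.
   Call f "of unit mean" when its mean square over |z| = r tends to 1 along a
   sequence r -> 1; by dominated convergence inner functions are of unit mean.  If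
   S_n is bounded, write F_n = g o F_m with g the composition of f_{m+1}, ..., f_n:
   the mean squares of F_m and F_n on a circle differ by at most 2(1 - |g'(0)|),
   hence by at most twice a tail of the series, and F is of unit mean as a locally
   uniform limit.
   Conversely a self-map F of unit mean is inner.  Its Taylor coefficients then have
   square sum 1, so the tails z^K g_K of its Taylor series are small in mean square;
   the Hardy-Littlewood maximal inequality makes them small on almost every whole
   radius, which gives radial limits almost everywhere, and dominated convergence
   identifies their modulus.  Cauchy's formula comes from Goursat's theorem on
   rectangles, which exp carries to annuli. *)

(* Boundary values do not compose well: g o phi meets the circle only through the radial limits of
   phi. Mean squares avoid this. If phi(0) = 0, write g(w) = g(0) + w g_1(w); after substituting phi
   the two terms stay orthogonal, as phi g_1(phi) has mean 0, and replacing |phi|^2 by 1 costs at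
   most a multiple of 1 - m2(phi). After N such splittings the first N Taylor coefficients of g are
   recovered up to C_N (1 - m2(phi)), with C_N independent of the radius. N is chosen before the
   radius, so crude bounds on the remainders suffice. The price is the way back from mean squares to
   radial limits. A Taylor polynomial is continuous up to the circle, so only tails matter, but they
   must be small on whole radii at once: this is why a maximal function is needed. Contours occur
   only as means over the angle. In the coordinates log|z| and arg z the form dz/z becomes a
   constant one, so Goursat on a rectangle says that two circle means agree. A difference quotient
   is only known to be continuous at its base point; that point is crossed by continuity of the mean
   in the radius. *)
Require Import Defs.
From mathcomp Require Import ring lra measurable_realfun.

Import Order.TTheory GRing.Theory Num.Theory.
Import numFieldNormedType.Exports.
Import ComplexField.Normc.

Local Open Scope classical_set_scope.
Local Open Scope ring_scope.
Local Open Scope complex_scope.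

Set Implicit Arguments.
Unset Strict Implicit.
Unset Printing Implicit Defensive.

(** * Complex numbers and complex differentiability *)

Section ComplexTopology.
Variable R : realType.
Implicit Types (z w : R[i]).

Lemma normCE z : `|z| = (normc z)%:C.
Proof. by case: z. Qed.

Lemma normc_ge0 z : 0 <= normc z.
Proof. by case: z => a b; exact: sqrtr_ge0. Qed.

Lemma discE z : disc z <-> normc z < 1.
Proof. by rewrite /disc /= normCE -[1 in X in X <-> _]/(1%:C) ltcR. Qed.

Lemma normc_leD z w : normc (z + w) <= normc z + normc w.
Proof. exact: le_normcD. Qed.

Lemma normc_N z : normc (- z) = normc z.
Proof. exact: normcN. Qed.

Lemma normc_sub z w : normc (z - w) = normc (w - z).
Proof. by rewrite -normc_N opprB. Qed.

Lemma normc_Re z : `|complex.Re z| <= normc z.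
Proof.
case: z => a b /=; rewrite -sqrtr_sqr ler_sqrt ?addr_ge0 ?sqr_ge0//.
by rewrite lerDl sqr_ge0.
Qed.

Lemma normc_Im z : `|complex.Im z| <= normc z.
Proof.
case: z => a b /=; rewrite -sqrtr_sqr ler_sqrt ?addr_ge0 ?sqr_ge0//.
by rewrite lerDr sqr_ge0.
Qed.

Lemma normc_real (r : R) : normc r%:C = `|r|.
Proof. by rewrite /= expr0n /= addr0 sqrtr_sqr. Qed.

Lemma sqr_normcE z : normc z ^+ 2 = complex.Re z ^+ 2 + complex.Im z ^+ 2.
Proof. by case: z => a b /=; rewrite sqr_sqrtr ?addr_ge0 ?sqr_ge0. Qed.

Lemma normc_le_ReIm z : normc z <= `|complex.Re z| + `|complex.Im z|.
Proof.
rewrite -(@ler_pXn2r _ 2) ?nnegrE ?normc_ge0 ?addr_ge0//.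
rewrite sqr_normcE sqrrD !real_normK ?num_real// addrAC lerDl.
by rewrite mulrn_wge0 ?mulr_ge0.
Qed.

Lemma normc_expi (t : R) : normc (expi t) = 1.
Proof. by rewrite /= cos2Dsin2 sqrtr1. Qed.

Lemma normcX z n : normc (z ^+ n) = normc z ^+ n.
Proof. by elim: n => [|n IH]; rewrite ?expr0 ?normc1// !exprS normcM IH. Qed.

Lemma normc_gt0 z : (0 < normc z) = (z != 0).
Proof.
rewrite lt_neqAle normc_ge0 andbT eq_sym; congr (~~ _).
by apply/eqP/eqP => [/eq0_normc//|->]; rewrite normc0.
Qed.

Lemma normcJ z : normc z^*%C = normc z.
Proof. by case: z => a b /=; rewrite sqrrN. Qed.

Lemma mulcJ z : z * z^*%C = (normc z ^+ 2)%:C.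
Proof. by rewrite -sqr_normc normCE -rmorphXn. Qed.

Lemma cvgCP (T : Type) (F : set_system T) (FF : Filter F) (u : T -> R[i]) l :
  u t @[t --> F] --> l <->
  (forall e : R, 0 < e -> \forall t \near F, normc (l - u t) <= e).
Proof.
split=> [/cvgrPdist_le ul e e0|ul].
  have /ul : 0 < e%:C :> R[i] by rewrite ltcR.
  by apply: filterS => t; rewrite normCE lecR.
(* A positive element of [R[i]] has zero imaginary part, so the complex radius is a real one. *)
apply/cvgrPdist_le => -[a b]; rewrite ltcE /= => /andP[/eqP b0 a0].
rewrite b0; have := ul _ a0; apply: filterS => t; rewrite normCE.
by rewrite -[a +i* 0]/(a%:C) lecR.
Qed.

Lemma near_normc z (e : R) : 0 < e -> \forall w \near z, normc (z - w) <= e.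
Proof.
move=> e0; have F : Filter (nbhs (z : R[i])) by exact: nbhs_filter.
by have /cvgCP := @cvg_id _ (nbhs z); exact.
Qed.

End ComplexTopology.

Section ContinuousC.
Variables (R : realType) (T : topologicalType).
Implicit Types (f g : T -> R[i]) (x : T).

(* Continuity with real radii: the balls of [R[i]] have their radii in [R[i]]. *)
Definition cts f x := forall e : R, 0 < e ->
  \forall y \near x, normc (f y - f x) <= e.

Lemma ctsP f x : cts f x <-> {for x, continuous f}.
Proof.
split=> [cf|/(@cvgCP _ _ _ (nbhs_filter x)) cf] => [|e e0].
  apply/(@cvgCP _ _ _ (nbhs_filter x)) => e e0; have := cf e e0.
  by apply: filterS => y; rewrite normc_sub.
by have := cf e e0; apply: filterS => y; rewrite normc_sub.
Qed.

Lemma cts_cst (c : R[i]) x : cts (fun=> c) x.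
Proof. by move=> e e0; near=> y; rewrite subrr normc0 ltW. Unshelve. all: end_near. Qed.

Lemma cts_lip f x (h : T -> R[i]) (k : R) :
  (forall y, normc (h y - h x) <= k * normc (f y - f x)) -> cts f x -> cts h x.
Proof.
move=> fh cf e e0.
have k1 : 0 < `|k| + 1 by rewrite ltr_wpDl.
have : 0 < e / (`|k| + 1) by rewrite divr_gt0.
move=> /cf; apply: filterS => y h1; apply: le_trans (fh y) _.
apply: (@le_trans _ _ ((`|k| + 1) * normc (f y - f x))).
  by rewrite ler_wpM2r ?normc_ge0// (le_trans (ler_norm _))// lerDl.
by rewrite mulrC -ler_pdivlMr.
Qed.

Lemma ctsD f g x : cts f x -> cts g x -> cts (fun y => f y + g y) x.
Proof.
move=> cf cg e e0; near=> y.
rewrite (_ : _ - _ = (f y - f x) + (g y - g x)); last by ring.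
rewrite (le_trans (normc_leD _ _))// (splitr e) lerD//; near: y.
  by apply: cf; rewrite divr_gt0.
by apply: cg; rewrite divr_gt0.
Unshelve. all: end_near. Qed.

Lemma ctsN f x : cts f x -> cts (fun y => - f y) x.
Proof. by apply: (@cts_lip _ _ _ 1) => y; rewrite -opprD normc_N mul1r. Qed.

Lemma ctsB f g x : cts f x -> cts g x -> cts (fun y => f y - g y) x.
Proof. by move=> cf cg; apply: ctsD => //; exact: ctsN. Qed.

Lemma ctsM f g x : cts f x -> cts g x -> cts (fun y => f y * g y) x.
Proof.
move=> cf cg e e0.
pose M := normc (f x) + normc (g x) + 1.
have M0 : 0 < M by rewrite ltr_wpDl// addr_ge0 ?normc_ge0.
(* With both increments at most [d <= 1], the three terms of the expansion add up to at most
   [d * M]. *)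
pose d := Num.min 1 (e / (M + M)).
have d0 : 0 < d by rewrite lt_min ltr01 divr_gt0// addr_gt0.
near=> y.
rewrite (_ : _ - _ = (f y - f x) * (g y - g x) + (f y - f x) * g x +
   f x * (g y - g x)); last by ring.
have fd : normc (f y - f x) <= d by near: y; exact: cf.
have gd : normc (g y - g x) <= d by near: y; exact: cg.
have d1 : d <= 1 by rewrite /d ge_min lexx.
have dM : d * (M + M) <= e.
  have M2 : 0 < M + M by rewrite addr_gt0.
  by rewrite -ler_pdivlMr// /d ge_min lexx orbT.
apply: le_trans (normc_leD _ _) _; apply: le_trans (lerD (normc_leD _ _) (lexx _)) _.
rewrite !normcM; apply: le_trans dM.
have := normc_ge0 (f y - f x); have := normc_ge0 (g y - g x).
have := normc_ge0 (f x); have := normc_ge0 (g x); rewrite /M.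
move: fd gd d1; move: (normc (f y - f x)) (normc (g y - g x)) (normc (f x)) (normc (g x)).
move=> a b c h *; nra.
Unshelve. all: end_near. Qed.

Lemma ctsV f x : f x != 0 -> cts f x -> cts (fun y => (f y)^-1) x.
Proof.
move=> f0 cf e e0.
pose M := normc (f x).
have M0 : 0 < M by rewrite normc_gt0.
(* The first bound keeps [normc (f y)] above [M / 2]; the second bounds the increment divided by
   [normc (f y) * M]. *)
pose d := Num.min (M / 2) (e * (M * M / 2)).
have d0 : 0 < d by rewrite lt_min divr_gt0//= mulr_gt0// divr_gt0// mulr_gt0.
near=> y.
have fd : normc (f y - f x) <= d by near: y; exact: cf.
have d1 : d <= M / 2 by rewrite /d ge_min lexx.
have dM : d <= e * (M * M / 2) by rewrite /d ge_min lexx orbT.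
have My : M / 2 <= normc (f y).
  by have := normc_leD (f y) (f x - f y); rewrite addrC subrK normc_sub -/M; lra.
have fy0 : f y != 0 by rewrite -normc_gt0 (lt_le_trans _ My)// divr_gt0.
rewrite (_ : _ - _ = - (f y - f x) * ((f y)^-1 * (f x)^-1)); last by field; rewrite f0 fy0.
rewrite !normcM normc_N !normcV -/M -invfM ler_pdivrMr ?mulr_gt0//; last first.
  by rewrite (lt_le_trans _ My)// divr_gt0.
apply: le_trans fd _; apply: le_trans dM _.
rewrite ler_wpM2l ?(ltW e0)// mulrAC ler_wpM2r ?(ltW M0)//.
Unshelve. all: end_near. Qed.

Lemma ctsX f n x : cts f x -> cts (fun y => f y ^+ n) x.
Proof.
move=> cf; elim: n => [|n IH]; first exact: cts_cst.
rewrite (_ : (fun y => f y ^+ n.+1) = fun y => f y * f y ^+ n); first exact: ctsM.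
by apply/funext => y; rewrite exprS.
Qed.

Lemma cts_sum (I : Type) (s : seq I) (u : I -> T -> R[i]) x :
  (forall i, cts (u i) x) -> cts (fun y => \sum_(i <- s) u i y) x.
Proof.
move=> cu; elim: s => [|i s IH].
  rewrite (_ : (fun y => _) = fun=> 0); first exact: cts_cst.
  by apply/funext => y; rewrite big_nil.
rewrite (_ : (fun y => _) = fun y => u i y + \sum_(i <- s) u i y); first exact: ctsD.
by apply/funext => y; rewrite big_cons.
Qed.

Lemma cts_Re f x : cts f x -> {for x, continuous (fun y => complex.Re (f y))}.
Proof.
move=> cf; apply/(@cvgrPdist_le _ _ _ _ (nbhs_filter x)) => e e0.
have := cf e e0; apply: filterS => y; apply: le_trans.
by rewrite distrC -raddfB; exact: normc_Re.
Qed.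

Lemma cts_Im f x : cts f x -> {for x, continuous (fun y => complex.Im (f y))}.
Proof.
move=> cf; apply/(@cvgrPdist_le _ _ _ _ (nbhs_filter x)) => e e0.
have := cf e e0; apply: filterS => y; apply: le_trans.
by rewrite distrC -raddfB; exact: normc_Im.
Qed.

Lemma normc_lip (z w : R[i]) : `|normc z - normc w| <= normc (z - w).
Proof.
have := normc_leD (z - w) w; have := normc_leD (w - z) z.
rewrite !subrK (normc_sub w) ler_norml lerBlDr lerNl opprB lerBlDr => h1 h2.
by rewrite h1 h2.
Qed.

Lemma cts_normc f x : cts f x -> {for x, continuous (fun y => normc (f y))}.
Proof.
move=> cf; apply/(@cvgrPdist_le _ _ _ _ (nbhs_filter x)) => e e0.
have := cf e e0; apply: filterS => y; apply: le_trans.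
by rewrite distrC; exact: normc_lip.
Qed.

Lemma cts_ReIm (u v : T -> R) x : {for x, continuous u} -> {for x, continuous v} ->
  cts (fun y => u y +i* v y) x.
Proof.
move=> /(@cvgrPdist_le _ _ _ _ (nbhs_filter x)) cu.
move=> /(@cvgrPdist_le _ _ _ _ (nbhs_filter x)) cv e e0; near=> y.
apply: le_trans (normc_le_ReIm _) _; rewrite /= (splitr e) distrC (distrC (v y)).
rewrite lerD//; near: y.
  by apply: cu; rewrite divr_gt0.
by apply: cv; rewrite divr_gt0.
Unshelve. all: end_near. Qed.

Lemma cts_real (u : T -> R) x : {for x, continuous u} -> cts (fun y => (u y)%:C : R[i]) x.
Proof. by move=> cu; apply: cts_ReIm => //; exact: cst_continuous. Qed.

End ContinuousC.

Section CtsComp.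
Variable R : realType.

Lemma cts_id (z : R[i]) : cts (fun w : R[i] => w) z.
Proof. by move=> e e0; have := near_normc z e0; apply: filterS => w; rewrite normc_sub. Qed.

Lemma cts_comp (T : topologicalType) (f : T -> R[i]) (h : R[i] -> R[i]) x :
  cts f x -> cts h (f x) -> cts (fun y => h (f y)) x.
Proof.
move=> /ctsP cf ch e e0.
exact: cf (ch e e0).
Qed.

Lemma cts_expi (t : R) : cts (@expi R) t.
Proof.
by apply: cts_ReIm; [exact: continuous_cos|exact: continuous_sin].
Qed.

End CtsComp.

Section ComplexDerivative.
Variable R : realType.
Implicit Types (z w : R[i]) (f g q : R[i] -> R[i]).

Lemma nbhsCP z (P : set R[i]) :
  nbhs z P <-> exists2 d : R, 0 < d & forall w, normc (w - z) < d -> P w.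
Proof.
split=> [/nbhs_ballP[[d1 d2]]|[d d0 dP]].
  rewrite /= ltcE /= => /andP[/eqP -> d0] dP; exists d1 => // w wd.
  by apply: dP; rewrite -ball_normE /= distrC normCE -[d1 +i* 0]/(d1%:C) ltcR.
apply/nbhs_ballP; exists d%:C => [|w /=]; first by rewrite /= ltcR.
by rewrite -ball_normE /= distrC normCE ltcR; exact: dP.
Qed.

(* An inductive wrapper, to keep unification from unfolding [derivable]. *)
Variant holo f z : Prop := Holo of derivable f z 1.

Definition cderiv f z : R[i] := derive1 f z.

(** Free of division, so [w = z] needs no exception, and all radii are real. *)
Lemma holo_epsP f z l :
  (holo f z /\ cderiv f z = l) <->
  (forall e : R, 0 < e -> exists2 d : R, 0 < d & forall w, normc (w - z) < d ->
    normc (f w - f z - l * (w - z)) <= e * normc (w - z)).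
Proof.
have E : (holo f z /\ cderiv f z = l) <->
    h^-1 *: (f (h + z) - f z) @[h --> 0^'] --> l.
  rewrite /cderiv /derive1; split => [[[]]|c].
    rewrite /derivable /= => c <-.
    by move: c; rewrite (_ : (fun h => h^-1 *: (f (h *: 1 + z) - f z)) =
      (fun h => h^-1 *: (f (h + z) - f z)) )//; apply/funext => h; rewrite /GRing.scale /= mulr1.
  split; last exact: cvg_lim.
  split; rewrite /derivable /= (_ : (fun h => h^-1 *: (f (h *: 1 + z) - f z)) =
      (fun h => h^-1 *: (f (h + z) - f z))).
    by apply/cvg_ex; exists l.
  by apply/funext => h; rewrite /GRing.scale /= mulr1.
rewrite E; split=> [/cvgCP c e e0|c].
  have /nbhsCP[d d0 cd] := c _ e0; exists d => // w wd.
  have [->|wz] := eqVneq w z; first by rewrite !subrr mulr0 subr0 normc0 mulr0.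
  have wz0 : w - z != 0 by rewrite subr_eq0.
  have := cd (w - z); rewrite subr0 => /(_ wd wz0).
  rewrite subrK /GRing.scale /= => h.
  rewrite -normc_N opprB (_ : _ - _ = (l - (w - z)^-1 * (f w - f z)) * (w - z)); last first.
    by rewrite mulrBl mulrAC mulVf// mul1r.
  by rewrite normcM ler_wpM2r ?normc_ge0.
apply/cvgCP => e e0; have [d d0 cd] := c _ e0.
apply/nbhsCP; exists d => // h; rewrite subr0 => hd h0.
have := cd (h + z); rewrite addrK => /(_ hd) {}cd.
rewrite (_ : _ - _ = - h^-1 * (f (h + z) - f z - l * h)); last first.
  by rewrite /GRing.scale /=; field.
by rewrite normcM normc_N normcV mulrC ler_pdivrMr ?normc_gt0.
Qed.

(** Carathéodory's criterion: the rules of differentiation reduce to algebra on the factor [q]. *)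
Lemma holo_caratheodory f z q : cts q z ->
  (forall w, f w - f z = q w * (w - z)) -> holo f z /\ cderiv f z = q z.
Proof.
move=> cq fq; apply/holo_epsP => e e0.
have /nbhsCP[d d0 dq] := cq _ e0; exists d => // w /dq qe.
by rewrite fq -mulrBl normcM ler_wpM2r ?normc_ge0.
Qed.

(** The difference quotient, completed on the diagonal. It serves in the rules of differentiation,
    in Cauchy's formula and, iterated at 0, as Taylor remainder. *)
Definition slope f z w := if w == z then cderiv f z else (f w - f z) / (w - z).

Lemma slopeE f z w : f w - f z = slope f z w * (w - z).
Proof.
rewrite /slope; case: eqVneq => [->|wz]; first by rewrite !subrr mulr0.
by rewrite divfK ?subr_eq0.
Qed.

Lemma slope_diag f z : slope f z z = cderiv f z.
Proof. by rewrite /slope eqxx. Qed.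

Lemma slope_cts f z : holo f z -> cts (slope f z) z.
Proof.
move=> df e e0.
have [/(_ (conj df erefl)) /(_ _ e0) [d d0 fd] _] := holo_epsP f z (cderiv f z).
have sz : slope f z z = cderiv f z by rewrite /slope eqxx.
apply/nbhsCP; exists d => // w wd.
have h := fd _ wd; rewrite slopeE -mulrBl normcM in h.
suff : normc (slope f z w - cderiv f z) <= e by rewrite -sz.
have [->|wz] := eqVneq w z; first by rewrite sz subrr normc0 ltW.
by move: h; rewrite ler_pM2r// normc_gt0 subr_eq0.
Qed.

Lemma holo_cts f z : holo f z -> cts f z.
Proof.
move=> df; have -> : f = fun w => slope f z w * (w - z) + f z.
  by apply/funext => w; rewrite -slopeE subrK.
apply: ctsD; last exact: cts_cst.
apply: ctsM; first exact: slope_cts.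
by apply: ctsB; [exact: cts_id|exact: cts_cst].
Qed.

Lemma holo_compP f g z : holo f z -> holo g (f z) ->
  holo (fun w => g (f w)) z /\
  cderiv (fun w => g (f w)) z = cderiv g (f z) * cderiv f z.
Proof.
move=> df dg.
have := @holo_caratheodory (fun w => g (f w)) z
  (fun w => slope g (f z) (f w) * slope f z w).
rewrite /= !slope_diag; apply; last first.
  by move=> w; rewrite -mulrA -slopeE slopeE.
apply: ctsM; last exact: slope_cts.
by apply: cts_comp; [exact: holo_cts|exact: slope_cts].
Qed.

Lemma holo_cst (c : R[i]) z : holo (fun=> c) z.
Proof.
apply: (proj1 (@holo_caratheodory _ _ (fun=> 0) _ _)); first exact: cts_cst.
by move=> w; rewrite subrr mul0r.
Qed.

Lemma holo_id z : holo (fun w : R[i] => w) z.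
Proof.
apply: (proj1 (@holo_caratheodory _ _ (fun=> 1) _ _)); first exact: cts_cst.
by move=> w; rewrite mul1r.
Qed.

Lemma holoMP f g z : holo f z -> holo g z ->
  holo (fun w => f w * g w) z /\
  cderiv (fun w => f w * g w) z = cderiv f z * g z + f z * cderiv g z.
Proof.
move=> df dg.
have := @holo_caratheodory (fun w => f w * g w) z
  (fun w => slope f z w * g w + f z * slope g z w).
rewrite /= !slope_diag; apply.
  apply: ctsD; apply: ctsM; try exact: slope_cts; last exact: cts_cst.
  exact: holo_cts.
by move=> w; rewrite mulrDl mulrAC -slopeE -mulrA -slopeE; ring.
Qed.

Lemma holoV f z : f z != 0 -> holo f z ->
  holo (fun w => (f w)^-1) z.
Proof.
move=> f0 df.
(* The factorisation must hold at every [w], also at zeros of [f] far from [z], where the inverse is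
   0 by convention. Near [z] only the second branch occurs. *)
pose q w := if f w == 0 then slope (fun w => (f w)^-1) z w
  else - slope f z w * ((f w)^-1 * (f z)^-1).
apply: (proj1 (@holo_caratheodory _ _ q _ _)); last first.
  move=> w; rewrite /q; case: eqVneq => [fw|fw]; first by rewrite -(slopeE (fun w => (f w)^-1)).
  by rewrite mulrAC mulNr -slopeE; field; rewrite fw f0.
have : cts (fun w => - slope f z w * ((f w)^-1 * (f z)^-1)) z.
  apply: ctsM; first by apply: ctsN; exact: slope_cts.
  by apply: ctsM; [apply: ctsV => //; exact: holo_cts|exact: cts_cst].
move=> + e e0 => /(_ e e0).
have fz : 0 < normc (f z) / 2 by rewrite divr_gt0// normc_gt0.
have := holo_cts df fz; apply: filterS2 => w h1 h2.
rewrite /q (negbTE f0); case: eqVneq => // fw.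
by move: h1 fz; rewrite fw sub0r normc_N; lra.
Qed.

Lemma holoX f n z : holo f z -> holo (fun w => f w ^+ n) z.
Proof.
move=> df; elim: n => [|n IH]; first exact: holo_cst.
rewrite (_ : (fun y => f y ^+ n.+1) = fun y => f y * f y ^+ n).
  exact: (holoMP df IH).1.
by apply/funext => y; rewrite exprS.
Qed.

Lemma holoBP f g z : holo f z -> holo g z ->
  holo (fun w => f w - g w) z /\
  cderiv (fun w => f w - g w) z = cderiv f z - cderiv g z.
Proof.
move=> df dg.
have := @holo_caratheodory (fun w => f w - g w) z
  (fun w => slope f z w - slope g z w).
rewrite /= !slope_diag; apply; first by apply: ctsB; exact: slope_cts.
by move=> w; rewrite mulrBl -!slopeE; ring.
Qed.

Lemma holoM f g z : holo f z -> holo g z -> holo (fun w => f w * g w) z.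
Proof. by move=> df dg; have [] := holoMP df dg. Qed.

Lemma holoB f g z : holo f z -> holo g z -> holo (fun w => f w - g w) z.
Proof. by move=> df dg; have [] := holoBP df dg. Qed.

Lemma holo_comp f g z : holo f z -> holo g (f z) -> holo (fun w => g (f w)) z.
Proof. by move=> df dg; have [] := holo_compP df dg. Qed.

Lemma holo_near_eq f g z (d : R) : 0 < d ->
  (forall w, normc (w - z) < d -> f w = g w) -> holo f z ->
  holo g z.
Proof.
move=> d0 fg df; have [/(_ (conj df erefl)) h _] := holo_epsP f z (cderiv f z).
have [] // := proj2 (holo_epsP g z (cderiv f z)).
move=> e /h[d' d'0 hd]; exists (Num.min d d'); first by rewrite lt_min d0.
move=> w; rewrite lt_min => /andP[wd wd'].
by rewrite -!fg ?subrr ?normc0//; exact: hd.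
Qed.

End ComplexDerivative.

Arguments holo_cst {R} c z.
Arguments holo_id {R} z.

(** * Integrals of complex functions and Goursat's theorem *)

Section ComplexIntegral.
Variable R : realType.
Implicit Types (a b : R) (u v : R -> R[i]) (p q : R -> R).
Local Notation mu := (@lebesgue_measure R).

(* Unsigned: [rint a b p = 0] when [b < a]. *)
Definition rint a b p : R := \int[mu]_(x in `[a, b]) p x.

Definition cint a b u : R[i] :=
  rint a b (fun x => complex.Re (u x)) +i* rint a b (fun x => complex.Im (u x)).

Definition rcts_on a b p := forall x, a <= x <= b -> {for x, continuous p}.

Definition cts_on a b u := forall x, a <= x <= b -> cts u x.

Lemma rcts_integrable a b p : rcts_on a b p -> mu.-integrable `[a, b] (EFin \o p).
Proof.
move=> cp; apply: continuous_compact_integrable; first exact: segment_compact.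
by apply: continuous_in_subspaceT => x /set_mem; rewrite /= in_itv /=; exact: cp.
Qed.

Lemma cts_on_Re a b u : cts_on a b u -> rcts_on a b (fun x => complex.Re (u x)).
Proof. by move=> cu x /cu; exact: cts_Re. Qed.

Lemma cts_on_Im a b u : cts_on a b u -> rcts_on a b (fun x => complex.Im (u x)).
Proof. by move=> cu x /cu; exact: cts_Im. Qed.

Lemma cts_onM a b u v : cts_on a b u -> cts_on a b v -> cts_on a b (fun x => u x * v x).
Proof. by move=> cu cv x xab; apply: ctsM; [exact: cu|exact: cv]. Qed.

Lemma cts_onB a b u v : cts_on a b u -> cts_on a b v -> cts_on a b (fun x => u x - v x).
Proof. by move=> cu cv x xab; apply: ctsB; [exact: cu|exact: cv]. Qed.

Lemma cts_on_cst a b (c : R[i]) : cts_on a b (fun=> c).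
Proof. by move=> x _; exact: cts_cst. Qed.

Lemma rintD a b p q : rcts_on a b p -> rcts_on a b q ->
  rint a b (fun x => p x + q x) = rint a b p + rint a b q.
Proof.
by move=> cp cq; rewrite /rint RintegralD//; exact: rcts_integrable.
Qed.

Lemma rintB a b p q : rcts_on a b p -> rcts_on a b q ->
  rint a b (fun x => p x - q x) = rint a b p - rint a b q.
Proof.
by move=> cp cq; rewrite /rint RintegralB//; exact: rcts_integrable.
Qed.

Lemma rintZ a b c p : rcts_on a b p -> rint a b (fun x => c * p x) = c * rint a b p.
Proof. by move=> cp; rewrite /rint RintegralZl//; exact: rcts_integrable. Qed.

Lemma rint_cst a b c : a <= b -> rint a b (fun=> c) = c * (b - a).
Proof.
move=> ab; rewrite /rint Rintegral_cst//= lebesgue_measure_itv/= lte_fin.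
move: ab; rewrite le_eqVlt => /predU1P[->|->//]; first by rewrite ltxx subrr.
Qed.

Lemma rint_split a m b p : a <= m <= b -> rcts_on a b p ->
  rint a b p = rint a m p + rint m b p.
Proof.
move=> /andP[am mb] cp.
have := @Rintegral_itvB R p (BLeft a) (BRight b) m (rcts_integrable cp).
rewrite !bnd_simp => /(_ am mb) h; rewrite /rint -[LHS](subrK (\int[mu]_(t in `[a, m]) p t)).
rewrite h addrC; congr (_ + _); rewrite Rintegral_itv_obnd_cbnd//.
apply: integrableS (rcts_integrable cp) => //.
by apply: subset_itv; rewrite bnd_simp.
Qed.

Lemma le_rint a b p q : rcts_on a b p -> rcts_on a b q ->
  (forall x, a <= x <= b -> p x <= q x) -> rint a b p <= rint a b q.
Proof.
move=> cp cq pq; apply: le_Rintegral => //.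
- exact: rcts_integrable.
- exact: rcts_integrable.
Qed.

Lemma eq_rint a b p q : (forall x, a <= x <= b -> p x = q x) ->
  rint a b p = rint a b q.
Proof.
by move=> pq; apply: eq_Rintegral => x /set_mem /=; rewrite in_itv; exact: pq.
Qed.

Lemma rcts_onD a b p q : rcts_on a b p -> rcts_on a b q -> rcts_on a b (fun x => p x + q x).
Proof. by move=> cp cq x xab; apply: cvgD; [exact: cp|exact: cq]. Qed.

Lemma rcts_onM a b p q : rcts_on a b p -> rcts_on a b q -> rcts_on a b (fun x => p x * q x).
Proof. by move=> cp cq x xab; apply: cvgM; [exact: cp|exact: cq]. Qed.

Lemma rcts_on_cst a b (c : R) : rcts_on a b (fun=> c).
Proof. by move=> x _; exact: cst_continuous. Qed.

Lemma rcts_onZ a b c p : rcts_on a b p -> rcts_on a b (fun x => c * p x).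
Proof. by move=> cp; apply: rcts_onM => //; exact: rcts_on_cst. Qed.

Lemma eq_cint a b u v : (forall x, a <= x <= b -> u x = v x) -> cint a b u = cint a b v.
Proof. by move=> uv; congr (_ +i* _); apply: eq_rint => x /uv ->. Qed.

Lemma complexD (x y z t : R) : (x +i* y) + (z +i* t) = (x + z) +i* (y + t) :> R[i].
Proof. by []. Qed.

Lemma cintD a b u v : cts_on a b u -> cts_on a b v ->
  cint a b (fun x => u x + v x) = cint a b u + cint a b v.
Proof.
move=> cu cv; rewrite /cint complexD -!rintD; first last.
- exact: cts_on_Re.
- exact: cts_on_Re.
- exact: cts_on_Im.
- exact: cts_on_Im.
by congr (_ +i* _); apply: eq_rint => x _; rewrite raddfD.
Qed.

Lemma cintZ a b (c : R[i]) u : cts_on a b u ->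
  cint a b (fun x => c * u x) = c * cint a b u.
Proof.
move=> cu; have cr := cts_on_Re cu; have ci := cts_on_Im cu.
case: c => c d; rewrite /cint.
have -> (x y : R) : (c +i* d) * (x +i* y) = (c * x - d * y) +i* (c * y + d * x) by [].
rewrite -!rintZ// -rintB ?(rcts_onZ)//; try exact: rcts_onZ.
rewrite -rintD; try exact: rcts_onZ.
by congr (_ +i* _); apply: eq_rint => x _; case: (u x).
Qed.

Lemma cintB a b u v : cts_on a b u -> cts_on a b v ->
  cint a b (fun x => u x - v x) = cint a b u - cint a b v.
Proof.
move=> cu cv; rewrite -mulN1r -cintZ// -cintD//; last first.
  by apply: cts_onM => //; exact: cts_on_cst.
by apply: eq_cint => x _; rewrite mulN1r.
Qed.

Lemma cint_cst a b (c : R[i]) : a <= b -> cint a b (fun=> c) = (b - a)%:C * c.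
Proof.
move=> ab; rewrite /cint !rint_cst//; case: c => c d /=.
by apply/eqP; rewrite eq_complex /=; apply/andP; split; apply/eqP; ring.
Qed.

Lemma cint_split a m b u : a <= m <= b -> cts_on a b u ->
  cint a b u = cint a m u + cint m b u.
Proof.
move=> amb cu; rewrite /cint complexD -!rint_split//.
  exact: cts_on_Im.
exact: cts_on_Re.
Qed.

Lemma cint_real a b p : cint a b (fun x => (p x)%:C) = (rint a b p)%:C.
Proof.
congr (_ +i* _) => /=; rewrite /rint.
by rewrite /Rintegral integral0.
Qed.

(** A unimodular [c] turns the integral into its modulus; then only the real part of [c * u x]
    contributes, and it is at most [normc (u x)]. *)
Lemma normc_cint a b u p : cts_on a b u -> rcts_on a b p ->
  (forall x, a <= x <= b -> normc (u x) <= p x) -> normc (cint a b u) <= rint a b p.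
Proof.
move=> cu cp up; have [->|w0] := eqVneq (cint a b u) 0.
  rewrite normc0 -(mul0r (b - a)).
  have [ab|ba] := leP a b; last first.
    by rewrite mul0r /rint set_itv_ge ?Rintegral_set0// bnd_simp -ltNge.
  rewrite -rint_cst//; apply: le_rint => //; first exact: rcts_on_cst.
  by move=> x /up; exact: le_trans (normc_ge0 _).
set w := cint a b u in w0 *.
pose c := w^*%C / (normc w)%:C.
have nw : (normc w)%:C != 0 :> R[i].
  by rewrite -normc_gt0 normc_real ger0_norm ?normc_ge0// normc_gt0.
have c1 : normc c = 1.
  rewrite /c normcM normcJ normcV normc_real ger0_norm ?normc_ge0// divff//.
  by rewrite gt_eqF// normc_gt0.
have : (normc w)%:C = c * w.
  by rewrite /c mulrAC (mulrC _ w) mulcJ; apply: (mulIf nw); rewrite divfK// -rmorphM.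
rewrite -cintZ// => /(congr1 (@complex.Re R)) /= ->.
apply: le_rint => //.
  by apply: cts_on_Re; apply: cts_onM => //; exact: cts_on_cst.
move=> x /up; apply: le_trans; rewrite -[leRHS]mul1r -c1 -normcM.
exact: le_trans (ler_norm _) (normc_Re _).
Qed.

End ComplexIntegral.

Local Arguments normc : simpl never.

(** * Goursat's theorem on rectangles, by repeated quartering *)

Section Goursat.
Variable R : realType.
Implicit Types (u : R -> R -> R[i]) (a b c d : R).

(* Complex differentiability in real coordinates, so that [exp] can be composed in
   polar form without a complex exponential. *)
Definition holo2 u x0 y0 := exists l : R[i], forall e : R, 0 < e ->
  exists2 r : R, 0 < r & forall x y, `|x - x0| < r -> `|y - y0| < r ->
    normc (u x y - u x0 y0 - l * ((x - x0) +i* (y - y0))) <= e * (`|x - x0| + `|y - y0|).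

(** The path [h] covers horizontal and vertical lines in one proof. *)
Lemma holo2_cts u x0 y0 (h : R -> R * R) t : h t = (x0, y0) ->
  (forall s, `|(h s).1 - x0| + `|(h s).2 - y0| <= `|s - t|) ->
  holo2 u x0 y0 -> cts (fun s => u (h s).1 (h s).2) t.
Proof.
move=> ht hs [l ul] e e0.
have [r r0 ur] := ul 1 ltr01.
pose k := 1 + normc l.
have k0 : 0 < k by rewrite ltr_wpDr ?normc_ge0.
have m0 : 0 < Num.min r (e / k) by rewrite lt_min r0 divr_gt0.
near=> s; rewrite ht /=.
have : `|s - t| < Num.min r (e / k).
  by near: s; exact: cvgr_distC_lt.
rewrite lt_min => /andP[sr se].
have := hs s; move: (h s) => [x y] /= hxy.
have xr : `|x - x0| < r by have := normr_ge0 (y - y0); lra.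
have yr : `|y - y0| < r by have := normr_ge0 (x - x0); lra.
have := ur x y xr yr; rewrite mul1r => {}ur.
have lxy : normc (l * ((x - x0) +i* (y - y0))) <= normc l * (`|x - x0| + `|y - y0|).
  by rewrite normcM ler_wpM2l ?normc_ge0// (le_trans (normc_le_ReIm _)).
rewrite -(subrK (l * ((x - x0) +i* (y - y0))) (_ - _)).
apply: le_trans (normc_leD _ _) _; apply: le_trans (lerD ur lxy) _.
rewrite -[X in X + _]mul1r -mulrDl -/k mulrC -ler_pdivlMr//.
exact: le_trans hxy (ltW se).
Unshelve. all: end_near. Qed.

Lemma holo2_ctsx u x0 y0 : holo2 u x0 y0 -> cts (fun x => u x y0) x0.
Proof.
move=> h; apply: (@holo2_cts u x0 y0 (fun x => (x, y0)) x0) => // s /=.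
by rewrite subrr normr0 addr0.
Qed.

Lemma holo2_ctsy u x0 y0 : holo2 u x0 y0 -> cts (fun y => u x0 y) y0.
Proof.
move=> h; apply: (@holo2_cts u x0 y0 (fun y => (x0, y)) y0) => // s /=.
by rewrite subrr normr0 add0r.
Qed.

(** The counterclockwise boundary integral, with opposite edges paired because [cint] carries no
    orientation; [0 +i* 1] is dz/dy on the vertical edges. *)
Definition rect_int u a b c d : R[i] :=
  cint a b (fun x => u x c - u x d) + (0 +i* 1) * cint c d (fun y => u b y - u a y).

Definition holo_rect u a b c d :=
  forall x y, a <= x <= b -> c <= y <= d -> holo2 u x y.

Lemma holo_rect_sub u a b c d a' b' c' d' : a <= a' -> b' <= b -> c <= c' -> d' <= d ->
  holo_rect u a b c d -> holo_rect u a' b' c' d'.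
Proof.
move=> aa bb cc dd h x y /andP[ax xb] /andP[cy yd]; apply: h.
  by rewrite (le_trans aa)// (le_trans xb).
by rewrite (le_trans cc)// (le_trans yd).
Qed.

Lemma rect_int_splitx u a m b c d : a <= m <= b -> c <= d -> holo_rect u a b c d ->
  rect_int u a b c d = rect_int u a m c d + rect_int u m b c d.
Proof.
move=> amb cd h.
have [ab am mb] : [/\ a <= b, a <= m & m <= b] by move/andP: amb => [*]; split; lra.
have ch y : c <= y <= d -> cts_on a b (fun x => u x y).
  by move=> yd x xab; apply: holo2_ctsx; exact: h.
have cv x : a <= x <= b -> cts_on c d (fun y => u x y).
  by move=> xab y yd; apply: holo2_ctsy; exact: h.
rewrite /rect_int (@cint_split _ a m b)//; last first.
  by apply: cts_onB; apply: ch; rewrite lexx ?andbT.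
rewrite !(@cintB _ c d); try by apply: cv; rewrite ?lexx ?andbT.
ring.
Qed.

Lemma rect_int_splity u a b c m d : a <= b -> c <= m <= d -> holo_rect u a b c d ->
  rect_int u a b c d = rect_int u a b c m + rect_int u a b m d.
Proof.
move=> ab cmd h.
have [cd cm md] : [/\ c <= d, c <= m & m <= d] by move/andP: cmd => [*]; split; lra.
have ch y : c <= y <= d -> cts_on a b (fun x => u x y).
  by move=> yd x xab; apply: holo2_ctsx; exact: h.
have cv x : a <= x <= b -> cts_on c d (fun y => u x y).
  by move=> xab y yd; apply: holo2_ctsy; exact: h.
rewrite /rect_int (@cint_split _ c m d)//; last first.
  by apply: cts_onB; apply: cv; rewrite lexx ?andbT.
rewrite !(@cintB _ a b); try by apply: ch; rewrite ?lexx ?andbT.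
ring.
Qed.

Lemma nested_intervals (a b : nat -> R) :
  (forall n, a n <= a n.+1) -> (forall n, b n.+1 <= b n) -> (forall n, a n <= b n) ->
  exists x, forall n, a n <= x <= b n.
Proof.
move=> ha hb ab.
have mona n m : (n <= m)%N -> a n <= a m.
  by apply: (@homo_leq _ a (fun x y => x <= y)) => // x y z; exact: le_trans.
have monb n m : (n <= m)%N -> b m <= b n.
  by move=> nm; apply: (@homo_leq _ b (fun x y => y <= x)) => // x y z /[swap]; exact: le_trans.
have anbm n m : a n <= b m.
  apply: le_trans (mona _ _ (leq_maxl n m)) _.
  exact: le_trans (ab _) (monb _ _ (leq_maxr n m)).
exists (sup (range a)) => n; apply/andP; split.
  apply: ub_le_sup; last by exists n.
  by exists (b 0) => _ [m _ <-].
apply: ge_sup; first by exists (a 0), 0.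
by move=> _ [m _ <-].
Qed.

(** The four quarter integrals add up to the whole, so one of them has at least a quarter of its
    modulus. The booleans select left or right, and bottom or top. *)
Lemma rect_int_quarter u a b c d : a <= b -> c <= d -> holo_rect u a b c d ->
  exists s t : bool,
    let m := (a + b) / 2 in let n := (c + d) / 2 in
    normc (rect_int u a b c d) / 4 <=
    normc (rect_int u (if s then a else m) (if s then m else b)
                      (if t then c else n) (if t then n else d)).
Proof.
move=> ab cd h; set m := (a + b) / 2; set n := (c + d) / 2.
have amb : a <= m <= b by rewrite /m; apply/andP; split; lra.
have cnd : c <= n <= d by rewrite /n; apply/andP; split; lra.
have [[am mb] [cn nd]] := (andP amb, andP cnd).
have E : rect_int u a b c d =
    rect_int u a m c n + rect_int u a m n d + (rect_int u m b c n + rect_int u m b n d).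
  rewrite (rect_int_splitx amb)// (rect_int_splity am cnd) ?(rect_int_splity mb cnd)//.
    exact: holo_rect_sub h.
  exact: holo_rect_sub h.
apply: contrapT => no.
have K s t : normc (rect_int u (if s then a else m) (if s then m else b)
   (if t then c else n) (if t then n else d)) < normc (rect_int u a b c d) / 4.
  by rewrite ltNge; apply/negP => k; apply: no; exists s, t.
have k1 : normc (rect_int u a m c n) < _ := K true true.
have k2 : normc (rect_int u a m n d) < _ := K true false.
have k3 : normc (rect_int u m b c n) < _ := K false true.
have k4 : normc (rect_int u m b n d) < _ := K false false.
have : normc (rect_int u a b c d) <= normc (rect_int u a m c n) + normc (rect_int u a m n d) +
    (normc (rect_int u m b c n) + normc (rect_int u m b n d)).
  by rewrite {1}E; apply: le_trans (normc_leD _ _) _; apply: lerD; exact: normc_leD.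
move: k1 k2 k3 k4; clear; move: (normc (rect_int u a b c d))
  (normc (rect_int u a m c n)) (normc (rect_int u a m n d))
  (normc (rect_int u m b c n)) (normc (rect_int u m b n d)) => *; lra.
Qed.

(* Subtracting the affine approximation, whose boundary integral vanishes. *)
Lemma rect_int_small u a b c d x0 y0 (l : R[i]) e : a <= x0 <= b -> c <= y0 <= d ->
  0 <= e -> holo_rect u a b c d ->
  (forall x y, a <= x <= b -> c <= y <= d ->
    normc (u x y - u x0 y0 - l * ((x - x0) +i* (y - y0))) <= e * (`|x - x0| + `|y - y0|)) ->
  normc (rect_int u a b c d) <= 2 * e * ((b - a) + (d - c)) ^+ 2.
Proof.
move=> x0ab y0cd e0 h ue.
have ab : a <= b by case/andP: x0ab; exact: le_trans.
have cd : c <= d by case/andP: y0cd; exact: le_trans.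
have ch y : c <= y <= d -> cts_on a b (fun x => u x y).
  by move=> yd x xab; apply: holo2_ctsx; exact: h.
have cv x : a <= x <= b -> cts_on c d (fun y => u x y).
  by move=> xab y yd; apply: holo2_ctsy; exact: h.
have ccd : c <= c <= d by rewrite lexx.
have dcd : c <= d <= d by rewrite lexx andbT.
have aab : a <= a <= b by rewrite lexx.
have bab : a <= b <= b by rewrite lexx andbT.
pose S := (b - a) + (d - c).
have ue2 x y x' y' : a <= x <= b -> c <= y <= d -> a <= x' <= b -> c <= y' <= d ->
    normc (u x y - u x' y' - l * ((x - x') +i* (y - y'))) <= 2 * e * S.
  move=> xab ycd xab' ycd'.
  rewrite (_ : _ - _ = (u x y - u x0 y0 - l * ((x - x0) +i* (y - y0))) -
     (u x' y' - u x0 y0 - l * ((x' - x0) +i* (y' - y0)))); last first.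
    have -> : (x - x') +i* (y - y') =
      ((x - x0) +i* (y - y0)) - ((x' - x0) +i* (y' - y0)) :> R[i].
      by apply/eqP; rewrite eq_complex /=; apply/andP; split; apply/eqP; ring.
    ring.
  have P x1 y1 : a <= x1 <= b -> c <= y1 <= d -> `|x1 - x0| + `|y1 - y0| <= S.
    by move=> /andP[? ?] /andP[? ?]; case/andP: x0ab => ? ?; case/andP: y0cd => ? ?;
      rewrite lerD// ler_norml; apply/andP; split; lra.
  apply: le_trans (normc_leD _ _) _; rewrite normc_N.
  apply: le_trans (lerD (ue _ _ xab ycd) (ue _ _ xab' ycd')) _.
  rewrite -mulrDr (mulrC 2) -mulrA ler_wpM2l// mulr_natl mulr2n.
  by rewrite lerD// P.
(* Between opposite edges the affine part changes by a constant, so no affine function has to be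
   integrated; the two constants cancel in [rect_int]. The terms [x - x] and [y - y] match the shape
   of [ue2]. *)
pose E1 x : R[i] := u x c - u x d - l * ((x - x) +i* (c - d)).
pose E2 y : R[i] := u b y - u a y - l * ((b - a) +i* (y - y)).
have cE1 : cts_on a b E1.
  have -> : E1 = fun x => u x c - u x d - l * (0 +i* (c - d)).
    by apply/funext => x; rewrite /E1 subrr.
  by apply: cts_onB; [apply: cts_onB; exact: ch|exact: cts_on_cst].
have cE2 : cts_on c d E2.
  have -> : E2 = fun y => u b y - u a y - l * ((b - a) +i* 0).
    by apply/funext => x; rewrite /E2 subrr.
  by apply: cts_onB; [apply: cts_onB; exact: cv|exact: cts_on_cst].
have -> : rect_int u a b c d = cint a b E1 + (0 +i* 1) * cint c d E2.
  rewrite /rect_int.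
  rewrite (_ : cint a b _ = cint a b (fun x => E1 x + l * (0 +i* (c - d)))); last first.
    by apply: eq_cint => x _; rewrite /E1 subrr subrK.
  rewrite (_ : cint c d _ = cint c d (fun y => E2 y + l * ((b - a) +i* 0))); last first.
    by apply: eq_cint => x _; rewrite /E2 subrr subrK.
  rewrite (cintD cE1 (cts_on_cst _)) (cintD cE2 (cts_on_cst _)).
  rewrite !cint_cst// mulrDr addrACA -[RHS]addr0; congr (_ + _).
  case: l {ue ue2 E1 E2 cE1 cE2} => l1 l2.
  by apply/eqP; rewrite eq_complex /=; apply/andP; split; apply/eqP; ring.
apply: le_trans (normc_leD _ _) _; rewrite normcM.
have -> : normc (0 +i* 1 : R[i]) = 1 by rewrite /normc expr0n expr1n add0r sqrtr1.
rewrite mul1r -/S expr2 mulrA {2}/S mulrDr -!rint_cst//.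
by apply: lerD; apply: normc_cint => //; (try exact: rcts_on_cst) => z zI; exact: ue2.
Qed.

Theorem goursat u a b c d : a <= b -> c <= d -> holo_rect u a b c d ->
  rect_int u a b c d = 0.
Proof.
move=> ab cd h.
pose ok (q : R * R * R * R) := [/\ a <= q.1.1.1, q.1.1.1 <= q.1.1.2, q.1.1.2 <= b &
   [/\ c <= q.1.2, q.1.2 <= q.2 & q.2 <= d]].
pose I (q : R * R * R * R) := rect_int u q.1.1.1 q.1.1.2 q.1.2 q.2.
pose sub (q : R * R * R * R) (s t : bool) : R * R * R * R :=
   let m := (q.1.1.1 + q.1.1.2) / 2 in let n := (q.1.2 + q.2) / 2 in
   (if s then q.1.1.1 else m, if s then m else q.1.1.2,
    if t then q.1.2 else n, if t then n else q.2).
have hq q : ok q -> holo_rect u q.1.1.1 q.1.1.2 q.1.2 q.2.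
  by move=> [q1 q2 q3 [q4 q5 q6]]; exact: holo_rect_sub h.
have /choice[g gP] : forall q, exists st : bool * bool,
    ok q -> normc (I q) / 4 <= normc (I (sub q st.1 st.2)).
  move=> q; have [okq|nq] := pselect (ok q); last by exists (true, true).
  have [q1 q2 q3 [q4 q5 q6]] := okq.
  by have [s [t st]] := rect_int_quarter q2 q5 (hq q okq); exists (s, t).
pose Q := fix Q n := if n is m.+1 then sub (Q m) (g (Q m)).1 (g (Q m)).2 else (a, b, c, d).
have okQ n : ok (Q n).
  elim: n => [|n [q1 q2 q3 [q4 q5 q6]]] /=; first by split.
  by rewrite /ok /sub; case: (g (Q n)) => -[] [] /=;
    (split; last split); clear -q1 q2 q3 q4 q5 q6; lra.
have sz n : (Q n).1.1.2 - (Q n).1.1.1 = (b - a) / 2 ^+ n /\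
            (Q n).2 - (Q n).1.2 = (d - c) / 2 ^+ n.
  elim: n => [|n [E1 E2]]; first by rewrite !expr0 !divr1.
  rewrite exprS invfM !(mulrCA _ 2^-1) -E1 -E2 /= /sub.
  by case: (g (Q n)) => -[] [] /=; split; field.
have IQ n : normc (I (a, b, c, d)) / 4 ^+ n <= normc (I (Q n)).
  elim: n => [|n IH]; first by rewrite expr0 divr1.
  rewrite exprS invfM mulrCA mulrC.
  by apply: le_trans (gP _ (okQ n)); rewrite ler_wpM2r.
have [x0 x0P] : exists x, forall n, (Q n).1.1.1 <= x <= (Q n).1.1.2.
  apply: nested_intervals => n; case: (okQ n) => [q1 q2 q3 [q4 q5 q6]] //=;
  by rewrite /sub; case: (g (Q n)) => -[] [] /=; lra.
have [y0 y0P] : exists x, forall n, (Q n).1.2 <= x <= (Q n).2.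
  apply: nested_intervals => n; case: (okQ n) => [q1 q2 q3 [q4 q5 q6]] //=;
  by rewrite /sub; case: (g (Q n)) => -[] [] /=; lra.
have [l ul] := h x0 y0 (x0P 0) (y0P 0).
apply: eq0_normc; apply/eqP; rewrite eq_le normc_ge0 andbT.
rewrite -/(I (a, b, c, d)).
pose S := (b - a) + (d - c).
have S0 : 0 <= S by rewrite addr_ge0// subr_ge0.
(* The n-th quarter keeps at least a fraction [4 ^- n] of the integral, and [rect_int_small] bounds
   it by [2 * e * (S / 2 ^+ n) ^+ 2]: the powers cancel. *)
suff K e : 0 < e -> normc (I (a, b, c, d)) <= 2 * e * S ^+ 2.
  apply/ler_addgt0Pl => e e0; rewrite addr0.
  have s0 : 0 < S ^+ 2 + 1 by rewrite ltr_wpDl// sqr_ge0.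
  (* The summand 1 covers a degenerate rectangle with [S = 0]. *)
  apply: le_trans (K (e / (2 * (S ^+ 2 + 1))) _) _.
    by rewrite divr_gt0// mulr_gt0.
  have -> (s : R) : 0 < s + 1 -> 2 * (e / (2 * (s + 1))) * s = e * (s / (s + 1)).
  - by move=> s1; field; rewrite gt_eqF.
  - by rewrite ger_pMr// ler_pdivrMr// mul1r lerDl.
  - exact: s0.
move=> e0; have [r r0 ur] := ul e e0.
have [n nr] : exists n, S / 2 ^+ n < r.
  have := @cvg_geometric R S 2^-1; rewrite ger0_norm// invf_lt1// ltr1n => /(_ isT).
  move=> /cvgrPdist_lt /(_ _ r0) [N _ /(_ N (leqnn _))] /=.
  rewrite sub0r normrN ger0_norm; last by rewrite mulr_ge0// exprn_ge0.
  by rewrite exprVn; exists N.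
have [q1 q2 q3 [q4 q5 q6]] := okQ n.
have [E1 E2] := sz n.
have := @rect_int_small u _ _ _ _ x0 y0 l e (x0P n) (y0P n) (ltW e0) (hq _ (okQ n)).
have p2 : 0 < 2 ^+ n :> R by rewrite exprn_gt0.
have n1 : (Q n).1.1.2 - (Q n).1.1.1 < r.
  apply: le_lt_trans nr; rewrite E1 ler_pM2r ?invr_gt0// lerDl subr_ge0//.
have n2 : (Q n).2 - (Q n).1.2 < r.
  apply: le_lt_trans nr; rewrite E2 ler_pM2r ?invr_gt0// lerDr subr_ge0//.
move=> K; have {}K := K _; move: K; rewrite E1 E2 -mulrDl -/S => K.
have {}K : normc (I (Q n)) <= 2 * e * (S / 2 ^+ n) ^+ 2.
  apply: K => x y /andP[? ?] /andP[? ?]; apply: ur.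
    by have /andP[? ?] := x0P n; rewrite ltr_norml; apply/andP; split; lra.
  by have /andP[? ?] := y0P n; rewrite ltr_norml; apply/andP; split; lra.
have := le_trans (IQ n) K; rewrite expr_div_n mulrA -exprM mulnC exprM.
have -> : (2 ^+ 2 : R) = 4 by rewrite -natrX.
by rewrite ler_pM2r// invr_gt0 exprn_gt0.
Qed.

End Goursat.

(** * The exponential in real coordinates *)

Section Polar.
Variable R : realType.
Implicit Types (f : R[i] -> R[i]) (r t x y : R).

Lemma is_derive_eps (p : R -> R) x l : is_derive x 1 p l -> forall e : R, 0 < e ->
  exists2 d : R, 0 < d & forall y, `|y - x| < d -> `|p y - p x - l * (y - x)| <= e * `|y - x|.
Proof.
move=> [dp <-] e e0.
have /cvgrPdist_le /(_ e e0) /nbhs_ballP[d d0 hd] : h^-1 *: (p (h *: 1 + x) - p x) @[h --> 0^'] --> 'D_1 p x.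
  exact: dp.
exists d => // y yd; have [->|yx] := eqVneq y x; first by rewrite !subrr mulr0 subr0 normr0 mulr0.
have yx0 : y - x != 0 by rewrite subr_eq0.
have := hd (y - x); rewrite -ball_normE /= sub0r normrN => /(_ yd yx0).
rewrite /GRing.scale /= mulr1 subrK => h.
rewrite (_ : _ - _ = - ('D_1 p x - (y - x)^-1 * (p y - p x)) * (y - x)); last by field.
by rewrite normrM normrN ler_wpM2r.
Qed.

Definition polar x y : R[i] := (expR x)%:C * expi y.

Lemma holo2_polar x0 y0 : holo2 polar x0 y0.
Proof.
exists (polar x0 y0) => e e0.
pose X0 := expR x0; have X00 : 0 < X0 by exact: expR_gt0.
(* Each of the two coordinates then errs by at most [e' * (1 + X0) = e / 2] times the distance. *)
pose e' := e / (2 * (1 + X0)).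
have e'0 : 0 < e' by rewrite divr_gt0// mulr_gt0// addr_gt0.
have [d1 d10 h1] := is_derive_eps (is_derive_expR x0) e'0.
have [d2 d20 h2] := is_derive_eps (is_derive_cos y0) e'0.
have [d3 d30 h3] := is_derive_eps (is_derive_sin y0) e'0.
have /cvgrPdist_le /(_ _ e'0) /nbhs_ballP[d4 /= d40 h4] := @continuous_cos R y0.
have /cvgrPdist_le /(_ _ e'0) /nbhs_ballP[d5 /= d50 h5] := @continuous_sin R y0.
exists (Num.min d1 (Num.min d2 (Num.min d3 (Num.min d4 d5)))).
  by rewrite !lt_min d10 d20 d30 d40 d50.
move=> x y; rewrite !lt_min => /andP[x1 _] /andP[_ /and4P[y2 y3 y4 y5]].
have {}h1 := h1 _ x1; have {}h2 := h2 _ y2; have {}h3 := h3 _ y3.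
have := h4 y; rewrite -ball_normE /= distrC => /(_ y4) {}h4.
have := h5 y; rewrite -ball_normE /= distrC => /(_ y5) {}h5.
apply: le_trans (normc_le_ReIm _) _; rewrite /polar /=.
rewrite !(mul0r, subr0, addr0, add0r, oppr0).
(* One estimate for both coordinates, with [C] the cosine or the sine: the error of the exponential,
   the product of two increments, and the error of [C]. *)
have key (C C0 C0' : R) : `|C| <= 1 -> `|C0 - C| <= e' -> `|C - C0 - C0' * (y - y0)| <= e' * `|y - y0| ->
   `|(expR x - X0 - X0 * (x - x0)) * C + X0 * (x - x0) * (C - C0) + X0 * (C - C0 - C0' * (y - y0))|
    <= e / 2 * (`|x - x0| + `|y - y0|).
  move=> k1 k2 k3.
  apply: le_trans (ler_normD _ _) _; apply: le_trans (lerD (ler_normD _ _) (lexx _)) _.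
  rewrite !normrM (gtr0_norm X00).
  have m1 : `|expR x - X0 - X0 * (x - x0)| * `|C| <= e' * `|x - x0|.
    by rewrite -[leRHS]mulr1; apply: ler_pM.
  have m2 : X0 * `|x - x0| * `|C - C0| <= X0 * e' * `|x - x0|.
    by rewrite mulrAC ler_wpM2r// ler_wpM2l ?(ltW X00)// distrC.
  have m3 : X0 * `|C - C0 - C0' * (y - y0)| <= X0 * e' * `|y - y0|.
    by rewrite -mulrA ler_wpM2l ?(ltW X00).
  have -> : e / 2 = e' * (1 + X0).
    by rewrite /e'; field; rewrite gt_eqF// addr_gt0.
  have m4 : 0 <= e' * `|y - y0| by rewrite mulr_ge0// ltW.
  lra.
rewrite (splitr e) mulrDl; apply: lerD.
  have := key (cos y) (cos y0) (- sin y0); rewrite distrC.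
  rewrite ler_norml cos_geN1 cos_le1 distrC => /(_ isT h4 h2).
  by apply: le_trans; rewrite le_eqVlt; apply/orP; left; apply/eqP; congr `| _ |; rewrite /X0; ring.
have := key (sin y) (sin y0) (cos y0).
rewrite ler_norml sin_geN1 sin_le1 => /(_ isT h5 h3).
by apply: le_trans; rewrite le_eqVlt; apply/orP; left; apply/eqP; congr `| _ |; rewrite /X0; ring.
Qed.

Lemma holo2_comp f u x0 y0 : holo2 u x0 y0 -> holo f (u x0 y0) ->
  holo2 (fun x y => f (u x y)) x0 y0.
Proof.
move=> [l ul] hf; exists (cderiv f (u x0 y0) * l) => e e0.
set m := cderiv f (u x0 y0); pose k := 1 + normc l; pose n := 1 + normc m.
have k0 : 0 < k by rewrite ltr_wpDr ?normc_ge0.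
have n0 : 0 < n by rewrite ltr_wpDr ?normc_ge0.
have ek : 0 < e / 2 / k by rewrite !divr_gt0.
have en : 0 < Num.min 1 (e / 2 / n) by rewrite lt_min ltr01 !divr_gt0.
have [d d0 fd] := (proj1 (holo_epsP f (u x0 y0) m)) (conj hf erefl) _ ek.
have [r r0 ur] := ul _ en.
have dk : 0 < d / k by rewrite divr_gt0.
(* The increment of [u] is at most [k] times the sum of the two distances, hence below [d]. *)
exists (Num.min r (d / k / 2)); first by rewrite lt_min r0 divr_gt0.
move=> x y; rewrite !lt_min => /andP[xr xd] /andP[yr yd].
have h := ur _ _ xr yr; set D := u x y - u x0 y0 - _ in h.
have := normc_le_ReIm ((x - x0) +i* (y - y0)) => /=.
set dl := (x - x0) +i* (y - y0) in D h *.
set s := `|x - x0| + `|y - y0| in h * => sdl.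
have s0 : 0 <= s by rewrite addr_ge0.
have sd : s < d / k by rewrite (splitr (d / k)) ltrD.
have h1 : normc D <= s.
  by apply: le_trans h _; rewrite -[leRHS]mul1r ler_wpM2r// ge_min lexx.
have h2 : normc D <= e / 2 / n * s.
  by apply: le_trans h _; rewrite ler_wpM2r// ge_min lexx orbT.
have wk : normc (u x y - u x0 y0) <= k * s.
  rewrite -(subrK (l * dl) (u x y - u x0 y0)) mulrDl mul1r.
  apply: le_trans (normc_leD _ _) _; apply: lerD => //.
  by rewrite normcM ler_wpM2l ?normc_ge0.
have {}fd := fd (u x y) (le_lt_trans wk _).
rewrite (_ : _ - _ = (f (u x y) - f (u x0 y0) - m * (u x y - u x0 y0)) + m * D); last first.
  by rewrite /D; ring.
apply: le_trans (normc_leD _ _) _; rewrite (splitr e) mulrDl; apply: lerD.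
  apply: le_trans (fd _) _; first by rewrite mulrC -ltr_pdivlMr.
  apply: le_trans (ler_wpM2l (ltW ek) wk) _.
  by rewrite mulrA divfK// gt_eqF.
rewrite normcM; apply: le_trans (ler_wpM2l (normc_ge0 _) h2) _.
rewrite mulrA ler_wpM2r// mulrCA ger_pMr ?divr_gt0//.
by rewrite ler_pdivrMr// mul1r lerDr.
Qed.

End Polar.

(** * Means over circles and Cauchy's formula *)

Section CircleMeans.
Variable R : realType.
Implicit Types (f : R[i] -> R[i]) (r t s : R) (u v : R -> R[i]) (p q : R -> R).

Definition circ r t : R[i] := r%:C * expi t.

Definition rmean p : R := (2 * pi)^-1 * rint 0 (2 * pi) p.

Definition cmean u : R[i] := (2 * pi)^-1%:C * cint 0 (2 * pi) u.

Definition ccts u := forall t, cts u t.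

Definition rcts p := forall t, {for t, continuous p}.

Lemma twopi_gt0 : 0 < 2 * pi :> R.
Proof. by rewrite mulr_gt0 ?pi_gt0. Qed.

Lemma ccts_on u a b : ccts u -> cts_on a b u.
Proof. by move=> cu x _; exact: cu. Qed.

Lemma rcts_on_all p a b : rcts p -> rcts_on a b p.
Proof. by move=> cp x _; exact: cp. Qed.

Lemma rcts_normc u : ccts u -> rcts (fun t => normc (u t)).
Proof. by move=> cu t; exact: cts_normc. Qed.

Lemma rctsM p q : rcts p -> rcts q -> rcts (fun t => p t * q t).
Proof. by move=> cp cq t; apply: cvgM; [exact: cp|exact: cq]. Qed.

Lemma rctsD p q : rcts p -> rcts q -> rcts (fun t => p t + q t).
Proof. by move=> cp cq t; apply: cvgD; [exact: cp|exact: cq]. Qed.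

Lemma rctsB p q : rcts p -> rcts q -> rcts (fun t => p t - q t).
Proof. by move=> cp cq t; apply: cvgB; [exact: cp|exact: cq]. Qed.

Lemma rcts_cst (c : R) : rcts (fun=> c).
Proof. by move=> t; exact: cst_continuous. Qed.

Lemma rctsX p n : rcts p -> rcts (fun t => p t ^+ n).
Proof.
move=> cp; elim: n => [|n IH]; first exact: rcts_cst.
rewrite (_ : (fun y => p y ^+ n.+1) = fun y => p y * p y ^+ n); first exact: rctsM.
by apply/funext => y; rewrite exprS.
Qed.

Lemma rctsV p : (forall t, p t != 0) -> rcts p -> rcts (fun t => (p t)^-1).
Proof.
move=> p0 cp t; exact: (@cvgV _ _ _ (nbhs_filter t) _ _ (p0 t) (cp t)).
Qed.

Lemma rmeanD p q : rcts p -> rcts q -> rmean (fun t => p t + q t) = rmean p + rmean q.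
Proof. by move=> cp cq; rewrite /rmean rintD ?mulrDr//; exact: rcts_on_all. Qed.

Lemma rmeanB p q : rcts p -> rcts q -> rmean (fun t => p t - q t) = rmean p - rmean q.
Proof. by move=> cp cq; rewrite /rmean rintB ?mulrBr//; exact: rcts_on_all. Qed.

Lemma rmeanZ c p : rcts p -> rmean (fun t => c * p t) = c * rmean p.
Proof.
by move=> cp; rewrite /rmean rintZ; [rewrite [LHS]mulrCA|exact: rcts_on_all].
Qed.

Lemma rmean_cst c : rmean (fun=> c) = c.
Proof.
by rewrite /rmean rint_cst ?(ltW twopi_gt0)// subr0 mulrC mulfK// gt_eqF ?twopi_gt0.
Qed.

Lemma le_rmean p q : rcts p -> rcts q -> (forall t, p t <= q t) -> rmean p <= rmean q.
Proof.
move=> cp cq pq; rewrite /rmean ler_wpM2l ?invr_ge0 ?(ltW twopi_gt0)//.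
by apply: le_rint => //; exact: rcts_on_all.
Qed.

Lemma rmean_ge0 p : rcts p -> (forall t, 0 <= p t) -> 0 <= rmean p.
Proof.
by move=> cp p0; rewrite -(rmean_cst 0); apply: le_rmean => //; exact: rcts_cst.
Qed.

Lemma eq_rmean p q : p =1 q -> rmean p = rmean q.
Proof. by move=> pq; congr (_ * _); apply: eq_rint => x _; exact: pq. Qed.

Lemma eq_cmean u v : u =1 v -> cmean u = cmean v.
Proof. by move=> uv; congr (_ * _); apply: eq_cint => x _; exact: uv. Qed.

Lemma cmeanD u v : ccts u -> ccts v -> cmean (fun t => u t + v t) = cmean u + cmean v.
Proof. by move=> cu cv; rewrite /cmean cintD ?mulrDr//; exact: ccts_on. Qed.

Lemma cmeanB u v : ccts u -> ccts v -> cmean (fun t => u t - v t) = cmean u - cmean v.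
Proof. by move=> cu cv; rewrite /cmean cintB ?mulrBr//; exact: ccts_on. Qed.

Lemma cmeanZ c u : ccts u -> cmean (fun t => c * u t) = c * cmean u.
Proof.
by move=> cu; rewrite /cmean cintZ; [rewrite [LHS]mulrCA|exact: ccts_on].
Qed.

Lemma cmean_cst (c : R[i]) : cmean (fun=> c) = c.
Proof.
rewrite /cmean cint_cst ?(ltW twopi_gt0)// subr0 mulrA -rmorphM mulVf ?mul1r//.
by rewrite gt_eqF ?twopi_gt0.
Qed.

Lemma cmean_real p : cmean (fun t => (p t)%:C) = (rmean p)%:C.
Proof. by rewrite /cmean cint_real -rmorphM. Qed.

Lemma cmean_Re u : ccts u -> complex.Re (cmean u) = rmean (fun t => complex.Re (u t)).
Proof. by move=> cu; rewrite /cmean /= mul0r subr0. Qed.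

Lemma normc_cmean u p : ccts u -> rcts p -> (forall t, normc (u t) <= p t) ->
  normc (cmean u) <= rmean p.
Proof.
move=> cu cp up; rewrite /cmean /rmean normcM normc_real.
have k0 := twopi_gt0; rewrite gtr0_norm ?invr_gt0//.
rewrite ler_wpM2l ?invr_ge0 ?(ltW k0)//.
exact: normc_cint (ccts_on cu) (rcts_on_all cp) _.
Qed.

Lemma normc_cmean_le u (M : R) : ccts u -> (forall t, normc (u t) <= M) ->
  normc (cmean u) <= M.
Proof.
by move=> cu uM; rewrite -(rmean_cst M); apply: normc_cmean => //; exact: rcts_cst.
Qed.

Lemma normc_cmean_le_on u (M : R) : ccts u ->
  (forall t, 0 <= t <= 2 * pi -> normc (u t) <= M) -> normc (cmean u) <= M.
Proof.
move=> cu uM; rewrite -(rmean_cst M) /cmean /rmean normcM normc_real.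
have k0 := twopi_gt0; rewrite gtr0_norm ?invr_gt0//.
rewrite ler_wpM2l ?invr_ge0 ?(ltW k0)//.
exact: (normc_cint (ccts_on cu) (@rcts_on_cst _ _ _ M)).
Qed.

Lemma normc_circ r t : 0 <= r -> normc (circ r t) = r.
Proof. by move=> r0; rewrite /circ normcM normc_expi mulr1 normc_real ger0_norm. Qed.

Lemma ccts_circ r : ccts (circ r).
Proof. by move=> t; apply: ctsM; [exact: cts_cst|exact: cts_expi]. Qed.

Lemma ccts_comp f r : 0 <= r -> (forall z, normc z = r -> cts f z) ->
  ccts (fun t => f (circ r t)).
Proof.
move=> r0 cf t; apply: cts_comp; first exact: ccts_circ.
by apply: cf; exact: normc_circ.
Qed.

Lemma ccts_holo f r : 0 <= r -> (forall z, normc z = r -> holo f z) ->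
  ccts (fun t => f (circ r t)).
Proof. by move=> r0 hf; apply: ccts_comp => // z /hf; exact: holo_cts. Qed.

(** Goursat for [f] after [polar] on the rectangle between [ln a] and [ln b] of height [2 * pi]: the
    horizontal edges cancel by periodicity, the vertical ones are the two means. *)
Lemma annulus_mean f a b : 0 < a -> a <= b ->
  (forall z, a <= normc z <= b -> holo f z) ->
  cmean (fun t => f (circ a t)) = cmean (fun t => f (circ b t)).
Proof.
move=> a0 ab hf; have b0 := lt_le_trans a0 ab.
have lab : ln a <= ln b by rewrite ler_ln ?posrE.
have E x y : normc (polar x y) = expR x.
  by rewrite /polar normcM normc_expi mulr1 normc_real gtr0_norm ?expR_gt0.
have := @goursat R (fun x y => f (polar x y)) (ln a) (ln b) 0 (2 * pi) lab (ltW twopi_gt0).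
have hr : holo_rect (fun x y => f (polar x y)) (ln a) (ln b) 0 (2 * pi).
  move=> x y /andP[xa xb] _; apply: holo2_comp; first exact: holo2_polar.
  by apply: hf; rewrite E -(lnK a0) -(lnK b0) !ler_expR xa.
move=> /(_ hr); rewrite /rect_int.
rewrite (_ : cint _ _ (fun x => _ - _) = 0); last first.
  rewrite -[RHS](mulr0 (ln b - ln a)%:C) -cint_cst//.
  apply: eq_cint => x _; rewrite /polar /expi.
  by rewrite -[2 * pi]add0r mulr_natl cosD2pi sinD2pi subrr.
have cc r : 0 < r -> a <= r <= b -> cts_on 0 (2 * pi) (fun y => f (polar (ln r) y)).
  by move=> r0 rab y _; apply: cts_comp; [apply: ctsM; [exact: cts_cst|exact: cts_expi]|
    apply: holo_cts; apply: hf; rewrite E lnK ?posrE].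
rewrite add0r cintB; try by apply: cc => //; rewrite lexx ?andbT.
move=> /eqP; rewrite mulf_eq0 => /orP[/eqP[/eqP]|]; first by rewrite oner_eq0.
rewrite subr_eq0 => /eqP h; rewrite /cmean; congr (_ * _).
move: h; by rewrite /polar !lnK ?posrE.
Qed.

End CircleMeans.

(** * Mean value property and Cauchy's theorem for difference quotients *)

Section Cauchy.
Variable R : realType.
Implicit Types (f g : R[i] -> R[i]) (r t s a : R) (z w : R[i]).

Lemma normc_eps_eq0 z : (forall e : R, 0 < e -> normc z <= e) -> z = 0.
Proof.
move=> ze; apply: eq0_normc; apply/eqP; rewrite eq_le normc_ge0 andbT.
by apply/ler_addgt0Pl => e e0; rewrite addr0; exact: ze.
Qed.

(** The circle is shrunk to 0, where continuity alone gives the limit. Hence a difference quotient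
    based at 0 is admissible before its differentiability there is known. *)
Lemma mean_value f s : 0 < s -> (forall z, 0 < normc z <= s -> holo f z) -> cts f 0 ->
  cmean (fun t => f (circ s t)) = f 0.
Proof.
move=> s0 hf cf; apply/eqP; rewrite -subr_eq0; apply/eqP; apply: normc_eps_eq0 => e e0.
have /nbhsCP[d d0 fd] := cf e e0.
pose r := Num.min s (d / 2).
have r0 : 0 < r by rewrite lt_min s0 divr_gt0.
have rs : r <= s by rewrite ge_min lexx.
have rd : r < d by rewrite gt_min (_ : d / 2 < d) ?orbT//; lra.
have cr : ccts (fun t => f (circ r t)).
  by apply: ccts_holo => [|z zr]; [exact: ltW|apply: hf; rewrite zr r0].
rewrite -(annulus_mean r0 rs); last first.
  by move=> z /andP[rz zs]; apply: hf; rewrite (lt_le_trans r0 rz).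
rewrite -(cmean_cst (f 0)) -cmeanB//; last by move=> t; exact: cts_cst.
apply: normc_cmean_le => [t|t]; first by apply: ctsB; [exact: cr|exact: cts_cst].
by apply: fd; rewrite subr0 normc_circ// ltW.
Qed.

(** Carries a mean across a circle on which [g] is known to be continuous only. Compactness of the
    period makes the estimate uniform in the angle. *)
Lemma cmean_circ_continuous g a : 0 < a -> (forall z, normc z = a -> cts g z) ->
  forall e : R, 0 < e -> exists2 d, 0 < d & forall r, 0 < r -> `|r - a| < d ->
    ccts (fun t => g (circ r t)) ->
    normc (cmean (fun t => g (circ r t)) - cmean (fun t => g (circ a t))) <= e.
Proof.
move=> a0 cg e e0.
have ca : ccts (fun t => g (circ a t)) by apply: ccts_comp => //; exact: ltW.
have : compact `[0, (2 * pi : R)] by exact: segment_compact.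
move/compact_near_coveringP => K.
have : \forall r \near a, forall t, `[0, (2 * pi : R)]%classic t ->
    normc (g (circ r t) - g (circ a t)) <= e.
  apply: (K _ (nbhs a) (fun r t => normc (g (circ r t) - g (circ a t)) <= e)).
  move=> t0 _.
  have e2 : 0 < e / 2 by rewrite divr_gt0.
  have /nbhsCP[d d0 gd] := cg (circ a t0) (normc_circ _ (ltW a0)) _ e2.
  have d2 : 0 < d / 2 by rewrite divr_gt0.
  have da : 0 < d / 4 / a by rewrite !divr_gt0.
  have E : \forall t' \near t0, normc (expi t' - expi t0) <= d / 4 / a by exact: cts_expi.
  near=> t r => /=.
  have tn : normc (expi t - expi t0) <= d / 4 / a by near: t; exact: E.
  have rn : `|r - a| < d / 2 by near: r; exact: cvgr_distC_lt.
  have atn : normc (circ a t - circ a t0) <= d / 4.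
    rewrite /circ -mulrBr normcM normc_real gtr0_norm// mulrC.
    by rewrite -ler_pdivlMr.
  rewrite (_ : _ - _ = (g (circ r t) - g (circ a t0)) - (g (circ a t) - g (circ a t0))); last by ring.
  apply: le_trans (normc_leD _ _) _; rewrite normc_N (splitr e); apply: lerD; apply: gd.
    rewrite (_ : _ - _ = (circ r t - circ a t) + (circ a t - circ a t0)); last by ring.
    apply: le_lt_trans (normc_leD _ _) _.
    have -> : normc (circ r t - circ a t) = `|r - a|.
      by rewrite /circ -mulrBl -rmorphB normcM normc_expi mulr1 normc_real.
    lra.
  by lra.
move=> /nbhs_ballP[d /= d0 hd]; exists d => // r r0 rd cr.
rewrite -cmeanB//; apply: normc_cmean_le_on => [t|t tI]; first exact: ctsB.
by apply: hd; rewrite /= ?in_itv//= -ball_normE /= distrC.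
Unshelve. all: end_near. Qed.

Definition holo_disc f := forall z, normc z < 1 -> holo f z.

Lemma slope_holo f z w : w != z -> holo f w -> holo (slope f z) w.
Proof.
move=> wz hf.
have h : holo (fun w => (f w - f z) * (w - z)^-1) w.
  have h1 : holo (fun w => f w - f z) w by apply: holoB => //; exact: holo_cst.
  have h2 : holo (fun w => w - z) w by apply: holoB; [exact: holo_id|exact: holo_cst].
  have wz0 : w - z != 0 by rewrite subr_eq0.
  by apply: holoM => //; apply: holoV.
apply: (@holo_near_eq R _ _ w (normc (w - z)) _ _ h).
  by rewrite normc_gt0 subr_eq0.
move=> x xw; rewrite /slope; case: eqVneq => // E.
by move: xw; rewrite E normc_sub ltxx.
Qed.

Lemma slope_cts_disc f z w : holo_disc f -> normc z < 1 -> normc w < 1 -> cts (slope f z) w.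
Proof.
move=> hf z1 w1; have [->|wz] := eqVneq w z; first by apply: slope_cts; exact: hf.
by apply: holo_cts; apply: slope_holo => //; exact: hf.
Qed.

(** Cauchy's theorem for the difference quotient, the factor [circ s t] standing for dw / (i dt).
    Inside radius |z| the mean is 0 by the mean value property, outside it is constant by
    [annulus_mean], and continuity at radius |z| joins the two. *)
Lemma mean_slope f z s : holo_disc f -> 0 < s < 1 -> normc z < s ->
  cmean (fun t => circ s t * slope f z (circ s t)) = 0.
Proof.
move=> hf /andP[s0 s1] zs; have z1 := lt_trans zs s1.
pose g w := w * slope f z w.
have cg w : normc w < 1 -> cts g w.
  by move=> w1; apply: ctsM; [exact: cts_id|exact: slope_cts_disc].
have hg w : w != z -> normc w < 1 -> holo g w.
  by move=> wz w1; apply: holoM; [exact: holo_id|apply: slope_holo => //; exact: hf].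
have g0 : g 0 = 0 by rewrite /g mul0r.
rewrite -[LHS]/(cmean (fun t => g (circ s t))).
have c0 : cts g 0 by apply: cg; rewrite normc0.
have [z0|z0] := eqVneq z 0.
  rewrite (mean_value s0) ?g0// => w /andP[w0 ws]; apply: hg.
    by rewrite z0 -normc_gt0.
  exact: le_lt_trans s1.
pose a := normc z.
have a0 : 0 < a by rewrite normc_gt0.
have cr r : 0 < r < 1 -> ccts (fun t => g (circ r t)).
  by move=> /andP[r0 r1]; apply: ccts_comp => [|w wr]; [exact: ltW|apply: cg; rewrite wr].
have K := @cmean_circ_continuous g a a0 (fun w wa => cg w (eq_ind_r (fun x => x < 1) z1 wa)).
have mlo r : 0 < r < a -> cmean (fun t => g (circ r t)) = 0.
  move=> /andP[r0 ra]; rewrite (mean_value r0) ?g0// => w /andP[w0 wr]; apply: hg.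
    by apply/eqP => E; move: ra; rewrite /a -E ltNge wr.
  by rewrite (le_lt_trans wr)// (lt_trans ra).
have mhi r : a < r <= s -> cmean (fun t => g (circ r t)) = cmean (fun t => g (circ s t)).
  move=> /andP[ar rs]; apply: annulus_mean => //; first exact: lt_trans ar.
  move=> w /andP[rw ws]; apply: hg; last exact: le_lt_trans s1.
  by apply/eqP => E; move: ar; rewrite /a -E ltNge rw.
apply: normc_eps_eq0 => e e0.
have e2 : 0 < e / 2 by rewrite divr_gt0.
have [d d0 hd] := K _ e2.
(* One radius on each side of [a], both within [d]: [a / 2] keeps the first positive, [s] caps the
   second. *)
pose r1 := Num.max (a / 2) (a - d / 2); pose r2 := Num.min s (a + d / 2).
have h1 : 0 < r1 < a by rewrite lt_max divr_gt0//= gt_max; apply/andP; split; lra.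
have h2 : a < r2 <= s by rewrite lt_min zs ge_min lexx andbT/=; lra.
have h1' : a - d / 2 <= r1 by rewrite le_max lexx orbT.
have h2' : r2 <= a + d / 2 by rewrite ge_min lexx orbT.
have [/andP[? ?] /andP[? ?]] := (h1, h2).
have := hd r1; rewrite (mlo _ h1) => A1.
have {}A1 : normc (0 - cmean (fun t => g (circ a t))) <= e / 2.
  apply: A1; [lra| |apply: cr; apply/andP; split; lra].
  by rewrite ltr_norml; apply/andP; split; lra.
have := hd r2; rewrite (mhi _ h2) => A2.
have {}A2 : normc (cmean (fun t => g (circ s t)) - cmean (fun t => g (circ a t))) <= e / 2.
  apply: A2; [lra| |apply: cr; apply/andP; split; lra].
  by rewrite ltr_norml; apply/andP; split; lra.
rewrite -[cmean _](subrK (cmean (fun t => g (circ a t)))).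
apply: le_trans (normc_leD _ _) _; rewrite (splitr e) lerD//.
by rewrite -normc_N -sub0r.
Qed.

End Cauchy.

(** * Cauchy's formula, derivatives of Cauchy integrals, Taylor remainders *)

Section CauchyFormula.
Variable R : realType.
Implicit Types (f g : R[i] -> R[i]) (k : R -> R[i]) (r t s a : R) (z w : R[i]).

Lemma circ_sub_gt0 s z t : normc z < s -> s - normc z <= normc (circ s t - z).
Proof.
move=> zs; have s0 : 0 <= s by rewrite (le_trans (normc_ge0 z))// ltW.
have := normc_leD (circ s t - z) z; rewrite subrK normc_circ//; lra.
Qed.

Lemma circ_neq s z t : normc z < s -> circ s t - z != 0.
Proof.
move=> zs; rewrite -normc_gt0; apply: lt_le_trans (circ_sub_gt0 t zs).
by rewrite subr_gt0.
Qed.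

Lemma circ_neq0 s t : 0 < s -> circ s t != 0.
Proof. by move=> s0; rewrite -normc_gt0 normc_circ// ltW. Qed.

Lemma ccts_cauchy_kernel s z : normc z < s -> ccts (fun t => (circ s t - z)^-1).
Proof.
move=> zs t; apply: ctsV; first exact: circ_neq.
by apply: ctsB; [exact: ccts_circ|exact: cts_cst].
Qed.

Lemma cctsM (k1 k2 : R -> R[i]) : ccts k1 -> ccts k2 -> ccts (fun t => k1 t * k2 t).
Proof. by move=> h1 h2 t; apply: ctsM; [exact: h1|exact: h2]. Qed.

Lemma cctsB (k1 k2 : R -> R[i]) : ccts k1 -> ccts k2 -> ccts (fun t => k1 t - k2 t).
Proof. by move=> h1 h2 t; apply: ctsB; [exact: h1|exact: h2]. Qed.

Lemma ccts_cst (c : R[i]) : ccts (fun _ : R => c).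
Proof. by move=> t; exact: cts_cst. Qed.

Lemma cctsX k n : ccts k -> ccts (fun t => k t ^+ n).
Proof. by move=> ck t; apply: ctsX; exact: ck. Qed.

(** The Cauchy integral of arbitrary boundary data [k], so that it also applies to a limit function
    whose holomorphy is still to be shown. *)
Definition cauchy_int k s z := cmean (fun t => k t * (circ s t * (circ s t - z)^-1)).

(** The kernel is holomorphic outside the circle, so the radius may grow without changing the mean,
    and w / (w - z) tends to 1 at infinity. *)
Lemma mean_cauchy_kernel s z : normc z < s -> cauchy_int (fun=> 1) s z = 1.
Proof.
move=> zs; have s0 : 0 < s by rewrite (le_lt_trans (normc_ge0 z)).
apply/eqP; rewrite -subr_eq0; apply/eqP; apply: normc_eps_eq0 => e e0.
(* On this circle |w - z| is at least |z| / e, so |w / (w - z) - 1| = |z| / |w - z| is at most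
   [e]. *)
pose r := s + normc z / e.
have z0 := normc_ge0 z.
have ze : 0 <= normc z / e by rewrite divr_ge0// ltW.
have sr : s <= r by rewrite lerDl.
have zr : normc z < r by exact: lt_le_trans sr.
have -> : cauchy_int (fun=> 1) s z = cmean (fun t => circ r t * (circ r t - z)^-1).
  rewrite -(@annulus_mean R (fun w => w * (w - z)^-1) s r)//.
    by apply: eq_cmean => t; rewrite mul1r.
  move=> w /andP[sw _]; apply: holoM; first exact: holo_id.
  apply: holoV; last by apply: holoB; [exact: holo_id|exact: holo_cst].
  rewrite subr_eq0; apply/eqP => E; move: (lt_le_trans zs sw).
  by rewrite E ltxx.
rewrite -[X in _ - X]cmean_cst -cmeanB; first last.
- exact: ccts_cst.
- by apply: cctsM; [exact: ccts_circ|exact: ccts_cauchy_kernel].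
apply: normc_cmean_le => [|t].
  apply: cctsB; last exact: ccts_cst.
  by apply: cctsM; [exact: ccts_circ|exact: ccts_cauchy_kernel].
have n0 := circ_neq t zr.
rewrite (_ : _ - _ = z * (circ r t - z)^-1); last by field.
rewrite normcM normcV ler_pdivrMr ?normc_gt0//.
apply: le_trans (ler_wpM2l (ltW e0) (circ_sub_gt0 t zr)).
rewrite /r addrAC mulrDr mulrCA divff ?mulr1 ?gt_eqF//.
by rewrite lerDr mulr_ge0 ?(ltW e0)// subr_ge0 ltW.
Qed.

Lemma ccts_disc f s : holo_disc f -> 0 <= s < 1 -> ccts (fun t => f (circ s t)).
Proof. by move=> hf /andP[s0 s1]; apply: ccts_holo => // z zs; apply: hf; rewrite zs. Qed.

Lemma cauchy_formula f s z : holo_disc f -> 0 < s < 1 -> normc z < s ->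
  f z = cauchy_int (fun t => f (circ s t)) s z.
Proof.
move=> hf s01 zs; have := mean_slope hf s01 zs; case/andP: (s01) => s0 s1.
have cf : ccts (fun t => f (circ s t)) by apply: ccts_disc; rewrite ?(ltW s0).
have ck : ccts (fun t => circ s t * (circ s t - z)^-1).
  by apply: cctsM; [exact: ccts_circ|exact: ccts_cauchy_kernel].
rewrite (_ : cmean _ = cmean (fun t => f (circ s t) * (circ s t * (circ s t - z)^-1) -
    f z * (circ s t * (circ s t - z)^-1))); last first.
  apply: eq_cmean => t; rewrite /slope ifF; last first.
    by apply/eqP => E; move: zs; rewrite -E normc_circ ?ltxx// ltW.
  by rewrite -mulrBl; ring.
rewrite cmeanB; first last.
- by apply: cctsM => //; exact: ccts_cst.
- exact: cctsM.
move/eqP; rewrite subr_eq0 => /eqP; rewrite /cauchy_int => ->.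
rewrite cmeanZ// -[LHS]mulr1 -(mean_cauchy_kernel zs); congr (_ * _).
by apply: eq_cmean => t; rewrite mul1r.
Qed.

(** The remainder is explicit: 1/(u - w) - 1/(u - z) - (w - z)/(u - z)^2 equals (w - z)^2 / ((u -
    w)(u - z)^2). *)
Lemma cauchy_int_deriv k s z (K : R) : ccts k -> (forall t, normc (k t) <= K) ->
  0 < s -> normc z < s ->
  holo (cauchy_int k s) z /\
  cderiv (cauchy_int k s) z = cmean (fun t => k t * (circ s t * (circ s t - z)^-1 ^+ 2)).
Proof.
move=> ck kK s0 zs; apply/holo_epsP => e e0.
have K0 : 0 <= K by apply: le_trans (kK 0); exact: normc_ge0.
pose D := s - normc z; have D0 : 0 < D by rewrite subr_gt0.
(* Bounds the remainder without its factor [(w - z) ^+ 2], as the circle stays at distance [D] from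
   [z] and [D / 2] from [w]; the summand 1 makes [M] positive. *)
pose M := K * s * (D / 2)^-1 * D^-1 ^+ 2 + 1.
have M0 : 0 < M.
  by rewrite ltr_wpDl// !mulr_ge0 ?exprn_ge0 ?invr_ge0 ?(ltW s0)// ltW// divr_gt0.
exists (Num.min (D / 2) (e / M)); first by rewrite lt_min !divr_gt0.
move=> w; rewrite lt_min => /andP[w1 w2].
have wz := normc_leD (w - z) z; rewrite subrK in wz.
have ws : normc w < s by rewrite /D in w1; lra.
have [cw cz] := (ccts_cauchy_kernel ws, ccts_cauchy_kernel zs).
have cc := @ccts_circ R s.
rewrite /cauchy_int -cmeanB; first last.
- by do 2 apply: cctsM => //.
- by do 2 apply: cctsM => //.
rewrite mulrC -cmeanZ; last by apply: cctsM => //; apply: cctsM => //; exact: cctsX.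
rewrite -cmeanB; first last.
- by apply: cctsM; [exact: ccts_cst|apply: cctsM => //; apply: cctsM => //; exact: cctsX].
- by apply: cctsB; do 2 apply: cctsM => //.
rewrite (_ : cmean _ = cmean (fun t => (w - z) ^+ 2 *
    (k t * (circ s t * ((circ s t - w)^-1 * (circ s t - z)^-1 ^+ 2))))); last first.
  apply: eq_cmean => t; have := circ_neq t zs; have := circ_neq t ws => h1 h2.
  by field; rewrite h1 h2.
rewrite cmeanZ; last first.
  by apply: cctsM => //; apply: cctsM => //; apply: cctsM => //; exact: cctsX.
rewrite normcM normcX expr2 mulrAC ler_wpM2r ?normc_ge0//.
have le1 : normc (cmean (fun t => k t * (circ s t * ((circ s t - w)^-1 * (circ s t - z)^-1 ^+ 2)))) <= M.
  apply: normc_cmean_le => [|t].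
    by apply: cctsM => //; apply: cctsM => //; apply: cctsM => //; exact: cctsX.
  rewrite /M (normcM (k t)) (normcM (circ s t)) (normcM (circ s t - w)^-1) normcX.
  rewrite !normcV normc_circ ?(ltW s0)//.
  apply: (@le_trans _ _ (K * s * (D / 2)^-1 * D^-1 ^+ 2)); last by rewrite lerDl.
  rewrite -!mulrA; apply: ler_pM => //; rewrite ?normc_ge0//.
    by rewrite !mulr_ge0 ?exprn_ge0 ?invr_ge0 ?normc_ge0// ltW.
  rewrite ler_wpM2l ?(ltW s0)//; apply: ler_pM.
  - by rewrite invr_ge0 normc_ge0.
  - by rewrite exprn_ge0// invr_ge0 normc_ge0.
  - rewrite lef_pV2 ?posrE ?normc_gt0 ?circ_neq ?divr_gt0//.
    by apply: le_trans (circ_sub_gt0 t ws); rewrite /D in w1 *; lra.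
  rewrite lerXn2r ?nnegrE ?invr_ge0 ?normc_ge0 ?(ltW D0)//.
  by rewrite lef_pV2 ?posrE ?normc_gt0 ?circ_neq//; exact: circ_sub_gt0.
apply: (@le_trans _ _ (normc (w - z) * M)).
  by rewrite ler_wpM2l ?normc_ge0.
by rewrite -ler_pdivlMr// ltW.
Qed.

(** By partial fractions, the difference quotient of the kernel at 0 is the kernel divided by u. The
    slope is thus again a Cauchy integral, holomorphic at 0 as well, and the step can be
    iterated. *)
Lemma cauchy_int_slope0 f k s (K : R) : ccts k -> (forall t, normc (k t) <= K) -> 0 < s ->
  (forall z, normc z < s -> f z = cauchy_int k s z) ->
  forall z, normc z < s -> slope f 0 z = cauchy_int (fun t => k t / circ s t) s z.
Proof.
move=> ck kK s0 fE z zs.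
have n0 : normc (0 : R[i]) < s by rewrite normc0.
have [hh dd] := cauchy_int_deriv ck kK s0 n0.
rewrite /slope; case: eqVneq => [->|z0].
  have -> : cderiv f 0 = cderiv (cauchy_int k s) 0.
    have [_ E] := holo_epsP f 0 (cderiv (cauchy_int k s) 0).
    apply: (E _).2 => e e0.
    have [d d0 hd] := (holo_epsP (cauchy_int k s) 0 (cderiv (cauchy_int k s) 0)).1 (conj hh erefl) e e0.
    exists (Num.min d s); first by rewrite lt_min d0.
    move=> w; rewrite lt_min => /andP[wd ws]; rewrite !fE ?normc0//; first exact: hd.
    by rewrite -(subr0 w).
  rewrite dd; apply: eq_cmean => t.
  by rewrite !subr0; have := @circ_neq0 s t s0 => h; field.
have cE w : normc w < s -> ccts (fun t => k t * (circ s t * (circ s t - w)^-1)).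
  by move=> ws; exact: (cctsM ck (cctsM (@ccts_circ _ s) (ccts_cauchy_kernel ws))).
rewrite !fE// subr0 /cauchy_int -(cmeanB (cE _ zs) (cE _ n0)).
rewrite mulrC -(cmeanZ _ (cctsB (cE _ zs) (cE _ n0))).
apply: eq_cmean => t; rewrite subr0.
have h1 := @circ_neq0 s t s0; have h2 := circ_neq t zs.
by field; rewrite h1 h2 z0.
Qed.

Definition bholo (B : R) f :=
  holo_disc f /\ (forall z, normc z < 1 -> normc (f z) <= B).

Lemma bholo_ge0 (B : R) f : bholo B f -> 0 <= B.
Proof. by move=> [_ /(_ 0)]; rewrite normc0 => /(_ ltr01); apply: le_trans; exact: normc_ge0. Qed.

(** The constant: if |z| < 1/2, the Cauchy integral over |w| = 3/4 has |w - z| >= 1/4; otherwise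
    |f(z) - f(0)| / |z| is at most 2B / (1/2). *)
Lemma bholo_slope0 (B : R) f : bholo B f -> bholo (4 * B) (slope f 0).
Proof.
move=> bf; have [hf fB] := bf; have B0 := bholo_ge0 bf.
have K s : 0 < s < 1 -> forall z, normc z < s ->
    slope f 0 z = cauchy_int (fun t => f (circ s t) / circ s t) s z.
  move=> s01; have [s0 s1] := andP s01.
  apply: (@cauchy_int_slope0 _ _ _ B) => //.
  - by apply: ccts_disc; rewrite ?(ltW s0).
  - by move=> t; apply: fB; rewrite normc_circ// ltW.
  - by move=> z zs; exact: cauchy_formula.
have cg s : 0 < s < 1 -> ccts (fun t => f (circ s t) / circ s t).
  move=> /andP[s0 s1]; apply: cctsM; first by apply: ccts_disc; rewrite ?(ltW s0).
  by move=> t; apply: ctsV; [exact: circ_neq0|exact: ccts_circ].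
have gB s t : 0 < s < 1 -> normc (f (circ s t) / circ s t) <= B / s.
  move=> /andP[s0 s1]; rewrite normcM normcV normc_circ ?(ltW s0)//.
  by rewrite ler_wpM2r ?invr_ge0 ?(ltW s0)// fB// normc_circ// ltW.
have s01 : 0 < (3 / 4 : R) < 1 by lra.
have [s0 s1] := andP s01.
split=> z z1.
  have [->|z0] := eqVneq z 0; last by apply: slope_holo => //; exact: hf.
  have n0 : normc (0 : R[i]) < 3 / 4 by rewrite normc0.
  have [h _] := cauchy_int_deriv (cg _ s01) (fun t => gB _ t s01) s0 n0.
  apply: (holo_near_eq s0 _ h) => w; rewrite subr0 => ws.
  by rewrite (K _ s01).
have [z2|z2] := ltP (normc z) (1 / 2).
  have zs : normc z < 3 / 4 by lra.
  rewrite (K _ s01 _ zs); apply: normc_cmean_le => [|t].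
    by apply: cctsM; [exact: cg|apply: cctsM; [exact: ccts_circ|exact: ccts_cauchy_kernel]].
  have h := circ_sub_gt0 t zs; have h0 : 0 < normc (circ (3 / 4) t - z) by lra.
  rewrite normcM [X in _ * X]normcM normcV normc_circ ?(ltW s0)//.
  rewrite mulrA ler_pdivrMr//.
  apply: le_trans (ler_wpM2r (ltW s0) (gB _ t s01)) _.
  rewrite divfK ?gt_eqF//; nra.
have z0 : z != 0 by rewrite -normc_gt0; lra.
rewrite /slope (negbTE z0) subr0 normcM normcV.
have zp : 0 < normc z by lra.
rewrite ler_pdivrMr//.
have h1 := fB _ z1; have h2 : normc (f 0) <= B by apply: fB; rewrite normc0.
have := normc_leD (f z) (- f 0); rewrite normc_N => h3.
nra.
Qed.

(* The remainder [g] in [f z = (Taylor polynomial of degree < N) + z ^ N g z]. *)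
Definition shiftn N f := iter N (fun g => slope g 0) f.

Definition coef f N : R[i] := shiftn N f 0.

Lemma bholo_shiftn (B : R) f N : bholo B f -> bholo (4 ^+ N * B) (shiftn N f).
Proof.
move=> bf; elim: N => [|N IH]; first by rewrite expr0 mul1r.
by rewrite exprS -mulrA; exact: bholo_slope0.
Qed.

Lemma taylor f N z : f z = \sum_(k < N) coef f k * z ^+ k + z ^+ N * shiftn N f z.
Proof.
elim: N => [|N IH]; first by rewrite big_ord0 add0r expr0 mul1r.
rewrite big_ord_recr /= {1}IH exprSr -!addrA; congr (_ + _).
have := slopeE (shiftn N f) 0 z; rewrite subr0 => /eqP; rewrite subr_eq => /eqP h.
by rewrite {1}h /coef; ring.
Qed.

Lemma shiftn_cauchy (B : R) f N s z : bholo B f -> 0 < s < 1 -> normc z < s ->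
  shiftn N f z = cauchy_int (fun t => f (circ s t) / circ s t ^+ N) s z.
Proof.
move=> bf s01; have [s0 s1] := andP s01; elim: N z => [|N IH] z zs.
  rewrite [LHS](cauchy_formula bf.1 s01 zs); apply: eq_cmean => t.
  by rewrite expr0 divr1.
rewrite [LHS](@cauchy_int_slope0 _ (fun t => f (circ s t) / circ s t ^+ N) s (B / s ^+ N))//.
- apply: eq_cmean => t; congr (_ * _); rewrite -mulrA; congr (_ * _).
  by rewrite -invfM -exprSr.
- apply: cctsM; first by apply: ccts_disc; [exact: bf.1|rewrite (ltW s0)].
  move=> t; apply: ctsV; first by rewrite expf_neq0// circ_neq0.
  by apply: ctsX; exact: ccts_circ.
- move=> t; rewrite normcM normcV normcX normc_circ ?(ltW s0)//.
  rewrite ler_wpM2r ?invr_ge0 ?exprn_ge0 ?(ltW s0)//.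
  by apply: bf.2; rewrite normc_circ// ltW.
Qed.

(** Growth like [s ^- N] instead of the [4 ^+ N] of [bholo_shiftn]: multiplied by [r ^+ N] with
    [r < s] it tends to 0. *)
Lemma shiftn_bound (B : R) f N s z : bholo B f -> 0 < s < 1 -> normc z < s ->
  normc (shiftn N f z) <= B / s ^+ N * (s / (s - normc z)).
Proof.
move=> bf s01 zs; have [s0 s1] := andP s01.
rewrite (shiftn_cauchy N bf s01 zs); apply: normc_cmean_le => [|t].
  apply: cctsM; last first.
    by apply: cctsM; [exact: ccts_circ|exact: ccts_cauchy_kernel].
  apply: cctsM; first by apply: ccts_disc; [exact: bf.1|rewrite (ltW s0)].
  move=> t; apply: ctsV; first by rewrite expf_neq0// circ_neq0.
  by apply: ctsX; exact: ccts_circ.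
rewrite normcM (normcM (f _)) normcV normcX (normcM (circ _ _)) normcV.
rewrite normc_circ ?(ltW s0)//.
apply: ler_pM.
- by rewrite mulr_ge0 ?normc_ge0// invr_ge0 exprn_ge0// ltW.
- by rewrite mulr_ge0 ?(ltW s0)// invr_ge0 normc_ge0.
- rewrite ler_wpM2r ?invr_ge0 ?exprn_ge0 ?(ltW s0)//.
  by apply: bf.2; rewrite normc_circ// ltW.
rewrite ler_wpM2l ?(ltW s0)// lef_pV2 ?posrE ?normc_gt0 ?circ_neq ?subr_gt0//.
exact: circ_sub_gt0.
Qed.

End CauchyFormula.

(** * Poisson kernel, Schwarz lemma and Harnack inequality *)

Section Poisson.
Variable R : realType.
Implicit Types (f g : R[i] -> R[i]) (r t s : R) (z w : R[i]).

Definition pker s z t : R := (s ^+ 2 - normc z ^+ 2) / normc (circ s t - z) ^+ 2.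

Lemma pker_ge0 s z t : normc z < s -> 0 <= pker s z t.
Proof.
move=> zs; rewrite /pker divr_ge0 ?exprn_ge0 ?normc_ge0// subr_ge0.
by rewrite lerXn2r ?nnegrE ?normc_ge0 ?(ltW zs)// (le_trans (normc_ge0 z))// ltW.
Qed.

Lemma rcts_pker s z : normc z < s -> rcts (pker s z).
Proof.
move=> zs; apply: rctsM; first exact: rcts_cst.
apply: rctsV => [t|]; first by rewrite expf_neq0// gt_eqF// normc_gt0 circ_neq.
apply: rctsX => t; apply: cts_normc.
by apply: ctsB; [exact: ccts_circ|exact: cts_cst].
Qed.

(** The Poisson kernel is the Cauchy kernel plus a term whose only pole in w is the reflected point
    s^2 / conj z, outside the closed disc of radius [s]. *)
Lemma pkerE s z t : 0 < s -> normc z < s ->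
  (pker s z t)%:C = circ s t * (circ s t - z)^-1 +
    z^*%C * circ s t * ((s ^+ 2)%:C - z^*%C * circ s t)^-1 :> R[i].
Proof.
move=> s0 zs; have h1 := circ_neq t zs; have h2 := @circ_neq0 R s t s0.
have h3 : (circ s t)^*%C - z^*%C != 0 by rewrite -rmorphB conjc_eq0.
have E : (s ^+ 2)%:C = circ s t * (circ s t)^*%C by rewrite mulcJ normc_circ// ltW.
have h4 : (s ^+ 2)%:C - z^*%C * circ s t != 0.
  by rewrite E mulrC -mulrBl mulf_neq0.
have n1 : (normc (circ s t - z) ^+ 2)%:C = (circ s t - z) * ((circ s t)^*%C - z^*%C).
  by rewrite -mulcJ rmorphB.
have -> : (pker s z t)%:C =
    ((s ^+ 2)%:C - (normc z ^+ 2)%:C) / (normc (circ s t - z) ^+ 2)%:C.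
  by rewrite /pker -rmorphB -fmorphV -rmorphM.
rewrite n1 -(mulcJ z).
move: h1 h2 h3 h4; rewrite E; move: (circ s t) (circ s t)^*%C z^*%C => a b c h1 h2 h3 h4.
by field; rewrite h1 h3 h4.
Qed.

(** The second term of [pkerE] times [f] is holomorphic on the closed disc and vanishes at 0, so it
    adds nothing to Cauchy's formula. *)
Lemma poisson f s z : holo_disc f -> 0 < s < 1 -> normc z < s ->
  f z = cmean (fun t => f (circ s t) * (pker s z t)%:C).
Proof.
move=> hf s01 zs; have [s0 s1] := andP s01.
pose g w := f w * (z^*%C * w * ((s ^+ 2)%:C - z^*%C * w)^-1).
have nz w : normc w <= s -> (s ^+ 2)%:C - z^*%C * w != 0.
  move=> ws; rewrite subr_eq0; apply/eqP => /(congr1 (@normc R)).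
  rewrite normc_real normcM normcJ ger0_norm ?sqr_ge0// => E.
  have := normc_ge0 z; have := normc_ge0 w; nra.
have hg w : normc w <= s -> holo g w.
  move=> ws; apply: holoM; first by apply: hf; exact: le_lt_trans s1.
  have h : holo (fun w => z^*%C * w) w by apply: holoM; [exact: holo_cst|exact: holo_id].
  apply: holoM => //; apply: holoV; first exact: nz.
  by apply: holoB => //; exact: holo_cst.
have g0 : cmean (fun t => g (circ s t)) = 0.
  rewrite (mean_value s0); first by rewrite /g mulr0 mul0r mulr0.
    by move=> w /andP[_]; exact: hg.
  by apply: holo_cts; apply: hg; rewrite normc0 ltW.
rewrite (cauchy_formula hf s01 zs) /cauchy_int -[LHS]addr0 -{1}g0 -cmeanD.
- by apply: eq_cmean => t; rewrite pkerE// mulrDr.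
- apply: cctsM; first by apply: ccts_disc; rewrite ?(ltW s0).
  by apply: cctsM; [exact: ccts_circ|exact: ccts_cauchy_kernel].
- by apply: ccts_holo => [|w ws]; [exact: ltW|apply: hg; rewrite ws].
Qed.

Lemma holo_disc_cst (c : R[i]) : holo_disc (fun=> c).
Proof. by move=> z _; exact: holo_cst. Qed.

Lemma rmean_pker s z : 0 < s < 1 -> normc z < s -> rmean (pker s z) = 1.
Proof.
move=> s01 zs; have := poisson (holo_disc_cst 1) s01 zs.
rewrite (@eq_cmean _ _ (fun t => (pker s z t)%:C)); last by move=> t; rewrite mul1r.
by rewrite cmean_real => /(congr1 (@complex.Re R)).
Qed.

Lemma poisson_le f s z : holo_disc f -> 0 < s < 1 -> normc z < s ->
  normc (f z) <= rmean (fun t => normc (f (circ s t)) * pker s z t).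
Proof.
move=> hf s01 zs; have [s0 s1] := andP s01.
have cf : ccts (fun t => f (circ s t)) by apply: ccts_disc; rewrite ?(ltW s0).
rewrite (poisson hf s01 zs); apply: normc_cmean => [||t].
- by apply: cctsM => // t; apply: cts_real; exact: rcts_pker.
- by apply: rctsM; [exact: rcts_normc|exact: rcts_pker].
by rewrite normcM normc_real ger0_norm ?pker_ge0.
Qed.

Lemma max_principle f s z (M : R) : holo_disc f -> 0 < s < 1 -> normc z < s ->
  (forall t, normc (f (circ s t)) <= M) -> normc (f z) <= M.
Proof.
move=> hf s01 zs fM; have [s0 s1] := andP s01.
have cf : ccts (fun t => f (circ s t)) by apply: ccts_disc; rewrite ?(ltW s0).
apply: le_trans (poisson_le hf s01 zs) _.
rewrite -[M]mulr1 -(rmean_pker s01 zs) -rmeanZ; last exact: rcts_pker.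
apply: le_rmean => [||t].
- by apply: rctsM; [exact: rcts_normc|exact: rcts_pker].
- by apply: rctsM; [exact: rcts_cst|exact: rcts_pker].
by rewrite ler_wpM2r// pker_ge0.
Qed.

Lemma schwarz f : bholo 1 f -> f 0 = 0 -> bholo 1 (slope f 0).
Proof.
move=> bf f0; have [hg _] := bholo_slope0 bf; split=> // z z1.
apply/ler_addgt0Pl => e e0.
(* The circle encloses [z], and on it |f(w)| / |w| <= 1 / s <= 1 + e. *)
pose s := Num.max ((1 + normc z) / 2) ((1 + e)^-1).
have e1 : 0 < 1 + e by rewrite addr_gt0.
have zs : normc z < s by rewrite lt_max; apply/orP; left; lra.
have s1 : s < 1 by rewrite gt_max invf_lt1// ltrDl e0 andbT; lra.
have s0 : 0 < s by exact: le_lt_trans (normc_ge0 z) zs.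
apply: (@max_principle _ s) => //; first by rewrite s0.
move=> t; have c0 := @circ_neq0 R s t s0.
rewrite /slope (negbTE c0) f0 !subr0 normcM normcV normc_circ ?(ltW s0)//.
rewrite ler_pdivrMr//; apply: le_trans (bf.2 _ _) _; first by rewrite normc_circ// ltW.
by rewrite mulrC -ler_pdivrMr ?addr_gt0// mul1r le_max addrC lexx orbT.
Qed.

Lemma unimodular z : exists2 c : R[i], normc c = 1 & c * z = (normc z)%:C.
Proof.
have [->|z0] := eqVneq z 0; first by exists 1; rewrite ?normc1 ?normc0 ?mulr0.
have nz : 0 < normc z by rewrite normc_gt0.
have nw : (normc z)%:C != 0 :> R[i] by rewrite -normc_gt0 normc_real ger0_norm ?normc_ge0.
exists (z^*%C / (normc z)%:C).
  rewrite normcM normcJ normcV normc_real ger0_norm ?normc_ge0// divff//.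
  by rewrite gt_eqF.
by rewrite mulrAC (mulrC _ z) mulcJ; apply: (mulIf nw); rewrite divfK// -rmorphM.
Qed.

(** With [c] rotating g(z) to its modulus, Re (1 - c g) is nonnegative, equals 1 - |g(z)| at [z] and
    is at least 1 - |g(0)| at 0. The Poisson kernel is bounded below by (s - |z|) / (s + |z|). *)
Lemma harnack_circ g s z : bholo 1 g -> 0 < s < 1 -> normc z < s ->
  (s - normc z) * (1 - normc (g 0)) <= (s + normc z) * (1 - normc (g z)).
Proof.
move=> bg s01 zs; have [s0 s1] := andP s01.
have [c c1 cg] := unimodular (g z).
have z0 := normc_ge0 z.
pose h w := 1 - c * g w.
have hh : holo_disc h.
  move=> w w1; apply: holoB; first exact: holo_cst.
  by apply: holoM; [exact: holo_cst|exact: bg.1].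
have ch : ccts (fun t => h (circ s t)) by apply: ccts_disc; rewrite ?(ltW s0).
pose v t := complex.Re (h (circ s t)).
have v0 t : 0 <= v t.
  rewrite /v /h raddfB subr_ge0; apply: le_trans (ler_norm _) _.
  apply: le_trans (normc_Re _) _; rewrite normcM c1 mul1r.
  by apply: bg.2; rewrite normc_circ// ltW.
have cv : rcts v by move=> t; apply: cts_Re; exact: ch.
have P w : normc w < s -> complex.Re (h w) = rmean (fun t => v t * pker s w t).
  move=> ws; rewrite (poisson hh s01 ws) cmean_Re; last first.
    by apply: cctsM => // t; apply: cts_real; exact: rcts_pker.
  by apply: eq_rmean => t; rewrite /v; case: (h _) => a b /=; rewrite mulr0 subr0.
have E : 1 - normc (g z) = rmean (fun t => v t * pker s z t).
  by rewrite -P// /h cg.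
have n0 : normc (0 : R[i]) < s by rewrite normc0.
have E0 : 1 - normc (g 0) <= rmean v.
  have -> : rmean v = complex.Re (h 0).
    rewrite P//; apply: eq_rmean => t.
    rewrite /pker subr0 normc0 expr0n subr0 normc_circ ?(ltW s0)// divff ?mulr1//.
    by rewrite expf_neq0// gt_eqF.
  rewrite /h raddfB lerB//; apply: le_trans (ler_norm _) _.
  by apply: le_trans (normc_Re _) _; rewrite normcM c1 mul1r.
rewrite E -rmeanZ; last by apply: rctsM => //; exact: rcts_pker.
apply: le_trans (ler_wpM2l _ E0) _; first by rewrite subr_ge0 ltW.
rewrite -rmeanZ//; apply: le_rmean => [||t].
- by apply: rctsM => //; exact: rcts_cst.
- by apply: rctsM; [exact: rcts_cst|apply: rctsM => //; exact: rcts_pker].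
rewrite mulrCA [leLHS]mulrC ler_wpM2l//.
have d0 : 0 < normc (circ s t - z) by rewrite normc_gt0 circ_neq.
have d1 : normc (circ s t - z) <= s + normc z.
  by apply: le_trans (normc_leD _ _) _; rewrite normc_N normc_circ// ltW.
rewrite /pker mulrA ler_pdivlMr ?exprn_gt0// subr_sqr [leRHS]mulrCA.
rewrite ler_wpM2l ?subr_ge0 ?(ltW zs)//.
by rewrite expr2; apply: ler_pM => //; exact: ltW.
Qed.

Lemma harnack g z : bholo 1 g -> normc z < 1 ->
  (1 - normc z) * (1 - normc (g 0)) <= (1 + normc z) * (1 - normc (g z)).
Proof.
move=> bg z1; have z0 := normc_ge0 z.
have n0 : normc (0 : R[i]) < 1 by rewrite normc0.
have g0 := bg.2 _ n0; have gz := bg.2 _ z1.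
have := normc_ge0 (g 0); have := normc_ge0 (g z).
set X := normc (g 0) in g0 *; set Y := normc (g z) in gz *; set a := normc z in z0 z1 *.
move=> Y0 X0; rewrite leNgt; apply/negP => D0.
pose D := (1 - a) * (1 - X) - (1 + a) * (1 - Y).
have D1 : 0 < D by rewrite subr_gt0.
(* At radius 1 - d the inequality of [harnack_circ] gives D <= d (Y - X) <= d <= D / 2, a
   contradiction. *)
pose d := Num.min ((1 - a) / 2) (D / 2).
have d0 : 0 < d by rewrite lt_min; apply/andP; split; lra.
have d1 : d <= (1 - a) / 2 by rewrite ge_min lexx.
have d2 : d <= D / 2 by rewrite ge_min lexx orbT.
have s01 : 0 < 1 - d < 1 by apply/andP; split; lra.
have := @harnack_circ g (1 - d) z bg s01; rewrite -/X -/Y -/a.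
have -> : a < 1 - d by lra.
move=> /(_ isT); rewrite /D in D1 d2; nra.
Qed.

End Poisson.

(** * Mean squares and Taylor coefficients *)

Section MeanSquare.
Variable R : realType.
Implicit Types (f g phi : R[i] -> R[i]) (r t s : R) (z w : R[i]).

Definition m2 f r : R := rmean (fun t => normc (f (circ r t)) ^+ 2).

Lemma rcts_sq f r : ccts (fun t => f (circ r t)) -> rcts (fun t => normc (f (circ r t)) ^+ 2).
Proof. by move=> cf; apply: rctsX; exact: rcts_normc. Qed.

Lemma m2_ge0 f r : ccts (fun t => f (circ r t)) -> 0 <= m2 f r.
Proof. by move=> cf; apply: rmean_ge0 => [|t]; [exact: rcts_sq|exact: sqr_ge0]. Qed.

Lemma m2_le f r (B : R) : ccts (fun t => f (circ r t)) ->
  (forall t, normc (f (circ r t)) <= B) -> m2 f r <= B ^+ 2.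
Proof.
move=> cf fB; rewrite -(rmean_cst (B ^+ 2)); apply: le_rmean => [||t].
- exact: rcts_sq.
- exact: rcts_cst.
by rewrite lerXn2r ?nnegrE ?normc_ge0//; exact: le_trans (normc_ge0 _) (fB t).
Qed.

Lemma ccts_bholo (B : R) f r : bholo B f -> 0 <= r < 1 -> ccts (fun t => f (circ r t)).
Proof. by move=> bf; apply: ccts_disc; exact: bf.1. Qed.

Lemma normc_sqD z w : normc (z + w) ^+ 2 =
  normc z ^+ 2 + normc w ^+ 2 + 2 * complex.Re (z^*%C * w).
Proof. by case: z => a b; case: w => c d; rewrite !sqr_normcE /=; ring. Qed.

(** [bholo 1] alone admits values of modulus 1, outside the domain of the next function in a
    composition. *)
Definition self_map phi := bholo 1 phi /\ (forall z, normc z < 1 -> normc (phi z) < 1).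

Lemma bholo_comp (B : R) g phi : bholo B g -> self_map phi ->
  bholo B (fun z => g (phi z)).
Proof.
move=> [hg gB] [[hp _] pD]; split=> z z1; last by apply: gB; exact: pD.
by apply: holo_comp; [exact: hp|apply: hg; exact: pD].
Qed.

Lemma bholoM (A B : R) f g : bholo A f -> bholo B g -> bholo (A * B) (fun z => f z * g z).
Proof.
move=> [hf fA] [hg gB]; split=> z z1; first by apply: holoM; [exact: hf|exact: hg].
by rewrite normcM ler_pM ?normc_ge0//; [exact: fA|exact: gB].
Qed.

Lemma bholo_mean (B : R) f r : bholo B f -> 0 < r < 1 -> cmean (fun t => f (circ r t)) = f 0.
Proof.
move=> [hf _] /andP[r0 r1]; apply: mean_value => // [z /andP[_ zr]|].
  by apply: hf; exact: le_lt_trans r1.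
by apply: holo_cts; apply: hf; rewrite normc0.
Qed.

Lemma shift_comp g w : g w = g 0 + w * slope g 0 w.
Proof. by have := slopeE g 0 w; rewrite subr0 => /eqP; rewrite subr_eq => /eqP ->; ring. Qed.

Lemma self_map_id : self_map (fun z => z).
Proof.
split; last by [].
by split=> z z1; [exact: holo_id|exact: ltW].
Qed.

(* The cross term of [|g 0 + phi g1(phi)|^2] has mean zero. *)
Lemma m2_shift (B : R) g phi r : bholo B g -> self_map phi -> phi 0 = 0 -> 0 < r < 1 ->
  m2 (fun z => g (phi z)) r = normc (g 0) ^+ 2 +
    rmean (fun t => normc (phi (circ r t)) ^+ 2 * normc (slope g 0 (phi (circ r t))) ^+ 2).
Proof.
move=> bg sp p0 r01; have r01' : 0 <= r < 1 by case/andP: r01 => /ltW -> ->.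
have b1 := bholo_slope0 bg; have bc := bholo_comp b1 sp.
have bm := bholoM sp.1 bc.
have c1 := ccts_bholo sp.1 r01'; have c2 := ccts_bholo bc r01'.
have cm := ccts_bholo bm r01'.
pose X t := (g 0)^*%C * (phi (circ r t) * slope g 0 (phi (circ r t))).
have cX : ccts X by apply: cctsM => //; exact: ccts_cst.
have s12 := rctsM (rctsX (n := 2) (rcts_normc c1)) (rctsX (n := 2) (rcts_normc c2)).
have E t : normc (g (phi (circ r t))) ^+ 2 = normc (g 0) ^+ 2 +
    (normc (phi (circ r t)) ^+ 2 * normc (slope g 0 (phi (circ r t))) ^+ 2 + 2 * complex.Re (X t)).
  by rewrite {1}shift_comp normc_sqD normcM exprMn addrA.
rewrite /m2 (eq_rmean E) rmeanD; first last.
- apply: rctsD => //.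
  by apply: rctsM => [|t]; [exact: rcts_cst|apply: cts_Re; exact: cX].
- exact: rcts_cst.
rewrite rmean_cst; congr (_ + _); rewrite rmeanD; first last.
- by apply: rctsM => [|t]; [exact: rcts_cst|apply: cts_Re; exact: cX].
- exact: s12.
rewrite rmeanZ; last by move=> t; apply: cts_Re; exact: cX.
rewrite -cmean_Re// /X cmeanZ// (bholo_mean bm r01) p0 mul0r mulr0.
by rewrite (raddf0 (@complex.Re R)) mulr0 addr0.
Qed.

Lemma m2_shift_id (B : R) g r : bholo B g -> 0 < r < 1 ->
  m2 g r = normc (g 0) ^+ 2 + r ^+ 2 * m2 (slope g 0) r.
Proof.
move=> bg r01; have r01' : 0 <= r < 1 by case/andP: r01 => /ltW -> ->.
rewrite [LHS](m2_shift bg self_map_id erefl r01) -rmeanZ; last first.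
  by apply: rcts_sq; exact: ccts_bholo (bholo_slope0 bg) _.
by congr (_ + _); apply: eq_rmean => t; rewrite normc_circ//; case/andP: r01'.
Qed.

(** In [m2_shift] the weight |phi|^2 is replaced by 1, at the cost of (1 - |phi|^2) times the square
    of the bound [4 * B] on the slope. *)
Lemma m2_shift_ge (B : R) g phi r : bholo B g -> self_map phi -> phi 0 = 0 -> 0 < r < 1 ->
  normc (g 0) ^+ 2 + m2 (fun z => slope g 0 (phi z)) r - (4 * B) ^+ 2 * (1 - m2 phi r)
  <= m2 (fun z => g (phi z)) r.
Proof.
move=> bg sp p0 r01; have r01' : 0 <= r < 1 by case/andP: r01 => /ltW -> ->.
have b1 := bholo_slope0 bg; have bc := bholo_comp b1 sp.
have c1 := ccts_bholo sp.1 r01'; have c2 := ccts_bholo bc r01'.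
have s1 := rctsX (n := 2) (rcts_normc c1); have s2 := rctsX (n := 2) (rcts_normc c2).
have s3 := rctsB (@rcts_cst _ 1) s1.
rewrite (m2_shift bg sp p0 r01) -addrA lerD2l lerBlDr.
have [r0 r1] := andP r01'.
have -> : (4 * B) ^+ 2 * (1 - m2 phi r) =
    rmean (fun t => (4 * B) ^+ 2 * (1 - normc (phi (circ r t)) ^+ 2)).
  by rewrite (rmeanZ _ s3) (rmeanB (@rcts_cst _ 1) s1) rmean_cst.
rewrite -(rmeanD (rctsM s1 s2) (rctsM (@rcts_cst _ _) s3)).
apply: le_rmean => [||t].
- exact: s2.
- exact: (rctsD (rctsM s1 s2) (rctsM (@rcts_cst _ _) s3)).
have ct : normc (circ r t) < 1 by rewrite normc_circ.
have h1 := bc.2 _ ct; have h2 := sp.1.2 _ ct.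
have n1 := normc_ge0 (slope g 0 (phi (circ r t))); have n2 := normc_ge0 (phi (circ r t)).
have h3 : normc (slope g 0 (phi (circ r t))) ^+ 2 <= (4 * B) ^+ 2.
  by rewrite lerXn2r ?nnegrE// (le_trans n1).
have h4 : normc (phi (circ r t)) ^+ 2 <= 1 by rewrite -(expr1n _ 2) lerXn2r ?nnegrE.
nra.
Qed.

Definition csq f N : R := \sum_(k < N) normc (coef f k) ^+ 2.

Lemma csq_ge0 f N : 0 <= csq f N.
Proof. by apply: sumr_ge0 => k _; exact: sqr_ge0. Qed.

Lemma shiftnS f N : shiftn N.+1 f = shiftn N (slope f 0).
Proof. by rewrite /shiftn iterSr. Qed.

Lemma csqS f N : csq f N.+1 = normc (f 0) ^+ 2 + csq (slope f 0) N.
Proof.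
rewrite /csq big_ord_recl; congr (_ + _); apply: eq_bigr => k _.
by rewrite /coef lift0 shiftnS.
Qed.

(** [m2_shift_ge] applied N times. The constant grows with N but does not depend on the radius. *)
Lemma csq_le_m2_comp (B : R) g phi N : bholo B g -> self_map phi -> phi 0 = 0 ->
  exists2 C : R, 0 <= C & forall r, 0 < r < 1 ->
    csq g N - C * (1 - m2 phi r) <= m2 (fun z => g (phi z)) r.
Proof.
move=> bg sp p0; elim: N B g bg => [|N IH] B g bg.
  exists 0 => // r r01; rewrite /csq big_ord0 mul0r subr0; apply: m2_ge0.
  apply: ccts_bholo (bholo_comp bg sp) _.
  by case/andP: r01 => /ltW -> ->.
have [C C0 hC] := IH _ _ (bholo_slope0 bg).
exists (C + (4 * B) ^+ 2) => [|r r01]; first by rewrite addr_ge0// sqr_ge0.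
have h1 := m2_shift_ge bg sp p0 r01; have h2 := hC _ r01.
by rewrite csqS; lra.
Qed.

Lemma m2_le_csq (B : R) g N r : bholo B g -> 0 < r < 1 ->
  m2 g r <= csq g N + (r ^+ N) ^+ 2 * m2 (shiftn N g) r.
Proof.
move=> bg r01; elim: N B g bg => [|N IH] B g bg.
  by rewrite /csq big_ord0 add0r expr0 expr1n mul1r.
rewrite (m2_shift_id bg r01) csqS -addrA lerD2l shiftnS.
have [r0 r1] := andP r01.
have h := IH _ _ (bholo_slope0 bg).
have c0 := csq_ge0 (slope g 0) N.
have r2 : r ^+ 2 <= 1 by rewrite -(expr1n _ 2) lerXn2r ?nnegrE ?ltW.
apply: le_trans (ler_wpM2l (sqr_ge0 _) h) _.
rewrite mulrDr (exprS r N) exprMn; apply: lerD; last by rewrite mulrA.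
by rewrite ler_piMl.
Qed.

End MeanSquare.

(** * Functions of unit mean: composition and Taylor coefficients *)

Section UnitMean.
Variable R : realType.
Implicit Types (f g phi : R[i] -> R[i]) (r t s : R) (z w : R[i]).

(** The shift by 2 makes already [rad 0] positive. *)
Definition rad n : R := 1 - n.+2%:R^-1.

Lemma rad_itv n : 0 < rad n < 1.
Proof.
rewrite /rad subr_gt0 invf_lt1// ltr1n gtrDl oppr_lt0 invr_gt0 ltr0n.
by [].
Qed.

Lemma rad_near (e : R) : 0 < e -> exists N, forall n, (N <= n)%N -> 1 - e < rad n.
Proof.
move=> e0; have [N _ hN] := @near_infty_natSinv_lt R (PosNum e0).
exists N => n Nn; rewrite /rad ltrD2l ltrN2.
apply: lt_trans (hN n Nn) => /=.
by rewrite ltf_pV2 ?posrE ?ltr0n// ltr_nat.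
Qed.

(* The weak form of innerness that survives composition and limits. *)
Definition unit_mean f := forall e : R, 0 < e ->
  exists N, forall n, (N <= n)%N -> 1 - e <= m2 f (rad n).

Lemma geometric_small (q e : R) : 0 <= q < 1 -> 0 < e ->
  exists N0, forall N, (N0 <= N)%N -> q ^+ N <= e.
Proof.
move=> /andP[q0 q1] e0; have := @cvg_geometric R 1 q; rewrite ger0_norm// => /(_ q1).
move=> /cvgrPdist_le /(_ _ e0) [N0 _ hN]; exists N0 => N /hN /=.
by rewrite sub0r normrN mul1r ger0_norm// exprn_ge0.
Qed.

(** With [shiftn_bound] on a circle of radius [s] between [r] and 1, the tail is at most a constant
    times a power of r / s. *)
Lemma tail_small (B : R) g r (e : R) : bholo B g -> 0 < r < 1 -> 0 < e ->
  exists N0, forall N, (N0 <= N)%N -> (r ^+ N) ^+ 2 * m2 (shiftn N g) r <= e.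
Proof.
move=> bg /andP[r0 r1] e0; have B0 := bholo_ge0 bg.
pose s := (1 + r) / 2; have s01 : 0 < s < 1 by rewrite /s; lra.
have [s0 s1] := andP s01.
have rs : r < s by rewrite /s; lra.
pose K := B * (s / (s - r)).
have K0 : 0 <= K by rewrite mulr_ge0// divr_ge0 ?subr_ge0// ltW.
pose q := r / s; have q01 : 0 <= q < 1.
  by rewrite /q divr_ge0 ?(ltW r0) ?(ltW s0)//= ltr_pdivrMr// mul1r.
have [q0 q1] := andP q01.
have K1 : 0 < K ^+ 2 + 1 by rewrite ltr_wpDl// sqr_ge0.
have [N0 hN] := geometric_small q01 (divr_gt0 e0 K1).
exists N0 => N /hN qN.
have m2b : m2 (shiftn N g) r <= (K / s ^+ N) ^+ 2.
  apply: m2_le; first by apply: ccts_bholo (bholo_shiftn N bg) _; rewrite (ltW r0).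
  move=> t; have := @shiftn_bound R B g N s (circ r t) bg s01.
  rewrite normc_circ ?(ltW r0)// => /(_ rs) h; apply: le_trans h _.
  by rewrite /K mulrAC.
apply: le_trans (ler_wpM2l (sqr_ge0 _) m2b) _.
rewrite -exprMn mulrCA -expr_div_n -/q exprMn.
have qq : (q ^+ N) ^+ 2 <= q ^+ N.
  by rewrite expr2 ler_piMl ?exprn_ge0// exprn_ile1// ltW.
have h1 : (q ^+ N) ^+ 2 <= e / (K ^+ 2 + 1) by exact: le_trans qq qN.
apply: le_trans (ler_wpM2l (sqr_ge0 K) h1) _.
by rewrite mulrCA ger_pMr// ler_pdivrMr// mul1r lerDl.
Qed.

Lemma m2_le_sup (B L : R) g r : bholo B g -> (forall N, csq g N <= L) -> 0 < r < 1 ->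
  m2 g r <= L.
Proof.
move=> bg gL r01; apply/ler_addgt0Pl => e e0.
have [N hN] := tail_small bg r01 e0.
apply: le_trans (m2_le_csq N bg r01) _; rewrite addrC.
by apply: lerD; [exact: hN|exact: gL].
Qed.

(** With [phi] the identity this is Bessel's inequality. [C] depends on N only, so the loss
    [C * (1 - m2 phi (rad n))] vanishes as n grows. *)
Lemma csq_le_sup (B L : R) g phi N : bholo B g -> self_map phi -> phi 0 = 0 ->
  unit_mean phi ->
  (exists N0, forall n, (N0 <= n)%N -> m2 (fun z => g (phi z)) (rad n) <= L) ->
  csq g N <= L.
Proof.
move=> bg sp p0 up [N0 hL]; apply/ler_addgt0Pl => e e0.
have [C C0 hC] := csq_le_m2_comp N bg sp p0.
have C1 : 0 < C + 1 by rewrite ltr_wpDl.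
have [N1 hN1] := up _ (divr_gt0 e0 C1).
pose n := maxn N0 N1.
have h1 := hL n (leq_maxl _ _); have h2 := hN1 n (leq_maxr _ _).
have h3 := hC _ (rad_itv n).
have h4 : C * (1 - m2 phi (rad n)) <= e.
  apply: (@le_trans _ _ (C * (e / (C + 1)))); first by rewrite ler_wpM2l//; lra.
  by rewrite mulrCA ger_pMr// ler_pdivrMr// mul1r lerDl.
lra.
Qed.

Lemma csq_unit_mean g (e : R) : bholo 1 g -> unit_mean g -> 0 < e ->
  exists N, 1 - e <= csq g N.
Proof.
move=> bg ug e0; have e2 : 0 < e / 2 by rewrite divr_gt0.
have [n /(_ n (leqnn _)) hn] := ug _ e2.
have [N /(_ N (leqnn _)) hN] := tail_small bg (rad_itv n) e2.
by exists N; have := m2_le_csq N bg (rad_itv n); lra.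
Qed.

(** The order of choices matters: first N, to exhaust the coefficients of [g], then the radius, to
    make [C * (1 - m2 phi (rad n))] small for the constant of that N. *)
Lemma unit_mean_comp g phi : bholo 1 g -> unit_mean g -> self_map phi -> phi 0 = 0 ->
  unit_mean phi -> unit_mean (fun z => g (phi z)).
Proof.
move=> bg ug sp p0 up e e0; have e2 : 0 < e / 2 by rewrite divr_gt0.
have [N hN] := csq_unit_mean bg ug e2.
have [C C0 hC] := csq_le_m2_comp N bg sp p0.
have C1 : 0 < C + 1 by rewrite ltr_wpDl.
have [N1 hN1] := up _ (divr_gt0 e2 C1).
exists N1 => n /hN1 h2; have h3 := hC _ (rad_itv n).
have h4 : C * (1 - m2 phi (rad n)) <= e / 2.
  apply: (@le_trans _ _ (C * (e / 2 / (C + 1)))); first by rewrite ler_wpM2l//; lra.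
  by rewrite mulrCA ger_pMr// ler_pdivrMr// mul1r lerDl.
lra.
Qed.

Lemma unit_mean_id : unit_mean (fun z => z).
Proof.
move=> e e0; have e2 : 0 < e / 2 by rewrite divr_gt0.
have [N hN] := rad_near e2; exists N => n /hN h.
have [r0 r1] := andP (rad_itv n).
have -> : m2 (fun z => z) (rad n) = rad n ^+ 2.
  rewrite /m2 -[RHS]rmean_cst; apply: eq_rmean => t.
  by rewrite normc_circ// ltW.
rewrite expr2; nra.
Qed.

Lemma csq_le1 g N : bholo 1 g -> csq g N <= 1.
Proof.
move=> bg; apply: (@csq_le_sup 1 1 g (fun z => z) N bg (@self_map_id R) erefl unit_mean_id).
exists 0 => n _; rewrite -(expr1n _ 2); have /andP[r0 r1] := rad_itv n.
apply: m2_le => [|t]; first by apply: ccts_bholo bg _; rewrite (ltW r0).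
by apply: bg.2; rewrite normc_circ// ltW.
Qed.

Lemma csq_split g K N : csq g (K + N) = csq g K + csq (shiftn K g) N.
Proof.
rewrite /csq big_split_ord; congr (_ + _); apply: eq_bigr => k _ //=.
by rewrite /coef /shiftn -iterD addnC.
Qed.

(** The coefficients of [shiftn K g] are those of [g] from index K on, and all of them have square
    sum at most 1. *)
Lemma m2_shiftn_le g K s : bholo 1 g -> 0 < s < 1 -> m2 (shiftn K g) s <= 1 - csq g K.
Proof.
move=> bg s01; apply: (m2_le_sup (bholo_shiftn K bg)) => // N.
by have := csq_le1 (K + N) bg; rewrite csq_split; lra.
Qed.

End UnitMean.

(** * Radial limits *)

Section RadialLimits.
Variable R : realType.
Implicit Types (f g phi : R[i] -> R[i]) (r t s : R) (z w l : R[i]).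
Local Notation mu := (@lebesgue_measure R).

Lemma radial_limitP f t l : radial_limit f t l <->
  (forall e : R, 0 < e -> exists2 d : R, 0 < d & forall r, 1 - d < r < 1 ->
    normc (l - f (circ r t)) <= e).
Proof.
split=> [/cvgCP fl e e0|fl].
  have /nbhs_ballP[d /= d0 hd] := fl _ e0.
  exists d => // r /andP[r0 r1]; apply: hd => //.
  by rewrite -ball_normE /= gtr0_norm ?subr_gt0//; lra.
apply/cvgCP => e /fl[d d0 hd]; apply/nbhs_ballP; exists d => //= r.
rewrite -ball_normE /= => rd r1; apply: hd; rewrite r1 andbT.
by move: rd; rewrite gtr0_norm ?subr_gt0//; lra.
Qed.

Lemma inner_self_map f : inner f -> self_map f.
Proof.
move=> [hf mf _]; split; last by move=> z /discE /mf /discE.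
by split=> z /discE zd; [split; exact: hf|apply: ltW; apply/discE; exact: mf].
Qed.

Lemma rcts_measurable (p : R -> R) (D : set R) : measurable D -> rcts p ->
  measurable_fun D (EFin \o p).
Proof.
move=> mD cp; apply/measurable_EFinP; apply: measurable_funTS.
by apply: continuous_measurable_fun => t; exact: cp.
Qed.

Lemma rint_itvco (p : R -> R) (a b : R) : rcts p ->
  (\int[mu]_(x in `[a, b[) (p x)%:E)%E = (rint a b p)%:E.
Proof.
move=> cp; have ip := @rcts_integrable R a b p (rcts_on_all cp).
rewrite integral_itv_bndo_bndc; last by apply: rcts_measurable.
rewrite /rint /Rintegral fineK//.
exact: integrable_fin_num ip.
Qed.

Lemma ae_mono (P Q : R -> Prop) : (forall x, P x -> Q x) ->
  {ae mu, forall x, P x} -> {ae mu, forall x, Q x}.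
Proof. by move=> PQ; apply: negligibleS => x /= nQ /PQ. Qed.

Lemma inner_unit_mean f : inner f -> unit_mean f.
Proof.
move=> fi; have sf := inner_self_map fi; have [_ _ fl] := fi.
pose h n t : R := 1 - normc (f (circ (rad R n) t)) ^+ 2.
have ch n : rcts (h n).
  have /andP[r0 r1] := rad_itv R n.
  apply: rctsB; [exact: rcts_cst|apply: rcts_sq].
  by apply: ccts_bholo sf.1 _; rewrite (ltW r0).
have nf n t : 0 <= normc (f (circ (rad R n) t)) <= 1.
  rewrite normc_ge0 /=; apply: sf.1.2; have /andP[r0 r1] := rad_itv R n.
  by rewrite normc_circ// ltW.
have := @dominated_convergence _ _ R mu `[0, (2 * pi : R)[ (measurable_itv _)
  (fun n => EFin \o h n) (cst 0%E) (cst 1%E).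
case.
- by move=> n; exact: rcts_measurable.
- exact: measurable_cst.
- apply: ae_mono fl => t ft tI.
  have [|l [/radial_limitP ll l1]] := ft; first by rewrite inE.
  have {}l1 : normc l = 1.
    by apply/eqP; move/eqP: l1; rewrite normCE -[1 in X in X -> _]/(1%:C) (inj_eq (@complexI _)).
  apply: cvg_EFin; first exact: nearW.
  (* Half of [e], since 1 - y^2 <= 2 (1 - y). *)
  apply/cvgrPdist_le => e e0; have [d d0 hd] := ll _ (divr_gt0 e0 (ltr0Sn R 1)).
  have [N hN] := rad_near d0; exists N => // n /= /hN rn.
  have /andP[r0 r1] := rad_itv R n.
  have := hd (rad R n); rewrite rn r1 => /(_ isT) h1.
  have /andP[n0 n1] := nf n t.
  have h2 := normc_leD (l - f (circ (rad R n) t)) (f (circ (rad R n) t)).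
  rewrite subrK l1 in h2.
  rewrite sub0r normrN /h ler_norml; apply/andP; split; nra.
- apply: (@integrableS _ _ _ mu `[0, 2 * pi]) => //.
    by apply: subset_itvl; rewrite bnd_simp.
  exact: (@rcts_integrable R 0 (2 * pi) (fun=> 1) (@rcts_on_cst R _ _ 1)).
- apply: aeW => t n _ /=; rewrite lee_fin /h.
  have /andP[n0 n1] := nf n t.
  by rewrite ler_norml; apply/andP; split; nra.
move=> _ _; rewrite integral0 => /fine_cvgP[_ /cvgrPdist_le] hc e e0.
have e1 : 0 < e * (2 * pi) by rewrite mulr_gt0 ?twopi_gt0.
have [N _ hN] := hc _ e1; exists N => n /hN /=.
rewrite rint_itvco//= sub0r normrN => h1.
have {}h1 : rint 0 (2 * pi) (h n) <= e * (2 * pi) by exact: le_trans (ler_norm _) h1.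
have : rmean (h n) <= e.
  rewrite /rmean mulrC ler_pdivrMr ?twopi_gt0//.
rewrite /h rmeanB; first last.
- apply: rcts_sq; apply: ccts_bholo sf.1 _.
  by have /andP[/ltW -> ->] := rad_itv R n.
- exact: rcts_cst.
by rewrite rmean_cst /m2; lra.
Qed.

End RadialLimits.

(** * Substitution and integration by parts on the line *)

Section RealCalculus.
Variable R : realType.
Implicit Types (p q P Q k w : R -> R) (a b c x : R).
Local Notation mu := (@lebesgue_measure R).

Lemma rint_FTC P p a b : a <= b -> rcts_on a b p ->
  (forall x, a <= x <= b -> is_derive x 1 P (p x)) -> rint a b p = P b - P a.
Proof.
rewrite le_eqVlt => /predU1P[<- _ _|ab cp dP].
  by rewrite subrr /rint set_itv1 Rintegral_set1.
have cP x : a <= x <= b -> P y @[y --> x] --> P x.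
  by move=> /dP[dx _]; apply: differentiable_continuous; exact/derivable1_diffP.
rewrite /rint /Rintegral (@continuous_FTC2 _ p P)//.
- by apply: continuous_in_subspaceT => x /set_mem; rewrite /= in_itv /=; exact: cp.
- split.
  + by move=> x; rewrite in_itv /= => /andP[/ltW xa /ltW xb]; have [|//] := dP x; rewrite xa.
  + by apply: cvg_at_right_filter; apply: cP; rewrite lexx ltW.
  + by apply: cvg_at_left_filter; apply: cP; rewrite lexx ltW.
- move=> x; rewrite in_itv /= => /andP[/ltW xa /ltW xb]; rewrite derive1E.
  by have [|_ ->//] := dP x; rewrite xa.
Qed.

Lemma is_derive_derive1 (G : R -> R) (x l : R) : derivable G x 1 ->
  derive1 G x = l -> is_derive x 1 G l.
Proof. by move=> d <-; rewrite derive1E; split. Qed.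

Lemma primitive p (A : R) : rcts p -> exists P, forall x, A < x -> is_derive x 1 P (p x).
Proof.
move=> cp; exists (fun x => \int[mu]_(t in `[A, x]) p t) => x Ax.
have ip : mu.-integrable [set` Interval (BLeft A) (BRight (x + 1))] (EFin \o p).
  by apply: rcts_integrable; exact: rcts_on_all.
have xx : x < x + 1 by rewrite ltrDl.
have [d e] := @continuous_FTC1 R p (BLeft A) x (x + 1) xx ip Ax (cp x).
exact: is_derive_derive1 d e.
Qed.

Lemma is_derive_affine (b c x : R) : is_derive x 1 (fun y : R => b * y + c) b.
Proof.
have := @is_deriveD R R R (fun y => b *: y) (cst c) x 1 b 0.
rewrite addr0; apply.
have := @is_deriveZ R R R (@id R) b x 1 1.
by rewrite /GRing.scale /= mulr1; apply.
Qed.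

Lemma rint_affine p a b (m c : R) : rcts p -> a <= b -> m = 1 \/ m = -1 ->
  rint a b (fun x => p (m * x + c)) = if m == 1 then rint (a + c) (b + c) p else rint (c - b) (c - a) p.
Proof.
move=> cp ab m1.
(* The primitive is differentiable only to the right of its base point, so the base lies below both
   possible image intervals. *)
pose A := Num.min (a + c) (c - b) - 1.
have [P dP] := primitive A cp.
have A1 : A < a + c by rewrite /A ltrBlDr gt_min ltrDl ltr01.
have A2 : A < c - b by rewrite /A ltrBlDr gt_min ltrDl ltr01 orbT.
have cpm : rcts (fun x => p (m * x + c)).
  move=> x; apply: (@cvg_comp _ _ _ (fun y => m * y + c) p _ (nbhs (m * x + c))); last exact: cp.
  by apply: cvgD; [apply: cvgM; [exact: cvg_cst|exact: cvg_id]|exact: cvg_cst].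
have cpa : rcts (fun x => m * p (m * x + c)) by apply: rctsM => //; exact: rcts_cst.
have E : rint a b (fun x => m * p (m * x + c)) = P (m * b + c) - P (m * a + c).
  apply: (@rint_FTC (fun x => P (m * x + c)) _ a b ab (rcts_on_all cpa)) => x /andP[xa xb].
  rewrite mulrC; apply: (@is_derive1_comp R P (fun y => m * y + c) x (p (m * x + c)) m).
    by apply: dP; case: m1 => ->; rewrite ?mul1r ?mulN1r; lra.
  exact: is_derive_affine.
have FTC u v : u <= v -> A < u -> P v - P u = rint u v p.
  move=> uv Au; apply/esym/(rint_FTC uv (rcts_on_all cp)) => x /andP[ux _].
  by apply: dP; exact: lt_le_trans ux.
case: m1 => mE; move: E; rewrite mE.
  rewrite eqxx !mul1r (_ : (fun x => 1 * _) = fun x => p (1 * x + c)); last first.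
    by apply/funext => x; rewrite mul1r.
  by move=> ->; rewrite FTC// lerD2r.
rewrite ifF; last by apply/eqP; lra.
rewrite !mulN1r rintZ; last by apply: rcts_on_all; rewrite -mE.
set I := rint a b _ => E.
have -> : I = P (- a + c) - P (- b + c) by lra.
by rewrite (addrC (- a)) (addrC (- b)) FTC// lerB.
Qed.

Lemma rint_shift p a b c : rcts p -> a <= b ->
  rint a b (fun x => p (x + c)) = rint (a + c) (b + c) p.
Proof.
move=> cp ab; have := rint_affine c cp ab (or_introl erefl); rewrite eqxx => <-.
by apply: eq_rint => x _; rewrite mul1r.
Qed.

Lemma rint_reflect p a b c : rcts p -> a <= b ->
  rint a b (fun x => p (c - x)) = rint (c - b) (c - a) p.
Proof.
move=> cp ab; have := rint_affine c cp ab (or_intror erefl).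
rewrite ifF; last by apply/eqP; lra.
by move=> <-; apply: eq_rint => x _; rewrite mulN1r addrC.
Qed.

(* Integrate by parts against [x |-> rint 0 x w - H x], which is nonpositive. *)
Lemma rint_decreasing_weight (w k k' : R -> R) (c H : R) : 0 <= c -> rcts w -> rcts k' ->
  (forall x, is_derive x 1 k (k' x)) -> (forall x, 0 <= x <= c -> k' x <= 0) ->
  (forall x, 0 <= x <= c -> 0 <= k x) ->
  (forall x, 0 <= x <= c -> rint 0 x w <= H * x) ->
  rint 0 c (fun x => w x * k x) <= H * rint 0 c k.
Proof.
move=> c0 cw ck' dk k'0 k0 wH.
have ck : rcts k.
  by move=> x; have [d _] := dk x; apply: differentiable_continuous; exact/derivable1_diffP.
(* Based at -1 to be differentiable at the endpoint 0 too. *)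
have [W dW] := primitive (-1) cw.
pose V x := W x - W 0 - H * x.
have dV x : -1 < x -> is_derive x 1 V (w x - H).
  move=> x1; have := @is_deriveB R R R W (fun y => H * y + W 0) x 1 (w x) H (dW _ x1) (is_derive_affine _ _ _).
  rewrite (_ : W - _ = V)//.
  by apply/funext => y; rewrite -[LHS]/(W y - (H * y + W 0)) /V; ring.
have V0 x : 0 <= x <= c -> V x <= 0.
  move=> xc; have := wH x xc; case/andP: xc => x0 xc.
  have -> : rint 0 x w = W x - W 0.
    apply: (rint_FTC x0 (rcts_on_all cw)) => y /andP[y0 _]; apply: dW; lra.
  by rewrite /V; lra.
have cwH : rcts (fun x => w x - H) by apply: rctsB => //; exact: rcts_cst.
have cVk' : rcts_on 0 c (fun x => V x * k' x).
  apply: rcts_onM; last exact: rcts_on_all.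
  move=> x /andP[x0 _]; have [|d _] := dV x; first by lra.
  by apply: differentiable_continuous; exact/derivable1_diffP.
have c1 : rcts_on 0 c (fun x => (w x - H) * k x) by apply: rcts_on_all; exact: rctsM.
have dVk x : 0 <= x <= c -> is_derive x 1 (fun y => V y * k y) ((w x - H) * k x + V x * k' x).
  move=> /andP[x0 _]; have dx : is_derive x 1 V (w x - H) by apply: dV; lra.
  have := @is_deriveM R R V k x 1 _ _ dx (dk x).
  by rewrite /GRing.scale /= [X in is_derive _ _ _ X]addrC (mulrC (k x)).
have := rint_FTC c0 (rcts_onD c1 cVk') dVk.
rewrite rintD// (_ : V 0 = 0) ?mul0r ?subr0; last by rewrite /V subrr mulr0 subr0.
have cc : 0 <= c <= c by rewrite c0 lexx.
have VV := mulr_le0_ge0 (V0 c cc) (k0 c cc).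
have Vk0 : 0 <= rint 0 c (fun x => V x * k' x).
  apply: Rintegral_ge0 => x; rewrite /= in_itv /= => xc.
  by apply: mulr_le0; [exact: V0|exact: k'0].
have -> : rint 0 c (fun x => (w x - H) * k x) = rint 0 c (fun x => w x * k x) - H * rint 0 c k.
  rewrite -rintZ; last exact: rcts_on_all.
  rewrite -rintB; first last.
  - by apply: rcts_onZ; exact: rcts_on_all.
  - by apply: rcts_on_all; exact: rctsM.
  by apply: eq_rint => x _; rewrite mulrBl.
lra.
Qed.

End RealCalculus.

(** * Values on a radius bounded by means over arcs *)

Section RadialMaximal.
Variable R : realType.
Implicit Types (h : R[i] -> R[i]) (r s t x c H : R).
Local Notation mu := (@lebesgue_measure R).

Lemma expiD (x y : R) : expi (x + y) = expi x * expi y :> R[i].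
Proof.
rewrite /expi sinD cosD; apply/eqP; rewrite eq_complex /=.
by apply/andP; split; apply/eqP; ring.
Qed.

Lemma circD r (x y : R) : circ r (x + y) = expi x * circ r y.
Proof. by rewrite /circ expiD; ring. Qed.

Lemma circ_periodic r x : circ r (x + 2 * pi) = circ r x.
Proof. by rewrite /circ /expi mulr_natl cosD2pi sinD2pi. Qed.

(** The Poisson kernel at the point [r] of the real axis, as an even function of the angle. *)
Definition rker r s x : R := (s ^+ 2 - r ^+ 2) / (s ^+ 2 + r ^+ 2 - 2 * r * s * cos x).

Lemma pker_real r s x : 0 <= r -> pker s r%:C x = rker r s x.
Proof.
move=> r0; rewrite /pker /rker normc_real ger0_norm//; congr (_ / _).
rewrite sqr_normcE /circ /expi /= !(mul0r, subr0, addr0, add0r, oppr0, mulr0).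
have := cos2Dsin2 x; set C := cos x; set S := sin x => E.
rewrite [LHS](_ : _ = s ^+ 2 * (C ^+ 2 + S ^+ 2) + r ^+ 2 - 2 * r * s * C); last by ring.
by rewrite E mulr1.
Qed.

Lemma rker_den_gt0 r s x : 0 <= r < s -> 0 < s ^+ 2 + r ^+ 2 - 2 * r * s * cos x.
Proof.
move=> /andP[r0 rs]; have c1 := cos_le1 x.
have : 2 * r * s * cos x <= 2 * r * s.
  by rewrite ler_piMr// !mulr_ge0// ltW// (le_lt_trans r0).
have : 0 < (s - r) ^+ 2 by rewrite exprn_gt0// subr_gt0.
by rewrite !expr2; nra.
Qed.

Lemma rker_ge0 r s x : 0 <= r < s -> 0 <= rker r s x.
Proof.
move=> rs; rewrite divr_ge0 ?(ltW (rker_den_gt0 _ rs))//.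
by move/andP: rs => [r0 /ltW rs]; rewrite subr_ge0 lerXn2r ?nnegrE// (le_trans r0).
Qed.

Definition rker' r s x : R := - ((s ^+ 2 - r ^+ 2) * (2 * r * s * sin x)) /
  (s ^+ 2 + r ^+ 2 - 2 * r * s * cos x) ^+ 2.

Lemma rcts_cos : rcts (@cos R).
Proof. by move=> x; exact: continuous_cos. Qed.

Lemma rcts_sin : rcts (@sin R).
Proof. by move=> x; exact: continuous_sin. Qed.

Lemma rcts_rker_den r s : rcts (fun x => s ^+ 2 + r ^+ 2 - 2 * r * s * cos x).
Proof.
by apply: rctsB; [exact: rcts_cst|apply: rctsM; [exact: rcts_cst|exact: rcts_cos]].
Qed.

Lemma rcts_rker r s : 0 <= r < s -> rcts (rker r s).
Proof.
move=> rs; apply: rctsM; first exact: rcts_cst.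
apply: rctsV; last exact: rcts_rker_den.
by move=> t; rewrite gt_eqF// rker_den_gt0.
Qed.

Lemma rcts_rker' r s : 0 <= r < s -> rcts (rker' r s).
Proof.
move=> rs; apply: rctsM.
  rewrite (_ : (fun x => _) = fun x => - ((s ^+ 2 - r ^+ 2) * (2 * r * s)) * sin x).
    by apply: rctsM; [exact: rcts_cst|exact: rcts_sin].
  by apply/funext => x; ring.
apply: rctsV; last by apply: rctsX; exact: rcts_rker_den.
by move=> t; rewrite expf_neq0// gt_eqF// rker_den_gt0.
Qed.

Lemma is_derive_rker r s x : 0 <= r < s -> is_derive x 1 (rker r s) (rker' r s x).
Proof.
move=> rs; have d0 := rker_den_gt0 x rs; have dn0 := gt_eqF d0.
pose D := fun x : R => s ^+ 2 + r ^+ 2 - 2 * r * s * cos x.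
have dD : is_derive x 1 D (2 * r * s * sin x).
  have h := @is_derive1_comp R (fun y => (- (2 * r * s)) * y + (s ^+ 2 + r ^+ 2)) cos x _ _
    (is_derive_affine _ _ _) (is_derive_cos x).
  rewrite mulrNN in h.
  by rewrite (_ : D = (fun y => - (2 * r * s) * y + (s ^+ 2 + r ^+ 2)) \o cos)//;
    apply/funext => y; rewrite /D /=; ring.
have [dd ed] := dD.
have Dx : D x != 0 by rewrite /D dn0.
have dV : derivable (fun y => (D y)^-1) x 1 by exact: derivableV.
have eV : 'D_1 (fun y => (D y)^-1) x = - (D x) ^- 2 *: 'D_1 D x by exact: deriveV.
have iV : is_derive x 1 (fun y => (D y)^-1) (- (D x) ^- 2 * (2 * r * s * sin x)).
  by split=> //; rewrite eV ed.
have := @is_derive1_comp R (fun y => (s ^+ 2 - r ^+ 2) * y + 0) _ x _ _ (is_derive_affine _ _ _) iV.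
rewrite (_ : _ \o _ = rker r s); last first.
  by apply/funext => y; rewrite /= addr0.
rewrite (_ : _ * _ = rker' r s x)// /rker' -/(D x).
by field.
Qed.

Lemma rker'_le0 r s x : 0 <= r < s -> 0 <= x <= pi -> rker' r s x <= 0.
Proof.
move=> rs xpi; have /andP[r0 sr] := rs.
have s0 : 0 <= s by rewrite (le_trans r0)// ltW.
rewrite /rker' mulNr oppr_le0 divr_ge0 ?sqr_ge0//.
rewrite mulr_ge0 ?subr_ge0 ?lerXn2r ?nnegrE ?(ltW sr)//.
by rewrite !mulr_ge0// sin_ge0_pi.
Qed.

(** The kernel decreases only on half a period; its evenness folds the other half onto it, and the
    folded weight integrates to the mass of [w] on arcs centred at [t]. *)
Lemma rint_fold (w : R -> R) r s t : rcts w -> (forall x, w (x + 2 * pi) = w x) ->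
  0 <= r < s ->
  rint 0 (2 * pi) (fun x => w (t + x) * rker r s x) =
  rint 0 pi (fun x => (w (t + x) + w (t - x)) * rker r s x).
Proof.
move=> cw pw rs; have pi0 := pi_gt0 R.
have cwt : rcts (fun x => w (t + x)).
  move=> x; apply: (@cvg_comp _ _ _ (fun y => t + y) w _ (nbhs (t + x))); last exact: cw.
  by apply: cvgD; [exact: cvg_cst|exact: cvg_id].
have cwt' : rcts (fun x => w (t - x)).
  move=> x; apply: (@cvg_comp _ _ _ (fun y => t - y) w _ (nbhs (t - x))); last exact: cw.
  by apply: cvgB; [exact: cvg_cst|exact: cvg_id].
have ck := rcts_rker rs.
have cp := rctsM cwt ck; have cp' := rctsM cwt' ck.
rewrite (@rint_split _ 0 pi (2 * pi) _ _ (rcts_on_all cp)); last first.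
  by apply/andP; split; [exact: ltW|lra].
have -> : rint pi (2 * pi) (fun x => w (t + x) * rker r s x) =
    rint 0 pi (fun x => w (t - x) * rker r s x).
  have := @rint_reflect R _ 0 pi (2 * pi) cp (ltW pi0).
  rewrite subr0 (_ : 2 * pi - pi = pi); last by ring.
  move=> <-; apply: eq_rint => x _; congr (_ * _).
    by rewrite addrCA addrC pw.
  by rewrite /rker (mulr_natl pi) cosB cos2pi sin2pi mul1r mul0r addr0.
rewrite -rintD; try exact: rcts_on_all.
by apply: eq_rint => x _; rewrite mulrDl.
Qed.

Lemma rint_rker r s : 0 <= r < s -> s < 1 -> rint 0 pi (rker r s) = pi.
Proof.
move=> rs s1; have /andP[r0 sr] := rs; have s0 := le_lt_trans r0 sr.
have := @rint_fold (fun=> 1) r s 0 (@rcts_cst R 1) (fun=> erefl) rs.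
have s01 : 0 < s < 1 by rewrite s0.
have rc : normc (r%:C : R[i]) < s by rewrite normc_real ger0_norm.
have := rmean_pker s01 rc; rewrite /rmean.
rewrite (@eq_rint _ _ _ _ (rker r s)); last by move=> x _; exact: pker_real.
rewrite (@eq_rint _ _ _ (fun x => 1 * rker r s x) (rker r s)); last by move=> x _; rewrite mul1r.
rewrite (@eq_rint _ _ _ (fun x => (1 + 1) * rker r s x) (fun x => 2 * rker r s x)); last first.
  by move=> x _; congr (_ * _); lra.
rewrite rintZ; last by apply: rcts_on_all; exact: rcts_rker.
move=> E1 E2; rewrite E2 in E1.
have pn : (2 * pi : R) != 0 by rewrite gt_eqF// twopi_gt0.
have : 2 * rint 0 pi (rker r s) = 2 * pi.
  by rewrite -[LHS](mulVKf pn) E1 mulr1.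
by lra.
Qed.

(* The Poisson kernel decreases on [0, pi], so the means of [|h|] over the arcs
   centred at [t] control [h] on the radius ending at [t]. *)
Lemma radial_bound h r s t H : holo_disc h -> 0 <= r < s -> s < 1 ->
  (forall x, 0 <= x <= pi -> rint (t - x) (t + x) (fun y => normc (h (circ s y))) <= 2 * H * x) ->
  normc (h (circ r t)) <= H.
Proof.
move=> hh rs s1 wH; have /andP[r0 sr] := rs; have s0 := le_lt_trans r0 sr.
have pi0 := pi_gt0 R; have s01 : 0 < s < 1 by rewrite s0.
pose w y := normc (h (circ s y)).
have cw : rcts w by apply: rcts_normc; apply: ccts_disc; rewrite ?(ltW s0).
have pw x : w (x + 2 * pi) = w x by rewrite /w circ_periodic.
(* A rotation brings the radius onto the positive real axis, where the Poisson kernel is [rker]. *)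
have ht : holo_disc (fun z => h (expi t * z)).
  move=> z z1; apply: holo_comp; first by apply: holoM; [exact: holo_cst|exact: holo_id].
  by apply: hh; rewrite normcM normc_expi mul1r.
have rc : normc (r%:C : R[i]) < s by rewrite normc_real ger0_norm.
have := poisson_le ht s01 rc.
rewrite (_ : expi t * r%:C = circ r t); last by rewrite /circ mulrC.
move=> le1; apply: le_trans le1 _.
rewrite (@eq_rmean _ _ (fun x => w (t + x) * rker r s x)); last first.
  by move=> x; rewrite /w circD pker_real.
rewrite /rmean rint_fold// mulrC ler_pdivrMr ?twopi_gt0//.
have cwt : rcts (fun x => w (t + x)).
  move=> x; apply: (@cvg_comp _ _ _ (fun y => t + y) w _ (nbhs (t + x))); last exact: cw.
  by apply: cvgD; [exact: cvg_cst|exact: cvg_id].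
have cwt' : rcts (fun x => w (t - x)).
  move=> x; apply: (@cvg_comp _ _ _ (fun y => t - y) w _ (nbhs (t - x))); last exact: cw.
  by apply: cvgB; [exact: cvg_cst|exact: cvg_id].
have := @rint_decreasing_weight R (fun x => w (t + x) + w (t - x)) (rker r s) (rker' r s)
  pi (2 * H) (ltW pi0) (rctsD cwt cwt') (rcts_rker' rs) (fun x => is_derive_rker x rs)
  (fun x => rker'_le0 rs) (fun x _ => rker_ge0 x rs).
rewrite rint_rker// (_ : H * (2 * pi) = 2 * H * pi); last by ring.
apply=> x xpi; apply: le_trans (wH x xpi); have /andP[x0 _] := xpi.
rewrite rintD; try exact: rcts_on_all.
rewrite rint_reflect// subr0.
rewrite (@eq_rint _ _ _ _ (fun x => w (x + t))); last by move=> y _; rewrite addrC.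
rewrite rint_shift// add0r (addrC x) [leRHS](@rint_split _ (t - x) t (t + x)).
- by rewrite [leLHS]addrC.
- by apply/andP; split; lra.
- exact: (rcts_on_all cw).
Qed.

End RadialMaximal.

(** * Weak-type bounds and smallness of Taylor tails on almost every radius *)

Section Fatou.
Variable R : realType.
Implicit Types (h F : R[i] -> R[i]) (r s t x c : R).
Local Notation mu := (@lebesgue_measure R).

(** The maximal inequality is stated with an integral over the whole line, so the periodic [w] is
    cut off outside an interval that contains every arc in question. *)
Lemma HL_maximal_rint (w : R -> R) (A B t x c : R) : rcts w -> (forall y, 0 <= w y) ->
  0 < x -> A <= t - x -> t + x <= B ->
  (HL_maximal (w \_ `[A, B]) t <= c%:E)%E -> rint (t - x) (t + x) w <= 2 * c * x.
Proof.
move=> cw w0 x0 At tB.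
have h1 : (iavg (w \_ `[A, B]) (ball t x) <= HL_maximal (w \_ `[A, B]) t)%E.
  by apply: ereal_sup_ubound; exists x => //; rewrite /= in_itv /= andbT.
move=> /(le_trans h1); rewrite /iavg lebesgue_measure_ball ?(ltW x0)//.
have x2 : 0 < x *+ 2 by rewrite pmulrn_lgt0.
rewrite inver gt_eqF// lee_pdivrMl// => h2.
rewrite -lee_fin (_ : 2 * c * x = x *+ 2 * c); last by rewrite -mulr_natl; ring.
rewrite EFinM; apply: le_trans h2; rewrite ball_itv.
have cwi : mu.-integrable `[t - x, t + x] (EFin \o w) by apply: rcts_integrable; exact: rcts_on_all.
rewrite /rint /Rintegral fineK; last exact: integrable_fin_num cwi.
rewrite (@integral_itv_bndoo R _ _ (EFin \o w) true false); last exact: rcts_measurable.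
rewrite le_eqVlt; apply/orP; left; apply/eqP; apply: eq_integral => y.
rewrite inE /= in_itv /= => /andP[y1 y2].
rewrite patchE ifT; last by rewrite inE /= in_itv /=; apply/andP; split; lra.
by rewrite /= ger0_norm.
Qed.

Lemma rint_periodic3 (w : R -> R) : rcts w -> (forall x, w (x + 2 * pi) = w x) ->
  rint (- (2 * pi)) (2 * pi + 2 * pi) w = 3 * rint 0 (2 * pi) w.
Proof.
move=> cw pw; have p0 := twopi_gt0 R.
rewrite (@rint_split _ _ 0 _ _ _ (rcts_on_all cw)); last by apply/andP; split; lra.
rewrite (@rint_split _ 0 (2 * pi) _ _ _ (rcts_on_all cw)); last by apply/andP; split; lra.
have -> : rint (2 * pi) (2 * pi + 2 * pi) w = rint 0 (2 * pi) w.
  rewrite -[X in rint X _ w]add0r -rint_shift ?(ltW p0)//.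
  by apply: eq_rint => x _; exact: pw.
have -> : rint (- (2 * pi)) 0 w = rint 0 (2 * pi) w.
  rewrite -[X in rint X _ w]add0r -[X in rint _ X w](subrr (2 * pi)) -rint_shift ?(ltW p0)//.
  by apply: eq_rint => x _; rewrite -pw subrK.
lra.
Qed.

(* [18 pi = 3 * 3 * 2 pi]: the constant of the maximal inequality, times the three
   periods that contain every arc centred in [0, 2 pi]. *)
Lemma weak_type_circ h s c (tau : R) : holo_disc h -> 0 < s < 1 -> 0 < c ->
  rmean (fun t => normc (h (circ s t))) <= tau ->
  exists2 E : set R, measurable E &
    (mu E <= (18 * pi * tau / c)%:E)%E /\
    forall t, 0 <= t < 2 * pi -> forall r, 0 <= r < s -> c < normc (h (circ r t)) -> E t.
Proof.
move=> hh s01 c0 wt; have [s0 s1] := andP s01; have p0 := twopi_gt0 R.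
pose w y := normc (h (circ s y)).
have cw : rcts w by apply: rcts_normc; apply: ccts_disc; rewrite ?(ltW s0).
have pw x : w (x + 2 * pi) = w x by rewrite /w circ_periodic.
pose A : R := - (2 * pi); pose B : R := 2 * pi + 2 * pi.
have wi : mu.-integrable `[A, B] (EFin \o w) by apply: rcts_integrable; exact: rcts_on_all.
have li : locally_integrable setT (w \_ `[A, B]) by exact: integrable_locally wi.
exists [set t | (c%:E < HL_maximal (w \_ `[A, B]) t)%E].
  rewrite -[X in measurable X]setTI; apply: emeasurable_fun_o_infty => //.
  exact: measurable_HL_maximal.
split.
  apply: le_trans (maximal_inequality li c0) _.
  have -> : (\int[mu]_y `|((w \_ `[A, B]) y)%:E| = (rint A B w)%:E)%E.
    rewrite /rint /Rintegral fineK; last exact: integrable_fin_num wi.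
    rewrite [RHS]integral_mkcond; apply: eq_integral => y _.
    by rewrite !patchE; case: ifPn => _ /=; rewrite ?normr0// ger0_norm// normc_ge0.
  rewrite rint_periodic3// -EFinM lee_fin.
  move: wt; rewrite /rmean mulrC ler_pdivrMr// => wt.
  rewrite mulrAC ler_wpM2r ?invr_ge0 ?(ltW c0)//.
  have {}wt : rint 0 (2 * pi) w <= tau * (2 * pi) by [].
  lra.
move=> t /andP[t0 t1] r /andP[r0 rs] hc; rewrite /= ltNge; apply/negP => tE.
move: hc; rewrite ltNge => /negP; apply.
apply: (@radial_bound R h r s t c hh) => //; first by rewrite r0.
move=> x /andP[]; rewrite le_eqVlt => /predU1P[<- _|x0 xpi].
  by rewrite subr0 addr0 mulr0 /rint set_itv1 Rintegral_set1.
apply: (@HL_maximal_rint w A B) => //.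
- by move=> y; exact: normc_ge0.
- by rewrite /A; lra.
- by rewrite /B; lra.
Qed.

(** The sets of [weak_type_circ] need not be nested as [s] grows. The exact exceptional sets are, so
    [weak_type_circ] is used only to bound their measures. *)
Lemma weak_type (B : R) h c (tau : R) : bholo B h -> 0 < c ->
  (forall s, 0 < s < 1 -> rmean (fun t => normc (h (circ s t))) <= tau) ->
  exists2 E : set R, measurable E &
    (mu E <= (18 * pi * tau / c)%:E)%E /\
    forall t, 0 <= t < 2 * pi -> forall r, 0 <= r < 1 -> c < normc (h (circ r t)) -> E t.
Proof.
move=> bh c0 ht.
(* The union is uncountable, but of open sets, hence open and measurable. *)
pose O j := \bigcup_(r in [set r : R | 0 <= r < rad R j])
  ((fun t => normc (h (circ r t))) @^-1` [set y | c < y]).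
pose E j := `[(0 : R), 2 * pi[%classic `&` O j.
have radS i j : (i <= j)%N -> rad R i <= rad R j.
  by move=> ij; rewrite /rad lerD2l lerN2 lef_pV2 ?posrE ?ltr0n// ler_nat.
have mE j : measurable (E j).
  apply: measurableI => //; apply: open_measurable; apply: bigcup_open => r /= /andP[r0 r1].
  apply: open_comp; last exact: open_gt.
  have cr : ccts (fun t => h (circ r t)).
    by apply: ccts_bholo bh _; rewrite r0 (lt_trans r1)//; case/andP: (rad_itv R j).
  by move=> t _; exact: (cts_normc (cr t)).
exists (\bigcup_j E j); first exact: bigcup_measurable.
split; last first.
  move=> t t01 r /andP[r0 r1] hc.
  have r1' : 0 < 1 - r by rewrite subr_gt0.
  have [N hN] := rad_near r1'.
  exists N => //; split; first by rewrite /= in_itv.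
  exists r => //=; rewrite r0 /=; apply: le_lt_trans (hN N (leqnn _)); lra.
have lim := @nondecreasing_cvg_mu _ _ R mu E mE (bigcup_measurable (fun k _ => mE k)) _.
have {}lim := lim _.
have : (mu \o E) x @[x --> \oo] --> mu (\bigcup_n E n).
  apply: lim => i j ij; apply/subsetPset; apply: setIS => t [r /= /andP[r0 ri] rt].
  by exists r => //=; rewrite r0 (lt_le_trans ri)// radS.
move=> {}lim; rewrite -(cvg_lim _ lim)//; apply: lime_le.
  by apply/cvg_ex; exists (mu (\bigcup_n E n)).
apply: nearW => j /=.
have s01 := rad_itv R j.
have [E' mE' [E'm E'P]] := weak_type_circ bh.1 s01 c0 (ht _ s01).
apply: le_trans E'm; apply: le_measure; rewrite ?inE; [exact: mE|exact: mE'|].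
move=> t [/=]; rewrite in_itv /= => tI [r /= rj rt].
exact: (E'P t tI r).
Qed.

(** Integrating 2 tau |F| <= tau^2 + |F|^2 takes the place of the Cauchy-Schwarz inequality. *)
Lemma rmean_normc_le F s (tau : R) : ccts (fun t => F (circ s t)) -> 0 < tau ->
  m2 F s <= tau ^+ 2 -> rmean (fun t => normc (F (circ s t))) <= tau.
Proof.
move=> cF t0 mF; have cn := rcts_normc cF; have c2 := rctsX (n := 2) cn.
have : rmean (fun t => 2 * tau * normc (F (circ s t))) <=
    rmean (fun t => tau ^+ 2 + normc (F (circ s t)) ^+ 2).
  apply: le_rmean => [||t].
  - by apply: rctsM => //; exact: rcts_cst.
  - by apply: rctsD => //; exact: rcts_cst.
  by rewrite -subr_ge0 (_ : _ - _ = (tau - normc (F (circ s t))) ^+ 2) ?sqr_ge0//; ring.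
rewrite rmeanZ// rmeanD//; last exact: rcts_cst.
rewrite rmean_cst -/(m2 F s) => h; rewrite -(ler_pM2l t0); nra.
Qed.

(* A radius on which no Taylor tail is small lies in all the exceptional sets of the
   weak-type bound, and their measures tend to 0. *)
Lemma fatou_cauchy F : bholo 1 F -> unit_mean F ->
  {ae mu, forall t, 0 <= t < 2 * pi -> forall c, 0 < c ->
    exists K, forall r, 0 <= r < 1 ->
      normc (circ r t ^+ K * shiftn K F (circ r t)) <= c}.
Proof.
move=> bF uF.
have main (m : nat) : {ae mu, forall t, 0 <= t < 2 * pi ->
    exists K, forall r, 0 <= r < 1 ->
      normc (circ r t ^+ K * shiftn K F (circ r t)) <= m.+1%:R^-1}.
  pose c : R := m.+1%:R^-1; have c0 : 0 < c by rewrite invr_gt0 ltr0n.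
  pose h K z := z ^+ K * shiftn K F z.
  have bid : bholo 1 (fun z : R[i] => z) by exact: (@self_map_id R).1.
  have bh K : bholo (4 ^+ K * 1) (h K).
    have bX : bholo 1 (fun z : R[i] => z ^+ K).
      split=> z z1; first by apply: holoX; exact: holo_id.
      by rewrite normcX exprn_ile1 ?normc_ge0// ltW.
    by have := bholoM bX (bholo_shiftn K bF); rewrite mul1r.
  have hm (n : nat) : exists K, forall s, 0 < s < 1 ->
      rmean (fun t => normc (h K (circ s t))) <= n.+1%:R^-1.
    have n0 : 0 < n.+1%:R^-1 :> R by rewrite invr_gt0 ltr0n.
    (* The square of the desired bound: [rmean_normc_le] takes its root when passing from mean
       squares to means. *)
    have [K hK] := csq_unit_mean bF uF (exprn_gt0 2 n0).
    exists K => s s01; have [s0 s1] := andP s01.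
    have s01' : 0 <= s < 1 by rewrite ltW.
    have ch := ccts_bholo (bh K) s01'.
    apply: rmean_normc_le => //.
    apply: (@le_trans _ _ (m2 (shiftn K F) s)); last first.
      by apply: le_trans (m2_shiftn_le K bF s01) _; rewrite lerBlDr addrC -lerBlDr.
    have cs := ccts_bholo (bholo_shiftn K bF) s01'.
    apply: le_rmean => [||t]; [exact: rcts_sq|exact: rcts_sq|].
    rewrite lerXn2r ?nnegrE ?normc_ge0// /h normcM normcX normc_circ ?(ltW s0)//.
    by rewrite ler_piMl ?normc_ge0// exprn_ile1// ltW.
  have /choice[K KP] := hm.
  have /choice[E EP] : forall n, exists E : set R, [/\ measurable E,
      (mu E <= (18 * pi * n.+1%:R^-1 / c)%:E)%E &
      forall t, 0 <= t < 2 * pi -> forall r, 0 <= r < 1 ->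
        c < normc (h (K n) (circ r t)) -> E t].
    move=> n; have [E mE [E1 E2]] := weak_type (bh (K n)) c0 (KP n).
    by exists E.
  exists (\bigcap_n E n); split.
  - by apply: bigcap_measurable => // n _; have [] := EP n.
  - apply/eqP; rewrite eq_le measure_ge0 andbT.
    apply/lee_addgt0Pr => e e0; rewrite add0e.
    have M0 : 0 < 18 * pi / c :> R by rewrite divr_gt0// mulr_gt0// pi_gt0.
    have eM : 0 < e / (18 * pi / c) by rewrite divr_gt0.
    have [N hN] := rad_near eM; have := hN N (leqnn _).
    rewrite /rad ltrD2l ltrN2 => hNe.
    (* [rad_near] controls the inverse of [N.+2], which is the one attached to index [N.+1]. *)
    have [mE E1 E2] := EP N.+1.
    apply: (@le_trans _ _ (mu (E N.+1))).
      apply: le_measure; rewrite ?inE//; last exact: bigcap_inf.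
      by apply: bigcap_measurable => // n _; have [] := EP n.
    apply: le_trans E1 _; rewrite lee_fin mulrAC mulrC.
    by rewrite -ler_pdivlMr// ltW.
  - move=> t /= /not_implyP[t01 noK] n _; have [_ _ E2] := EP n.
    apply: contrapT => nE; apply: noK; exists (K n) => r r01.
    by rewrite leNgt; apply/negP => /(E2 t t01 r r01).
have := ae_foralln main; apply: ae_mono => t ht t01 c c0.
have [N hN] := rad_near c0; have := hN N (leqnn _); rewrite /rad ltrD2l ltrN2 => Nc.
have [K hK] := ht N.+1 t01; exists K => r r01.
by apply: le_trans (hK r r01) _; exact: ltW.
Qed.

End Fatou.

(** * Self-maps of unit mean are inner *)

Section InnerFromMeans.
Variable R : realType.
Implicit Types (h F : R[i] -> R[i]) (r s t x c : R).
Local Notation mu := (@lebesgue_measure R).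

Lemma real_cauchy (x : nat -> R) :
  (forall e : R, 0 < e -> exists N, forall n, (N <= n)%N -> `|x N - x n| <= e) ->
  exists l, forall e : R, 0 < e -> exists N, forall n, (N <= n)%N -> `|l - x n| <= e.
Proof.
move=> xc; have : cvg (x @ \oo).
  apply: cauchy_cvg; apply: cauchy_exP => e e0.
  have e2 : 0 < e / 2 by rewrite divr_gt0.
  have [N hN] := xc _ e2; exists (x N); exists N => // n /= /hN h.
  by rewrite -ball_normE /=; lra.
move=> /cvg_ex[l /cvgrPdist_le xl]; exists l => e e0.
by have [N _ hN] := xl e e0; exists N => n Nn; exact: hN.
Qed.

(** On the radius, F is a polynomial continuous up to the endpoint plus a uniformly small tail, so
    it satisfies Cauchy's criterion. *)
Lemma radial_limit_exists F t : bholo 1 F ->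
  (forall c, 0 < c -> exists K, forall r, 0 <= r < 1 ->
      normc (circ r t ^+ K * shiftn K F (circ r t)) <= c) ->
  exists l, radial_limit F t l.
Proof.
move=> bF FK.
have osc e : 0 < e -> exists2 d : R, 0 < d <= 1 & forall r r', 1 - d < r < 1 -> 1 - d < r' < 1 ->
    normc (F (circ r t) - F (circ r' t)) <= e.
  move=> e0; have e4 : 0 < e / 4 by rewrite divr_gt0.
  have [K hK] := FK _ e4.
  pose S r := \sum_(k < K) coef F k * circ r t ^+ k.
  have cS : cts S 1.
    apply: cts_sum => k; apply: ctsM; first exact: cts_cst.
    apply: ctsX; apply: ctsM; last exact: cts_cst.
    by apply: cts_real; exact: cvg_id.
  have /nbhs_ballP[d /= d0 hd] := cS _ e4.
  (* Capped by 1 so that the radii considered stay nonnegative, as [hK] requires. *)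
  exists (Num.min d 1); first by rewrite lt_min d0 ltr01 ge_min lexx orbT.
  move=> r r' /andP[r1 r2] /andP[r1' r2'].
  have m1 : Num.min d 1 <= 1 by rewrite ge_min lexx orbT.
  have md : Num.min d 1 <= d by rewrite ge_min lexx.
  have Hr u : 1 - Num.min d 1 < u -> u < 1 -> normc (S u - S 1) <= e / 4.
    move=> u1 u2; apply: hd; rewrite -ball_normE /= gtr0_norm ?subr_gt0//; lra.
  have R1 : 0 <= r < 1 by rewrite r2 andbT; lra.
  have R1' : 0 <= r' < 1 by rewrite r2' andbT; lra.
  rewrite (taylor F K (circ r t)) (taylor F K (circ r' t)).
  rewrite -/(S r) -/(S r').
  have h1 := hK r R1; have h2 := hK r' R1'; have h3 := Hr r r1 r2; have h4 := Hr r' r1' r2'.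
  set A := circ r t ^+ K * shiftn K F (circ r t) in h1 *.
  set A' := circ r' t ^+ K * shiftn K F (circ r' t) in h2 *.
  move: h1 h2 h3 h4; move: A A' (S r) (S r') (S 1).
  clear -e0 => a a' u v w h1 h2 h3 h4.
  rewrite (_ : _ - _ = ((u - w) + a) - ((v - w) + a')); last by ring.
  apply: le_trans (normc_leD _ _) _; rewrite normc_N.
  have h5 := normc_leD (u - w) a; have h6 := normc_leD (v - w) a'.
  lra.
(* The limit is found coordinatewise along [rad]; [osc] then extends it to all radii near 1. *)
pose x n := F (circ (rad R n) t).
have xc e : 0 < e -> exists N, forall n, (N <= n)%N -> normc (x N - x n) <= e.
  move=> /osc[d /andP[d0 d1] hd]; have [N hN] := rad_near d0; exists N => n Nn.
  have /andP[_ r1] := rad_itv R N; have /andP[_ r2] := rad_itv R n.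
  by apply: hd; rewrite hN//.
have [a ha] : exists a, forall e : R, 0 < e -> exists N, forall n, (N <= n)%N ->
    `|a - complex.Re (x n)| <= e.
  apply: real_cauchy => e /xc[N hN]; exists N => n /hN; apply: le_trans.
  by rewrite -raddfB; exact: normc_Re.
have [b hb] : exists b, forall e : R, 0 < e -> exists N, forall n, (N <= n)%N ->
    `|b - complex.Im (x n)| <= e.
  apply: real_cauchy => e /xc[N hN]; exists N => n /hN; apply: le_trans.
  by rewrite -raddfB; exact: normc_Im.
exists (a +i* b); apply/radial_limitP => e e0.
have e2 : 0 < e / 2 by rewrite divr_gt0.
have e4 : 0 < e / 4 by rewrite divr_gt0.
have [d /andP[d0 d1] hd] := osc _ e2.
exists d => // r rd.
have [N1 h1] := ha _ e4; have [N2 h2] := hb _ e4; have [N3 h3] := rad_near d0.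
pose n := maxn N1 (maxn N2 N3).
have g1 := h1 n (leq_maxl _ _).
have g2 : `|b - complex.Im (x n)| <= e / 4.
  by apply: h2; rewrite /n leq_max; apply/orP; right; exact: leq_maxl.
have g3 : 1 - d < rad R n < 1.
  have /andP[_ ->] := rad_itv R n; rewrite andbT; apply: h3.
  by rewrite /n leq_max; apply/orP; right; exact: leq_maxr.
have g4 := hd _ _ g3 rd.
rewrite -(subrK (x n) (a +i* b)) -addrA.
apply: le_trans (normc_leD _ _) _.
have g5 := normc_le_ReIm ((a +i* b) - x n).
rewrite !raddfB /= in g5.
have {}g4 : normc (x n - F (circ r t)) <= e / 2 by [].
lra.
Qed.

Lemma ae_mono2 (P Q S : R -> Prop) : (forall x, P x -> Q x -> S x) ->
  {ae mu, forall x, P x} -> {ae mu, forall x, Q x} -> {ae mu, forall x, S x}.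
Proof.
move=> PQS hP hQ; apply: negligibleS (negligibleU hP hQ) => x /= nS.
have [Px|nP] := pselect (P x); last by left.
by right => Qx; apply: nS; exact: PQS.
Qed.

Lemma unit_mean_inner F : self_map F -> unit_mean F -> inner F.
Proof.
move=> sF uF; have [bF mF] := sF; split.
- by move=> z /discE zd; have [] := bF.1 z zd.
- by move=> z /discE zd; apply/discE; exact: mF.
pose h n t : R := 1 - normc (F (circ (rad R n) t)) ^+ 2.
have cF n : ccts (fun t => F (circ (rad R n) t)).
  by apply: ccts_bholo bF _; have /andP[/ltW -> ->] := rad_itv R n.
have ch n : rcts (h n) by apply: rctsB; [exact: rcts_cst|exact: rcts_sq].
have nf n t : 0 <= normc (F (circ (rad R n) t)) <= 1.
  rewrite normc_ge0 /=; apply: bF.2; have /andP[r0 r1] := rad_itv R n.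
  by rewrite normc_circ// ltW.
have h01 n t : 0 <= h n t <= 1.
  by have /andP[n0 n1] := nf n t; rewrite /h; apply/andP; split; nra.
have lims : {ae mu, forall t, 0 <= t < 2 * pi -> exists l, radial_limit F t l}.
  by apply: ae_mono (fatou_cauchy bF uF) => t ht t01; apply: radial_limit_exists => //; exact: ht.
(* An upper limit is measurable and defined at every [t], also where the radial limit fails. The
   absolute value lets the integral of [G] be read as that of its modulus. *)
pose G t : \bar R := (`|limn_esup (fun n => (h n t)%:E)|)%E.
have Glim t l : radial_limit F t l -> (h n t)%:E @[n --> \oo] --> (1 - normc l ^+ 2)%:E.
  move=> /radial_limitP ll; apply: cvg_EFin; first exact: nearW.
  apply/cvgrPdist_le => e e0; have e2 : 0 < e / (2 * (normc l + 1)).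
    by rewrite divr_gt0// mulr_gt0// ltr_wpDl ?normc_ge0.
  have [d d0 hd] := ll _ e2.
  have [N hN] := rad_near d0; exists N => // n /= /hN rn.
  have /andP[r0 r1] := rad_itv R n.
  have := hd (rad R n); rewrite rn r1 => /(_ isT) h1.
  have /andP[n0 n1] := nf n t.
  have := normc_lip l (F (circ (rad R n) t)).
  move: n0 n1 h1; rewrite /h; set y := normc (F _); set z := normc (l - _); have l0 := normc_ge0 l.
  move=> y0 y1 ze lip.
  rewrite (_ : _ - _ = - ((normc l - y) * (normc l + y))); last by ring.
  rewrite normrN normrM (ger0_norm (addr_ge0 l0 y0)).
  have k0 : 0 < 2 * (normc l + 1) by rewrite mulr_gt0// ltr_wpDl.
  have : `|normc l - y| * (normc l + y) <= e / (2 * (normc l + 1)) * (2 * (normc l + 1)).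
    by apply: ler_pM => //; [exact: addr_ge0|exact: le_trans ze|lra].
  by rewrite divfK// gt_eqF.
have Glim1 t l : radial_limit F t l -> normc l <= 1.
  move=> /radial_limitP ll; apply/ler_addgt0Pl => e e0.
  have [d d0 hd] := ll _ e0.
  have [N hN] := rad_near d0; have rn := hN N (leqnn _).
  have /andP[r0 r1] := rad_itv R N.
  have := hd (rad R N); rewrite rn r1 => /(_ isT) h1.
  have /andP[n0 n1] := nf N t.
  have := normc_leD (l - F (circ (rad R N) t)) (F (circ (rad R N) t)).
  by rewrite subrK; lra.
have GE t l : radial_limit F t l -> G t = (1 - normc l ^+ 2)%:E.
  move=> rl; rewrite /G (cvg_limn_einf_sup (Glim t l rl)).2 gee0_abs// lee_fin.
  have := Glim1 t l rl; have := normc_ge0 l; nra.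
have mG : measurable_fun `[0, (2 * pi : R)[ G.
  apply: measurableT_comp; first exact: abse_measurable.
  apply: measurable_fun_limn_esup => n.
  by apply: rcts_measurable.
have := @dominated_convergence _ _ R mu `[0, (2 * pi : R)[ (measurable_itv _)
  (fun n => EFin \o h n) G (cst 1%E).
case.
- by move=> n; exact: rcts_measurable.
- exact: mG.
- apply: ae_mono lims => t ht; rewrite /= in_itv /= => /ht[l rl].
  by rewrite (GE t l rl); exact: Glim.
- apply: (@integrableS _ _ _ mu `[0, 2 * pi]) => //.
    by apply: subset_itvl; rewrite bnd_simp.
  exact: (@rcts_integrable R 0 (2 * pi) (fun=> 1) (@rcts_on_cst R _ _ 1)).
- apply: aeW => t n _ /=; rewrite lee_fin.
  by have /andP[h0 h1] := h01 n t; rewrite ger0_norm.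
move=> _ _ Gcvg.
(* The integrals of [h n] tend to that of [G] by dominated convergence and to 0 by unit mean. Hence
   1 - |l|^2 vanishes for almost every radial limit l. *)
have Gz : (\int[mu]_(x in `[0%R, (2 * pi)%R[) G x = 0)%E.
  apply: (cvg_unique _ Gcvg) => //.
  rewrite (_ : [sequence _]_n = fun n => (rint 0 (2 * pi) (h n))%:E); last first.
    by apply/funext => n; rewrite /= -rint_itvco.
  apply: cvg_EFin; first exact: nearW.
  apply/cvgrPdist_le => e e0; have p0 := twopi_gt0 R.
  have [N hN] := uF _ (divr_gt0 e0 p0); exists N => // n /= /hN.
  have rh : rmean (h n) = 1 - m2 F (rad R n).
    rewrite /h rmeanB ?rmean_cst//; first exact: rcts_cst.
    exact: rcts_sq.
  have h0 : 0 <= rint 0 (2 * pi) (h n).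
    by apply: Rintegral_ge0 => x _; have /andP[] := h01 n x.
  rewrite sub0r normrN ger0_norm//= => m2n.
  have : rmean (h n) <= e / (2 * pi) by rewrite rh lerBlDr addrC -lerBlDr.
  by rewrite /rmean mulrC ler_pM2r// invr_gt0.
have /(ae_eq_integral_abs mu (measurable_itv `[0, 2 * pi[) mG) Gae :
    (\int[mu]_(x in `[0%R, (2 * pi)%R[) `|G x| = 0)%E.
  by rewrite -[RHS]Gz; apply: eq_integral => t _; rewrite abse_id.
apply: ae_mono2 lims Gae => t ht Gt; rewrite in_itv /= => t01.
have [l rl] := ht t01; exists l; split=> //.
have : G t = 0%E by apply: Gt; rewrite /= in_itv.
rewrite (GE t l rl) => E; have l1 : 1 - normc l ^+ 2 = 0 by case: E.
rewrite normCE.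
have n0 := normc_ge0 l.
have nl : normc l = 1.
  have /eqP : (normc l - 1) * (normc l + 1) = 0 by move: l1; rewrite expr2; lra.
  by rewrite mulf_eq0 => /orP[/eqP|/eqP]; lra.
by rewrite nl.
Qed.

End InnerFromMeans.

(** * Iterated compositions *)

Section Iterates.
Variable R : realType.
Implicit Types (f : nat -> R[i] -> R[i]) (g phi : R[i] -> R[i]) (r s : R) (z w : R[i]).

Definition fixing_maps f := forall n, (1 <= n)%N -> self_map (f n) /\ f n 0 = 0.

Lemma self_map_comp g phi : self_map g -> self_map phi -> self_map (fun z => g (phi z)).
Proof.
move=> [bg gD] sp; split; first exact: bholo_comp.
by move=> z z1; apply: gD; exact: sp.2.
Qed.

Lemma iter_comp0 f n : fixing_maps f -> iter_comp f n 0 = 0.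
Proof. by move=> hf; elim: n => //= n ->; exact: (hf n.+1 isT).2. Qed.

Lemma iter_comp_self_map f n : fixing_maps f -> self_map (iter_comp f n).
Proof.
move=> hf; elim: n => [|n IH]; first exact: self_map_id.
exact: self_map_comp (hf n.+1 isT).1 IH.
Qed.

Lemma iter_comp_unit_mean f n : fixing_maps f ->
  (forall n, (1 <= n)%N -> unit_mean (f n)) -> unit_mean (iter_comp f n).
Proof.
move=> hf uf; elim: n => [|n IH]; first exact: unit_mean_id.
have [[bf _] _] := hf n.+1 isT.
exact: (unit_mean_comp bf (uf n.+1 isT) (iter_comp_self_map n hf) (iter_comp0 n hf) IH).
Qed.

Lemma iter_compD f m n z :
  iter_comp f (m + n) z = iter_comp (fun k => f (m + k)%N) n (iter_comp f m z).
Proof. by elim: n => [|n IH]; rewrite ?addn0// addnS /= IH addnS. Qed.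

Lemma fixing_maps_shift f m : fixing_maps f -> fixing_maps (fun k => f (m + k)%N).
Proof. by move=> hf n n0; apply: hf; rewrite (leq_trans n0)// leq_addl. Qed.

Definition defect g : R := 1 - normc (cderiv g 0).

Lemma defect_ge0 g : self_map g -> g 0 = 0 -> 0 <= defect g.
Proof.
move=> sg g0; rewrite subr_ge0 -slope_diag; apply: (schwarz sg.1 g0).2.
by rewrite normc0.
Qed.

(** By the chain rule the moduli of the derivatives at 0 multiply, and (1 - a)(1 - b) >= 0 makes the
    defect subadditive. *)
Lemma defect_comp g phi : self_map g -> g 0 = 0 -> self_map phi -> phi 0 = 0 ->
  defect (fun z => g (phi z)) <= defect g + defect phi.
Proof.
move=> sg g0 sp p0; have n0 : normc (0 : R[i]) < 1 by rewrite normc0.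
have hg : holo g (phi 0) by rewrite p0; exact: sg.1.1.
have [_ E] := holo_compP (sp.1.1 _ n0) hg.
have aux (a b : R) : 0 <= 1 - a -> 0 <= 1 - b -> 1 - a * b <= (1 - a) + (1 - b).
  by move=> a1 b1; have := mulr_ge0 a1 b1; rewrite mulrBl mul1r mulrBr mulr1; lra.
by rewrite {1}/defect E p0 normcM; exact: aux (defect_ge0 sg g0) (defect_ge0 sp p0).
Qed.

Lemma defect_id : defect (fun z => z) = 0.
Proof.
have [_ E] := @holo_caratheodory R (fun z => z) 0 (fun=> 1) (@cts_cst _ _ _ _)
  (fun w => esym (mul1r _)).
by rewrite /defect E normc1 subrr.
Qed.

Definition defect_sum f n : R := \sum_(k < n) defect (f k.+1).

Lemma defect_sumS f n : defect_sum f n.+1 = defect_sum f n + defect (f n.+1).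
Proof. by rewrite /defect_sum big_ord_recr. Qed.

Lemma defect_iter f n : fixing_maps f -> defect (iter_comp f n) <= defect_sum f n.
Proof.
move=> hf; elim: n => [|n IH]; first by rewrite defect_id /defect_sum big_ord0.
have [sf f0] := hf n.+1 isT.
apply: le_trans (defect_comp sf f0 (iter_comp_self_map n hf) (iter_comp0 n hf)) _.
by rewrite addrC defect_sumS lerD2r.
Qed.

Lemma defect_sumD f m n :
  defect_sum f (m + n) = defect_sum f m + defect_sum (fun k => f (m + k)%N) n.
Proof.
elim: n => [|n IH]; first by rewrite addn0 [X in _ = _ + X]/defect_sum big_ord0 addr0.
by rewrite addnS !defect_sumS IH addnS -[LHS]addrA.
Qed.

Lemma defect_sum_ge0 f n : fixing_maps f -> 0 <= defect_sum f n.
Proof. by move=> hf; apply: sumr_ge0 => k _; have [] := hf k.+1 isT; exact: defect_ge0. Qed.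

(* Harnack's inequality for [1 - |f(z)/z|]. *)
Lemma defect_contract g w (x : R) : self_map g -> g 0 = 0 -> normc w <= x < 1 ->
  normc (g w) <= normc w * (1 - (1 - x) / 2 * defect g).
Proof.
move=> sg g0 /andP[wx x1]; have w1 := le_lt_trans wx x1.
have := slopeE g 0 w; rewrite g0 !subr0 => ->; rewrite normcM mulrC.
have w0 := normc_ge0 w; apply: ler_wpM2l => //.
have := harnack (schwarz sg.1 g0) w1; rewrite slope_diag.
have := defect_ge0 sg g0; have := (schwarz sg.1 g0).2 _ w1; rewrite /defect.
have aux (a d y : R) : 0 <= y <= x -> 0 <= d -> a <= 1 -> (1 - y) * d <= (1 + y) * (1 - a) ->
    a <= 1 - (1 - x) / 2 * d.
  by clear -x1 => /andP[y0 yx] d0 a1 h; nra.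
by move=> h1 h2 h3; apply: (aux _ _ (normc w)) => //; rewrite w0.
Qed.

(** Replaces an infinite product of factors 1 - c d: the bound u (1 + c S) <= 1 passes to the next
    step because (1 - c d)(1 + c S + c d) <= 1 + c S. *)
Lemma decay_step (x c u v S d : R) : 0 <= u <= x -> 0 <= c -> 0 <= S -> 0 <= d ->
  u * (1 + c * S) <= 1 -> v <= u * (1 - c * d) -> v <= x /\ v * (1 + c * (S + d)) <= 1.
Proof.
move=> /andP[u0 ux] c0 S0 d0 uS h.
have cd0 : 0 <= c * d by exact: mulr_ge0.
have cS0 : 0 <= c * S by exact: mulr_ge0.
have ucd : 0 <= u * (c * d) by exact: mulr_ge0.
split; first by rewrite mulrBr in h; lra.
have h2 : v * (1 + c * (S + d)) <= u * (1 - c * d) * (1 + c * (S + d)).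
  by apply: ler_wpM2r => //; rewrite mulrDr; lra.
apply: le_trans h2 _.
have := mulr_ge0 u0 (mulr_ge0 cd0 (addr_ge0 cS0 cd0)).
rewrite (_ : u * (1 - c * d) * _ = u * (1 + c * S) - u * (c * d * (c * S + c * d))).
  by lra.
by ring.
Qed.

Lemma iter_comp_decay f n z : fixing_maps f -> normc z < 1 ->
  normc (iter_comp f n z) <= normc z /\
  normc (iter_comp f n z) * (1 + (1 - normc z) / 2 * defect_sum f n) <= 1.
Proof.
move=> hf z1; have z0 := normc_ge0 z.
elim: n => [|n [IH1 IH2]].
  by rewrite /defect_sum big_ord0 mulr0 addr0 mulr1; split=> //=; exact: ltW.
have [sf f0] := hf n.+1 isT.
(* The iterates never leave the disc of radius |z|, so the contraction rate belonging to |z| serves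
   for every n. *)
have := @defect_contract (f n.+1) (iter_comp f n z) (normc z) sf f0.
rewrite IH1 z1 => /(_ isT) h; rewrite defect_sumS.
apply: decay_step IH2 h.
- by rewrite normc_ge0.
- by rewrite divr_ge0// subr_ge0 ltW.
- exact: defect_sum_ge0.
- exact: defect_ge0.
Qed.

End Iterates.

(** * Locally uniform limits of bounded holomorphic functions *)

Section LimitFunction.
Variable R : realType.
Implicit Types (f G : nat -> R[i] -> R[i]) (F g phi : R[i] -> R[i]) (r s t : R) (z w : R[i]).

(** Locally uniform convergence on discs with real radii, free of the uniform structure on
    functions. *)
Definition near_cvg G F := forall z, normc z < 1 -> exists2 d : R, 0 < d &
  forall e : R, 0 < e -> exists N, forall n, (N <= n)%N ->
    forall w, normc (w - z) < d -> normc w < 1 -> normc (F w - G n w) <= e.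

Lemma locally_uniformly_near_cvg G F : cvg_locally_uniformly_disc G F -> near_cvg G F.
Proof.
move=> GF z /discE /GF[U /nbhsCP[d d0 dU] uni]; exists d => // e e0.
have [N _ hN] : \forall n \near \oo, forall w, (U `&` @disc R) w -> normc (F w - G n w) <= e.
  apply: (uni [set h | forall w, (U `&` @disc R) w -> normc (F w - h w) <= e]).
  apply/uniform_nbhs; exists [set p | normc (p.1 - p.2) <= e]; split; last by [].
  rewrite -entourage_ballE; exists (e%:C); first by rewrite /= ltcR.
  by move=> [x y]; rewrite /= -ball_normE /= normCE ltcR => /ltW.
exists N => n Nn w wd w1; apply: hN => //; split; first exact: dU.
exact/discE.
Qed.

Lemma near_cvg_pt G F z : near_cvg G F -> normc z < 1 ->
  forall e : R, 0 < e -> exists N, forall n, (N <= n)%N -> normc (F z - G n z) <= e.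
Proof.
move=> GF z1 e e0; have [d d0 /(_ _ e0)[N hN]] := GF z z1.
by exists N => n Nn; apply: hN => //; rewrite subrr normc0.
Qed.

Lemma near_cvg_cts G F z : near_cvg G F -> (forall n, holo_disc (G n)) ->
  normc z < 1 -> cts F z.
Proof.
move=> GF hG z1 e e0; have [d d0 hd] := GF z z1.
have e3 : 0 < e / 3 by rewrite divr_gt0.
have [N /(_ N (leqnn _)) hN] := hd _ e3.
have := holo_cts (hG N z z1) e3; move=> /nbhsCP[d' d'0 hd'].
apply/nbhsCP; exists (Num.min d (Num.min d' (1 - normc z))).
  by rewrite !lt_min d0 d'0 subr_gt0.
move=> w; rewrite !lt_min => /and3P[wd wd' w1].
have {}w1 : normc w < 1 by have := normc_leD (w - z) z; rewrite subrK; lra.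
have h1 := hN w wd w1; have h2 := hd' w wd'.
have h3 : normc (F z - G N z) <= e / 3 by apply: hN => //; rewrite subrr normc0.
rewrite (_ : _ - _ = (F w - G N w) + (G N w - G N z) + (G N z - F z)); last by ring.
have := normc_leD (F w - G N w + (G N w - G N z)) (G N z - F z).
have := normc_leD (F w - G N w) (G N w - G N z).
rewrite (normc_sub (G N z)); lra.
Qed.

Lemma near_cvg_circ G F r : near_cvg G F -> 0 <= r < 1 ->
  forall e : R, 0 < e -> exists N, forall n, (N <= n)%N ->
    forall t, 0 <= t <= 2 * pi -> normc (F (circ r t) - G n (circ r t)) <= e.
Proof.
move=> GF /andP[r0 r1] e e0.
have : compact `[0, (2 * pi : R)] by exact: segment_compact.
move/compact_near_coveringP => K.
have [N _ hN] : \forall n \near \oo, forall t, `[0, (2 * pi : R)]%classic t ->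
    normc (F (circ r t) - G n (circ r t)) <= e.
  apply: (K _ \oo (fun n t => normc (F (circ r t) - G n (circ r t)) <= e)).
  move=> t0 _.
  have c1 t : normc (circ r t) < 1 by rewrite normc_circ.
  have [d d0 /(_ _ e0)[N hN]] := GF (circ r t0) (c1 t0).
  have d2 : 0 < d / 2 by rewrite divr_gt0.
  have E : \forall t' \near t0, normc (circ r t' - circ r t0) <= d / 2 by exact: ccts_circ.
  near=> t n => /=; apply: hN => //.
    by near: n; exists N.
  apply: (@le_lt_trans _ _ (d / 2)); last by lra.
  by near: t; exact: E.
by exists N => n /hN h t tI; apply: h; rewrite /= in_itv.
Unshelve. all: end_near. Qed.

(** Weierstrass's theorem: Cauchy's formula passes to the limit on a circle, so F is a Cauchy
    integral of its own continuous boundary data and [cauchy_int_deriv] applies. *)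
Lemma near_cvg_holo G F (B : R) : near_cvg G F -> (forall n, bholo B (G n)) -> holo_disc F.
Proof.
move=> GF bG z z1; have z0 := normc_ge0 z.
pose s := (1 + normc z) / 2; have s01 : 0 < s < 1 by rewrite /s; lra.
have [s0 s1] := andP s01; have zs : normc z < s by rewrite /s; lra.
have hG n : holo_disc (G n) := (bG n).1.
have cF : ccts (fun t => F (circ s t)).
  by apply: ccts_comp => [|w ws]; [exact: ltW|apply: near_cvg_cts GF hG _; rewrite ws].
have FB t : normc (F (circ s t)) <= B.
  have c1 : normc (circ s t) < 1 by rewrite normc_circ// ltW.
  apply/ler_addgt0Pl => e e0; have [N /(_ N (leqnn _)) hN] := near_cvg_pt GF c1 e0.
  have := normc_leD (F (circ s t) - G N (circ s t)) (G N (circ s t)).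
  by rewrite subrK; have := (bG N).2 _ c1; lra.
have FE w : normc w < s -> cauchy_int (fun t => F (circ s t)) s w = F w.
  move=> ws; apply/eqP; rewrite -subr_eq0; apply/eqP; apply: normc_eps_eq0 => e e0.
  have w1 := lt_trans ws s1; have sw : 0 < s - normc w by rewrite subr_gt0.
  have e2 : 0 < e / 2 by rewrite divr_gt0.
  have s01' : 0 <= s < 1 by rewrite ltW.
  have [N1 hN1] := near_cvg_pt GF w1 e2.
  (* Compensates the Cauchy kernel, which is at most 1 / (s - |w|) on the circle. *)
  have e3 : 0 < e / 2 * (s - normc w) by rewrite mulr_gt0.
  have [N2 hN2] := near_cvg_circ GF s01' e3.
  pose n := maxn N1 N2.
  have h1 := hN1 n (leq_maxl _ _); have h2 := hN2 n (leq_maxr _ _).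
  have cG : ccts (fun t => G n (circ s t)) by exact: ccts_disc.
  have ck := cctsM (@ccts_circ R s) (ccts_cauchy_kernel ws).
  rewrite (_ : _ - _ = (cauchy_int (fun t => F (circ s t)) s w -
    cauchy_int (fun t => G n (circ s t)) s w) - (F w - G n w)); last first.
    by rewrite -(cauchy_formula (hG n) s01 ws); ring.
  apply: le_trans (normc_leD _ _) _; rewrite normc_N (splitr e); apply: lerD => //.
  rewrite /cauchy_int -cmeanB; first last.
  - exact: cctsM.
  - exact: cctsM.
  apply: normc_cmean_le_on; first by apply: cctsB; exact: cctsM.
  move=> t tI; rewrite -mulrBl normcM.
  have h3 := circ_sub_gt0 t ws.
  have h4 : normc (circ s t * (circ s t - w)^-1) <= (s - normc w)^-1.
    rewrite normcM normcV normc_circ ?(ltW s0)// ler_pdivrMr; last by lra.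
    rewrite mulrC ler_pdivlMr//; have := normc_ge0 (circ s t - w); nra.
  apply: (@le_trans _ _ (e / 2 * (s - normc w) * (s - normc w)^-1)).
    by apply: ler_pM; rewrite ?normc_ge0//; exact: h2.
  by rewrite mulfK// gt_eqF.
apply: (@holo_near_eq R (cauchy_int (fun t => F (circ s t)) s) F z (s - normc z)).
- by rewrite subr_gt0.
- move=> w wz; apply: FE; have := normc_leD (w - z) z; rewrite subrK; lra.
- exact: (cauchy_int_deriv cF FB s0 zs).1.
Qed.

End LimitFunction.

(** * Bounded and unbounded defect sums *)

Section Dichotomy.
Variable R : realType.
Implicit Types (f : nat -> R[i] -> R[i]) (F g phi : R[i] -> R[i]) (r : R) (z w : R[i]).

Lemma limit_self_map f F : fixing_maps f -> near_cvg (iter_comp f) F ->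
  (forall z, normc z < 1 -> normc (F z) < 1) -> self_map F.
Proof.
move=> hf fF mF; split=> //; split=> [|z /mF/ltW//].
by apply: near_cvg_holo fF _ => n; exact: (iter_comp_self_map n hf).1.
Qed.

Lemma limit_eq0 f F z : fixing_maps f -> near_cvg (iter_comp f) F ->
  (forall M : R, exists n, M < defect_sum f n) -> normc z < 1 -> F z = 0.
Proof.
move=> hf fF Soo z1; apply: normc_eps_eq0 => e e0.
pose c := (1 - normc z) / 2; have c0 : 0 < c by rewrite divr_gt0// subr_gt0.
have e2 : 0 < e / 2 by rewrite divr_gt0.
(* From this size of the defect sum on, [iter_comp_decay] gives |F_n(z)| <= e / 2. *)
have [n0 hn0] := Soo ((e / 2 * c)^-1).
have [N hN] := near_cvg_pt fF z1 e2.
pose n := (n0 + N)%N; have := hN n (leq_addl _ _).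
have Sn : (e / 2 * c)^-1 <= defect_sum f n.
  rewrite /n defect_sumD (le_trans (ltW hn0))// lerDl.
  by apply: defect_sum_ge0; exact: fixing_maps_shift.
have [_] := iter_comp_decay n hf z1; rewrite -/c => h1 h2.
have F0 := normc_ge0 (iter_comp f n z).
have {h1} : normc (iter_comp f n z) * (c * (e / 2 * c)^-1) <= 1.
  apply: le_trans h1; apply: ler_wpM2l => //.
  by apply: (@le_trans _ _ (c * defect_sum f n)); rewrite ?lerDr// ler_wpM2l// ltW.
have -> : c * (e / 2 * c)^-1 = (e / 2)^-1.
  by clearbody c; field; rewrite !gt_eqF.
rewrite ler_pdivrMr// mul1r => h1.
have := normc_leD (F z - iter_comp f n z) (iter_comp f n z); rewrite subrK; lra.
Qed.

(* If [k = g(w)/w] has mean [g'(0)] on the circle, then [1 - |k|^2 <= 2(1 - Re(c k))]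
   for any unimodular [c]; choose [c] with [c g'(0) = |g'(0)|]. *)
Lemma m2_comp_ge g phi r : self_map g -> g 0 = 0 -> self_map phi -> phi 0 = 0 ->
  0 < r < 1 -> m2 phi r - 2 * defect g <= m2 (fun z => g (phi z)) r.
Proof.
move=> sg g0 sp p0 r01; have r01' : 0 <= r < 1 by case/andP: r01 => /ltW -> ->.
have b1 := schwarz sg.1 g0; have bc := bholo_comp b1 sp.
have n0 : normc (0 : R[i]) < 1 by rewrite normc0.
have [c c1 cE] := unimodular (slope g 0 0).
pose k t := slope g 0 (phi (circ r t)).
have ck : ccts k := ccts_bholo bc r01'.
have cck : ccts (fun t => c * k t) by apply: cctsM => //; exact: ccts_cst.
have rRe : rcts (fun t => complex.Re (c * k t)) by move=> t; apply: cts_Re; exact: cck.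
have E : defect g = rmean (fun t => 1 - complex.Re (c * k t)).
  rewrite (rmeanB (@rcts_cst _ 1) rRe) rmean_cst -cmean_Re// cmeanZ// (bholo_mean bc r01).
  by rewrite p0 cE /= /defect slope_diag.
have rB := rctsB (@rcts_cst _ 1) rRe.
have sq1 : rcts (fun t => normc (phi (circ r t)) ^+ 2) by apply: rcts_sq; exact: ccts_bholo sp.1 _.
rewrite E -(rmeanZ _ rB) -(rmeanB sq1); last by apply: rctsM => //; exact: rcts_cst.
apply: le_rmean => [||t].
- by apply: rctsB => //; apply: rctsM => //; exact: rcts_cst.
- exact: (@rcts_sq R (fun z => g (phi z)) r (ccts_bholo (bholo_comp sg.1 sp) r01')).
have ct : normc (circ r t) < 1 by rewrite normc_circ; case/andP: r01'.
have := slopeE g 0 (phi (circ r t)); rewrite g0 !subr0 -/(k t) => ->.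
have x1 := sp.1.2 _ ct; have x0 := normc_ge0 (phi (circ r t)).
have k1 : normc (k t) <= 1 := bc.2 _ ct; have k0 := normc_ge0 (k t).
have Rk : complex.Re (c * k t) <= normc (k t).
  by apply: le_trans (ler_norm _) _; apply: le_trans (normc_Re _) _; rewrite normcM c1 mul1r.
rewrite normcM; move: Rk k1 k0 x1 x0.
move: (normc (k t)) (normc (phi (circ r t))) (complex.Re _) => a x b.
clear => ba a1 a0 x1 x0.
have x2 : x ^+ 2 <= 1 by rewrite -(expr1n _ 2) lerXn2r ?nnegrE.
have a2 : a ^+ 2 <= 1 by rewrite -(expr1n _ 2) lerXn2r ?nnegrE.
have h : 0 <= (1 - x ^+ 2) * (1 - a ^+ 2) by rewrite mulr_ge0// subr_ge0.
have h' : 0 <= (1 - a) ^+ 2 by exact: sqr_ge0.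
rewrite exprMn; move: h h'; rewrite sqrrB mulrBl mulrBr; lra.
Qed.

(** Both moduli are at most 1, so their squares differ by at most twice the distance. *)
Lemma m2_near F g r (e : R) : bholo 1 F -> bholo 1 g -> 0 <= r < 1 ->
  (forall t, 0 <= t <= 2 * pi -> normc (F (circ r t) - g (circ r t)) <= e) ->
  m2 g r - 2 * e <= m2 F r.
Proof.
move=> bF bg r01 Fg; have cF := ccts_bholo bF r01; have cg := ccts_bholo bg r01.
have k0 := @twopi_gt0 R.
have ro := rctsB (rcts_sq cg) (@rcts_cst R (2 * e)).
rewrite -[2 * e]rmean_cst -(rmeanB (rcts_sq cg) (@rcts_cst _ _)).
rewrite /m2 /rmean ler_wpM2l ?invr_ge0 ?(ltW k0)//.
apply: le_rint => [||t tI]; [exact: rcts_on_all|by apply: rcts_on_all; exact: rcts_sq|].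
have ct : normc (circ r t) < 1 by rewrite normc_circ; case/andP: r01.
have := Fg t tI; have := bF.2 _ ct; have := bg.2 _ ct.
have := normc_ge0 (F (circ r t)); have := normc_ge0 (g (circ r t)).
have := normc_lip (F (circ r t)) (g (circ r t)); rewrite ler_norml => /andP[+ _].
have := normc_ge0 (F (circ r t) - g (circ r t)).
move: (normc (F (circ r t) - g (circ r t))) (normc (F (circ r t))) (normc (g (circ r t))).
clear => d a b d0 h1 b0 a0 b1 a1 h2.
have h : 0 <= (e - (b - a)) * (b + a) by apply: mulr_ge0; lra.
have h' : 0 <= e * (2 - (b + a)) by apply: mulr_ge0; lra.
move: h h'; rewrite !expr2 !mulrBl !mulrBr !mulrDr; lra.
Qed.

Lemma bounded_tail f (M e : R) : (forall n, defect_sum f n <= M) -> 0 < e ->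
  exists m, forall n, defect_sum (fun k => f (m + k)%N) n <= e.
Proof.
move=> SM e0; pose S := range (defect_sum f).
have hS : has_sup S.
  by split; [exists (defect_sum f 0); exists 0%N|exists M => _ [n _ <-]].
have [_ [m _ <-] hm] := sup_adherent e0 hS; exists m => n.
have : defect_sum f (m + n) <= sup S.
  by apply: sup_upper_bound => //; exists (m + n)%N.
by rewrite defect_sumD; lra.
Qed.

(** The index m is fixed by the tail of the series, then the radius by F_m, and only then j by
    convergence on that circle; the loss from F_m to F_(m+j) is bounded uniformly in j. The losses
    add up to 1 + 2 + 2 eighths of [e]. *)
Lemma limit_unit_mean f F (M : R) : fixing_maps f ->
  (forall n, (1 <= n)%N -> unit_mean (f n)) -> near_cvg (iter_comp f) F -> self_map F ->
  (forall n, defect_sum f n <= M) -> unit_mean F.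
Proof.
move=> hf uf fF sF SM e e0; have e8 : 0 < e / 8 by rewrite divr_gt0.
have [m hm] := bounded_tail SM e8.
have [N hN] := iter_comp_unit_mean m hf uf e8; exists N => n /hN h1.
have r01 := rad_itv R n.
have r01' : 0 <= rad R n < 1 by case/andP: r01 => /ltW -> ->.
have [j /(_ (m + j)%N (leq_addl _ _)) hj] := near_cvg_circ fF r01' e8.
have h2 := m2_near sF.1 (iter_comp_self_map (m + j) hf).1 r01' hj.
have hfm := fixing_maps_shift m hf.
have h3 := m2_comp_ge (iter_comp_self_map j hfm) (iter_comp0 j hfm)
  (iter_comp_self_map m hf) (iter_comp0 m hf) r01.
have h4 := le_trans (defect_iter j hfm) (hm j).
have E : m2 (iter_comp f (m + j)) (rad R n) =
    m2 (fun z => iter_comp (fun k => f (m + k)%N) j (iter_comp f m z)) (rad R n).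
  by apply: eq_rmean => t; rewrite iter_compD.
move: h1 h2 h3 h4; rewrite E; lra.
Qed.

Lemma unit_mean_neq0 F : unit_mean F -> (forall z, normc z < 1 -> F z = 0) -> False.
Proof.
move=> uF F0; have e0 : 0 < 1 / 2 :> R by rewrite divr_gt0.
have [n /(_ n (leqnn _))] := uF _ e0.
have /andP[r0 r1] := rad_itv R n.
have -> : m2 F (rad R n) = 0; last by lra.
rewrite /m2 -[RHS]rmean_cst; apply: eq_rmean => t.
by rewrite F0 ?normc0 ?expr0n// normc_circ// ltW.
Qed.

Lemma defect_series_ltoo f : fixing_maps f ->
  (\sum_(1 <= n <oo) (defect (f n))%:E < +oo)%E <-> exists M, forall n, defect_sum f n <= M.
Proof.
move=> hf.
have d0 n : (1 <= n)%N -> true -> (0 <= (defect (f n))%:E)%E.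
  by move=> /hf[sf f0] _; rewrite lee_fin; exact: defect_ge0.
have SE n : (\sum_(1 <= k < n.+1) (defect (f k))%:E)%E = (defect_sum f n)%:E.
  by rewrite sumEFin big_add1 /= big_mkord.
split=> [Soo|[M SM]].
  have S0 : (0 <= \sum_(1 <= n <oo) (defect (f n))%:E)%E by exact: nneseries_ge0.
  exists (fine (\sum_(1 <= n <oo) (defect (f n))%:E)%E) => n.
  rewrite -lee_fin fineK; last by rewrite ge0_fin_numE.
  by rewrite -SE; exact: nneseries_lim_ge.
apply: (@le_lt_trans _ _ M%:E); last exact: ltry.
apply: lime_le; first exact: is_cvg_nneseries.
exists 1%N => // n /= n0; rewrite -(prednK n0) SE lee_fin; exact: SM.
Qed.

End Dichotomy.

Theorem theorem1p1 (R : realType) (f : nat -> R[i] -> R[i]) (F : R[i] -> R[i])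
    (f_inner : forall n : nat, (1 <= n)%N -> inner (f n))
    (f_fix0 : forall n : nat, (1 <= n)%N -> f n 0 = 0)
    (F_maps : maps_disc F)
    (F_lim : cvg_locally_uniformly_disc (iter_comp f) F) :
  (constant_disc F \/ inner F) /\
  (inner F <->
   (\sum_(1 <= n <oo) (1 - normc (derive1 (f n) 0))%:E < +oo)%E).
Proof.
have hf : fixing_maps f.
  by move=> n n1; split; [exact: inner_self_map (f_inner n n1)|exact: f_fix0].
have uf n : (1 <= n)%N -> unit_mean (f n) by move=> n1; exact: inner_unit_mean (f_inner n n1).
have fF := locally_uniformly_near_cvg F_lim.
have sF : self_map F by apply: limit_self_map hf fF _ => z /discE /F_maps /discE.
have sumE := defect_series_ltoo hf.
rewrite /defect /cderiv in sumE.
(* One case split settles both claims: bounded sums make F inner, unbounded ones make it zero, hence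
   constant and not of unit mean, so not inner. *)
have [[M SM]|noM] := pselect (exists M, forall n, defect_sum f n <= M).
  have iF : inner F by exact: unit_mean_inner sF (limit_unit_mean hf uf fF sF SM).
  by split; [right|split=> // _; apply/sumE; exists M].
have Soo M : exists n, M < defect_sum f n.
  apply: contrapT => nM; apply: noM; exists M => n; rewrite leNgt; apply/negP => Mn.
  by apply: nM; exists n.
have F0 z : normc z < 1 -> F z = 0 by exact: limit_eq0 hf fF Soo.
split; first by left; exists 0 => z /discE; exact: F0.
split=> [iF|/sumE//]; exfalso.
exact: unit_mean_neq0 (inner_unit_mean iF) F0.
Qed.
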